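(* Let $f \in \mathcal{N}_{sym}$. Then there exists a modeling reproducing kernel space $\mathcal{L}(f)$ on $U_{ext}(f)$ for $f$. In other words, $f$ has a minimal realization $(\mathcal{L}(f),A,v)$ with $\varrho(A)=U_{ext}(f)$.
   Context: $\mathbb{C}^+$ and $\mathbb{C}^-$ are the open upper and lower half-planes, and $\mathcal{H}^\infty(\mathbb{C}^{+})$ is the space of bounded analytic functions on $\mathbb{C}^+$. $\mathcal{N}(\mathbb{C}^+)$ (functions of bounded type) is the set of meromorphic functions on $\mathbb{C}^+$ of the form $f_1/f_2$ with $f_1,f_2\in\mathcal{H}^\infty(\mathbb{C}^+)$, $f_2\not\equiv 0$; $\mathcal{N}(\mathbb{C}^-)$ is defined analogously. $\mathcal{N}_{sym}$ is the set of meromorphic functions $f$ on $\mathbb{C}\setminus\mathbb{R}$ with $f_{|\mathbb{C}^+}\in\mathcal{N}(\mathbb{C}^+)$, $f_{|\mathbb{C}^-}\in\mathcal{N}(\mathbb{C}^-)$ and $f(\overline{\zeta})=\overline{f(\zeta)}$. $U(f)\subset\mathbb{C}\setminus\mathbb{R}$ is the domain of analyticity of $f$ (the complement of its poles). $U_{ext}(f)$ is the union of $U(f)$ and all $\zeta\in\mathbb{R}$ for which there is an open interval $(a,b)\ni\zeta$ such that $f$ can be analytically extended through $(a,b)$ (there is an analytic function on an open neighbourhood of $(a,b)$ agreeing with $f$ off $\mathbb{R}$); $f$ also denotes the extended function on $U_{ext}(f)$. A Krein space is a complex vector space $\mathcal{K}$ with a sesquilinear form $[\cdot,\cdot]_{\mathcal{K}}$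 that decomposes into a direct orthogonal sum $\mathcal{K}=\mathcal{K}_+[+]\mathcal{K}_-$ such that $(\mathcal{K}_+,[\cdot,\cdot]_{\mathcal{K}})$ and $(\mathcal{K}_-,-[\cdot,\cdot]_{\mathcal{K}})$ are Hilbert spaces; it carries the Hilbert space topology of $\mathcal{K}_+\oplus(-\mathcal{K}_-)$, which does not depend on the decomposition. A relation in $\mathcal{K}$ is a linear subspace $A\subset\mathcal{K}\times\mathcal{K}$; its adjoint is $A^+=\{(u,v):[u,y]_{\mathcal{K}}=[v,x]_{\mathcal{K}}\ \forall (x,y)\in A\}$; $A$ is self-adjoint if $A=A^+$. $\varrho(A)$ is the resolvent set. A realization of an analytic function $q:U\subset\mathbb{C}\to\mathbb{C}$ is a triple $(\mathcal{K},A,v)$ with $\mathcal{K}$ a Krein space, $A$ a self-adjoint relation in $\mathcal{K}$ with $\varrho(A)\neq\emptyset$, $v\in\mathcal{K}$, together with a base point $\zeta_0\in\varrho(A)\cap U$, such that $q(\zeta)=\overline{q(\zeta_0)}+(\zeta-\overline{\zeta_0})[(I+(\zeta-\zeta_0)(A-\zeta)^{-1})v,v]_{\mathcal{K}}$ for all $\zeta\in\varrho(A)\cap U$. It is minimal if $\overline{\mathrm{span}}\{(I+(\zeta-\zeta_0)(A-\zeta)^{-1})v:\zeta\in\varrho(A)\}=\mathcal{K}$. A reproducing kernel Krein space on an open set $\Omega\subset\mathbb{C}$ with kernel $H:\Omega\times\Omega\to\mathbb{C}$ is a Krein space $\mathcal{K}$ of analytic functions on $\Omega$ such that $H(\cdot,w)\in\mathcal{K}$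 and $g(w)=[g,H(\cdot,w)]_{\mathcal{K}}$ for all $w\in\Omega$, $g\in\mathcal{K}$. The Nevanlinna kernel of $f$ is $N_f(\zeta,w)=\frac{f(\zeta)-\overline{f(w)}}{\zeta-\overline{w}}$ for $\zeta\neq\overline{w}$ and $N_f(w,\overline{w})=f'(w)$, $\zeta,w\in U_{ext}(f)$. The difference-quotient operator is $D_w(g)(\zeta)=\frac{g(\zeta)-g(w)}{\zeta-w}$ for $\zeta\ne w$, $D_w(g)(w)=g'(w)$. For $\Omega\subset U_{ext}(f)$ symmetric with respect to $\mathbb{R}$, a modeling reproducing kernel space on $\Omega$ for $f$ is a reproducing kernel Krein space $\mathcal{K}$ on $\Omega$ with kernel $N_f$ such that $D_w:\mathcal{K}\to\mathcal{K}$ is well-defined and bounded for every $w\in\Omega$. The minimal realization associated with a modeling space has $(A-w)^{-1}=D_w$ for $w \in \Omega$ and $v=N_f(\cdot,\overline{\zeta_0})$, $\zeta_0\in\Omega$. *)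

(* Defs.v *)
From HB Require Import structures.
From mathcomp Require Import all_boot all_order all_algebra.
From mathcomp Require Import all_classical all_reals all_analysis.
From mathcomp Require Export complex.

Set Implicit Arguments.
Unset Strict Implicit.
Unset Printing Implicit Defensive.

Import Order.TTheory GRing.Theory Num.Theory.
Import numFieldNormedType.Exports.

Local Open Scope classical_set_scope.
Local Open Scope ring_scope.

(* Everything is defined over an arbitrary numClosedFieldType C, whose topology
   is the one of MathComp-Analysis; the intended instance is C := R[i] with
   R : realType.  In the order of C, x < y means that y - x is real and
   positive; in particular, for real a and b, [set t | a < t < b] is the open
   real interval (a, b). *)

Section Functions.
Variable C : numClosedFieldType.
Implicit Types (f g q : C -> C) (D : set C).

Definition upper_half : set C := [set z | 0 < 'Im z].
Definition lower_half : set C := [set z | 'Im z < 0].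
Definition nonreal : set C := [set z | 'Im z != 0].

Definition analytic_at f (z : C) := \forall w \near z, derivable f w 1.
Definition analytic_on D f := forall z, D z -> analytic_at f z.

(* A meromorphic function is represented by a total function whose values at
   the poles are irrelevant: the two alternatives below exclude each other,
   whatever the value f z. *)
Definition pole_at f (z : C) :=
  (\forall w \near z^', derivable f w 1) /\ (`|f w| @[w --> z^'] --> +oo).
Definition meromorphic_on D f :=
  forall z, D z -> analytic_at f z \/ pole_at f z.

Definition bounded_analytic D f :=
  analytic_on D f /\ exists M : C, forall z, D z -> `|f z| <= M.

(* Since f is meromorphic, the equation f = f1 / f2 off the zeros of f2 forces
   every pole of f to be a zero of f2. *)
Definition bounded_type D f :=
  meromorphic_on D f /\
  exists f1 f2, [/\ bounded_analytic D f1, bounded_analytic D f2,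
    exists2 z, D z & f2 z != 0 &
    forall z, D z -> f2 z != 0 -> f z = f1 z / f2 z].

Definition analyticity_domain f : set C := nonreal `&` analytic_at f.

Definition Nsym f :=
  [/\ bounded_type upper_half f, bounded_type lower_half f &
      forall z, analyticity_domain f z -> f z^* = (f z)^*].

Definition extends_through f (a b : C) := exists (V : set C) g,
  [/\ open V, [set t | a < t < b] `<=` V, analytic_on V g &
      forall z, V z -> nonreal z -> f z = g z].

Definition Uext f : set C := analyticity_domain f `|`
  [set x | exists a b : C, [/\ a \is Num.real, b \is Num.real, a < x < b &
                               extends_through f a b]].

(* The values of f on the real line are irrelevant: at the real points of
   Uext f the extended function is the limit of f from C \ R. *)
Definition fext f (z : C) : C :=
  if 'Im z != 0 then f z else lim (f w @[w --> within nonreal (nbhs z)]).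

Definition nevanlinna_kernel f (z w : C) : C :=
  if z == w^* then derive1 (fext f) z
  else (fext f z - (fext f w)^*) / (z - w^*).

Definition diff_quot (w : C) g (z : C) : C :=
  if z == w then derive1 g w else (g z - g w) / (z - w).

End Functions.

Definition is_subspace (C : numClosedFieldType) (V : lmodType C) (S : set V) :=
  S 0 /\ forall (a : C) x y, S x -> S y -> S (a *: x + y).

(* Krein spaces are realized as linear subspaces of an ambient complex vector
   space V, so that a Krein space of functions is literally a set of functions;
   the form is only meaningful on the subspace. *)
Section KreinSpaces.
Variables (C : numClosedFieldType) (V : lmodType C).
Implicit Types (S : set V) (form : V -> V -> C).

Definition hermitian_on S form :=
  (forall (a : C) x y z, S x -> S y -> S z ->
     form (a *: x + y) z = a * form x z + form y z) /\
  (forall x y, S x -> S y -> form y x = (form x y)^*).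

Definition form_norm form (x : V) : C := sqrtC (form x x).

Definition is_hilbert S form :=
  [/\ is_subspace S, hermitian_on S form,
      forall x, S x -> x != 0 -> 0 < form x x &
      forall u : nat -> V, (forall n, S (u n)) ->
        (forall e : C, 0 < e ->
           \forall m & n \near \oo, form_norm form (u m - u n) < e) ->
        exists2 l, S l & form_norm form (u n - l) @[n --> \oo] --> (0 : C)].

Definition fundamental_decomposition S form (Sp Sm : set V) :=
  [/\ Sp `<=` S /\ Sm `<=` S,
      forall x, S x -> exists p m, [/\ Sp p, Sm m & x = p + m],
      Sp `&` Sm = [set 0] /\ (forall p m, Sp p -> Sm m -> form p m = 0),
      is_hilbert Sp form &
      is_hilbert Sm (fun x y => - form x y)].

Record kreinSpace := KreinSpace {
  kset : set V;
  kform : V -> V -> C;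
  kset_subspace : is_subspace kset;
  kform_hermitian : hermitian_on kset kform;
  kset_decomposition :
    exists Sp Sm, fundamental_decomposition kset kform Sp Sm }.

Implicit Types (K : kreinSpace) (T : V -> V).

(* The norm of Sp [+] (- Sm); xget picks the component of x in Sp. *)
Definition knorm K (Sp Sm : set V) (x : V) : C :=
  let p := xget 0 [set p | Sp p /\ Sm (x - p)] in
  let m := x - p in
  sqrtC (kform K p p - kform K m m).

(* All fundamental decompositions give equivalent norms, so that the
   topological notions may be stated with respect to some decomposition. *)
Definition bounded_operator K T :=
  [/\ forall x, kset K x -> kset K (T x),
      forall (a : C) x y, kset K x -> kset K y ->
        T (a *: x + y) = a *: T x + T y &
      exists Sp Sm, fundamental_decomposition (kset K) (kform K) Sp Sm /\
        exists M : C, forall x, kset K x ->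
          knorm K Sp Sm (T x) <= M * knorm K Sp Sm x].

Definition kdense K S := S `<=` kset K /\
  exists Sp Sm, fundamental_decomposition (kset K) (kform K) Sp Sm /\
    forall x, kset K x -> forall e : C, 0 < e ->
      exists2 y, S y & knorm K Sp Sm (x - y) < e.

Definition lspan S : set V := smallest (@is_subspace C V) S.

Implicit Types (A : set (V * V)).

Definition relation_in K A :=
  is_subspace A /\ (forall x y, A (x, y) -> kset K x /\ kset K y).

Definition adjoint K A : set (V * V) :=
  [set uv | [/\ kset K uv.1, kset K uv.2 &
     forall x y, A (x, y) -> kform K uv.1 y = kform K uv.2 x]].

Definition self_adjoint K A := relation_in K A /\ A = adjoint K A.

Definition graph_on K T : set (V * V) :=
  [set xy | kset K xy.1 /\ xy.2 = T xy.1].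

(* (A - z)^-1 = {(y - z x, x) : (x, y) \in A} *)
Definition resolvent_rel A (z : C) : set (V * V) :=
  [set yx | exists x y, A (x, y) /\ yx = (y - z *: x, x)].

Definition resolvent_set K A : set C :=
  [set z | exists2 T, bounded_operator K T & resolvent_rel A z = graph_on K T].

Definition resolvent A (z : C) (x : V) : V :=
  xget 0 [set y | resolvent_rel A z (x, y)].

Definition gamma A (z0 z : C) (v : V) : V := v + (z - z0) *: resolvent A z v.

Definition realization (U : set C) (q : C -> C) K A (v : V) (z0 : C) :=
  [/\ analytic_on U q, self_adjoint K A, kset K v,
      (resolvent_set K A `&` U) z0 &
      forall z, (resolvent_set K A `&` U) z ->
        q z = (q z0)^* + (z - z0^*) * kform K (gamma A z0 z v) v].

Definition minimal_realization (U : set C) (q : C -> C) K A (v : V) (z0 : C) :=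
  realization U q K A v z0 /\
  kdense K (lspan [set gamma A z0 z v | z in resolvent_set K A]).

End KreinSpaces.

(* A function on an open set W is represented by the total function on C that
   extends it by 0. *)
Section ReproducingKernel.
Variable C : numClosedFieldType.
Implicit Types (W : set C) (f : C -> C) (K : kreinSpace (C -> C)).

Definition zero_ext W (g : C -> C) : C -> C := patch (fun=> 0) W g.

Definition rk_krein_space W (H : C -> C -> C) K :=
  [/\ open W,
      forall g, kset K g -> analytic_on W g /\ zero_ext W g = g,
      forall w, W w -> kset K (zero_ext W (H ^~ w)) &
      forall g w, kset K g -> W w -> g w = kform K g (zero_ext W (H ^~ w))].

Definition diff_quot_op W (w : C) (g : C -> C) : C -> C :=
  zero_ext W (diff_quot w g).

Definition modeling_space W f K :=
  [/\ W `<=` Uext f, forall z, W z -> W z^*,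
      rk_krein_space W (nevanlinna_kernel f) K &
      forall w, W w -> bounded_operator K (diff_quot_op W w)].

Definition associated_realization W f K
    (A : set ((C -> C) * (C -> C))) (v : C -> C) (z0 : C) :=
  [/\ W z0, v = zero_ext W (nevanlinna_kernel f ^~ z0^*),
      forall w, W w -> resolvent_rel A w = graph_on K (diff_quot_op W w) &
      minimal_realization W (fext f) K A v z0].

End ReproducingKernel.

(* Main.v *)
(* On O = Uext f the kernel functions N_w(z) = (phi(z) - phi(w^* )) / (z - w^* ) of
   phi = fext f belong to a Hilbert space H of holomorphic functions, normed by a weighted
   sum of L^2 norms over the boundaries of countably many squares in O, with weights
   adapted to phi.  On H, point evaluations and the difference-quotient operators D_w are
   bounded, and (T F)(z) = <F, N_z> defines a self-adjoint contraction with
   D_w T = T (D_{w^*})^*.  Write T = J S^2, where J is a symmetry commuting with S >= 0.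
   The range of S, with the form [S x, S y] = <J x, y>, is the required Krein space: its
   reproducing kernel is N, and D_w is bounded on it by the theorem of Krein and Lax on
   symmetrizable operators.  A point outside O cannot lie in the resolvent set, since the
   Neumann series of the resolvent would extend phi holomorphically to it. *)

Require Import Defs.
From HB Require Import structures.
From mathcomp Require Import all_boot all_order all_algebra.
From mathcomp Require Import all_classical all_reals all_analysis.
From mathcomp Require Import ring lra.

Set Implicit Arguments.
Unset Strict Implicit.
Unset Printing Implicit Defensive.

Import Order.TTheory GRing.Theory Num.Theory.
Import numFieldNormedType.Exports.

Local Open Scope classical_set_scope.
Local Open Scope ring_scope.

(** * Complex differentiation *)

(** The kernel of [f] may have infinitely many positive and negative squares, so the space cannot be
    built by completing a definite form up to a finite defect; the sign has to be carried by [J] on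
    an auxiliary Hilbert space. That space is chosen for the sake of two bounds. Weights that decay
    fast against the divided differences of [phi] on pairs of squares make [T] a contraction, and
    the Cauchy formula on one square bounds evaluation and difference quotients. The intertwining
    relation is a three-point identity for divided differences, read as N_w - N_u = (conj w - conj
    u) D_{conj u} N_w. The real obstacle is that [S] has no bounded inverse, so boundedness of D_w
    on H does not by itself give an estimate in the norm of the range of [S]; the intertwining
    relation makes the adjoint of D_w symmetrizable for the seminorm |S x|, and this yields the
    estimate. Squares are used because their boundary integrals split into four integrals over real
    intervals: Goursat's theorem, the Cauchy formula and the mean-square norms all rest on
    one-variable integration. *)

Lemma exists_pow2_gt (R : realType) (x : R) : exists n : nat, x < 2 ^+ n.
Proof.
exists (Num.bound `|x|); apply: le_lt_trans (ler_norm x) _.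
apply: lt_trans (archi_boundP (normr_ge0 x)) _.
by rewrite -natrX ltr_nat ltn_expl.
Qed.

Section Modulus.
Variable R : realType.
Implicit Types (z w : R[i]).

Definition cmod z : R := Normc.normc z.

Lemma cmodE z : `|z| = ((cmod z)%:C)%C. Proof. by case: z. Qed.
Lemma cmod0 : cmod 0 = 0. Proof. exact: Normc.normc0. Qed.
Lemma cmod1 : cmod 1 = 1. Proof. exact: Normc.normc1. Qed.
Lemma cmodM z w : cmod (z * w) = cmod z * cmod w. Proof. exact: Normc.normcM. Qed.
Lemma cmodV z : cmod z^-1 = (cmod z)^-1. Proof. exact: Normc.normcV. Qed.
Lemma cmodN z : cmod (- z) = cmod z. Proof. exact: normcN. Qed.
Lemma cmodB z w : cmod (z - w) = cmod (w - z). Proof. by rewrite -cmodN opprB. Qed.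
Lemma cmodD z w : cmod (z + w) <= cmod z + cmod w. Proof. exact: le_normcD. Qed.
Lemma cmodX z n : cmod (z ^+ n) = cmod z ^+ n.
Proof. by elim: n => [|n IH]; rewrite ?expr0 ?cmod1 // !exprS cmodM IH. Qed.
Lemma cmod_ge0 z : 0 <= cmod z. Proof. by case: z => a b; exact: sqrtr_ge0. Qed.
Lemma cmod_eq0 z : (cmod z == 0) = (z == 0).
Proof. by apply/eqP/eqP => [/Normc.eq0_normc|->]; rewrite ?cmod0. Qed.
Lemma cmod_gt0 z : (0 < cmod z) = (z != 0).
Proof. by rewrite lt_def cmod_ge0 andbT cmod_eq0. Qed.
Lemma cmod_triangle y z w : cmod (z - w) <= cmod (z - y) + cmod (y - w).
Proof. by rewrite -[z - w](subrKA y) cmodD. Qed.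
Lemma cmod_real (x : R) : cmod (x%:C)%C = `|x|.
Proof. by rewrite /cmod /= expr0n addr0 sqrtr_sqr. Qed.
Lemma cmod_conj z : cmod (conjc z) = cmod z.
Proof. by case: z => a b; rewrite /cmod /= sqrrN. Qed.
Lemma cmod_i : cmod ('i)%C = 1.
Proof. by rewrite /cmod /= expr0n expr1n add0r sqrtr1. Qed.
Lemma cmod_sqr z : cmod z ^+ 2 = complex.Re z ^+ 2 + complex.Im z ^+ 2.
Proof. by case: z => a b; rewrite /cmod sqr_sqrtr ?addr_ge0 ?sqr_ge0. Qed.
Lemma Re_le_cmod z : `|complex.Re z| <= cmod z.
Proof.
rewrite -(@ler_pXn2r _ 2) ?nnegrE ?cmod_ge0 // cmod_sqr real_normK ?num_real //.
by rewrite lerDl sqr_ge0.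
Qed.
Lemma Im_le_cmod z : `|complex.Im z| <= cmod z.
Proof.
rewrite -(@ler_pXn2r _ 2) ?nnegrE ?cmod_ge0 // cmod_sqr real_normK ?num_real //.
by rewrite lerDr sqr_ge0.
Qed.
Lemma cmod_le_ReIm z : cmod z <= `|complex.Re z| + `|complex.Im z|.
Proof.
rewrite -(@ler_pXn2r _ 2) ?nnegrE ?cmod_ge0 ?addr_ge0 // cmod_sqr sqrrD.
rewrite !real_normK ?num_real // lerD2r lerDl mulrn_wge0 //.
Qed.
Lemma mul_conjc z : z * conjc z = ((cmod z ^+ 2)%:C)%C.
Proof. by rewrite -sqr_normc cmodE -rmorphXn. Qed.
Lemma cmod_dist_dist z w : `|cmod z - cmod w| <= cmod (z - w).
Proof.
rewrite ler_norml; have := cmodD (z - w) w; have := cmodD (w - z) z.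
by rewrite !subrK (cmodB w z); lra.
Qed.
Lemma sqr_le_of_le2 (x c : R) : 0 <= c -> x ^+ 2 <= c ^+ 2 -> x <= c.
Proof. by move=> c0 h; apply: le_trans (ler_norm _) _; rewrite -(@ler_pXn2r _ 2) ?nnegrE // real_normK ?num_real. Qed.
End Modulus.
Arguments cmod : simpl never.

Section ContinuityAndDerivative.
Variable R : realType.
Implicit Types (f g q : R[i] -> R[i]) (z w l : R[i]).

Definition ccont f z := forall e : R, 0 < e ->
  exists2 d : R, 0 < d & forall w, cmod (w - z) < d -> cmod (f w - f z) < e.

Definition cball z (r : R) : set R[i] := [set w | cmod (w - z) < r].

Definition cnear z (P : R[i] -> Prop) := exists2 d : R, 0 < d & forall w, cmod (w - z) < d -> P w.

Lemma cnearI z P Q : cnear z P -> cnear z Q -> cnear z (fun w => P w /\ Q w).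
Proof.
move=> [d d0 hP] [e e0 hQ]; exists (Num.min d e); first by rewrite lt_min d0.
by move=> w; rewrite lt_min => /andP[wd we]; split; [exact: hP|exact: hQ].
Qed.

Lemma cnearW z (P Q : R[i] -> Prop) : (forall w, P w -> Q w) -> cnear z P -> cnear z Q.
Proof. by move=> PQ [d d0 h]; exists d => // w /h /PQ. Qed.

Lemma cnear_pt z (P : R[i] -> Prop) : cnear z P -> P z.
Proof. by move=> [d d0]; apply; rewrite subrr cmod0. Qed.

Lemma cnear_cball z (r : R) : 0 < r -> cnear z (cball z r).
Proof. by move=> r0; exists r. Qed.

Lemma cnear_open z w (r : R) : cmod (w - z) < r -> cnear w (cball z r).
Proof.
move=> h; exists (r - cmod (w - z)); first by rewrite subr_gt0.
by move=> y hy; rewrite /cball /=; have := cmod_triangle w y z; lra.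
Qed.

Lemma cnear_near z (P : R[i] -> Prop) : cnear z P -> cnear z (fun w => cnear w P).
Proof.
move=> [d d0 h]; exists d => // w wz.
by apply: cnearW (cnear_open wz).
Qed.

Lemma ccont_cst l z : ccont (fun=> l) z.
Proof. by move=> e e0; exists 1 => // w _; rewrite subrr cmod0. Qed.
Lemma ccont_id z : ccont id z.
Proof. by move=> e e0; exists e. Qed.
Lemma ccont_conj z : ccont conjc z.
Proof. by move=> e e0; exists e => // w; rewrite -rmorphB cmod_conj. Qed.

Lemma ccont_local f g z : cnear z (fun w => f w = g w) -> ccont f z -> ccont g z.
Proof.
move=> fg cf e /cf /(cnearI fg) h; apply: cnearW h => w [<-].
by rewrite (cnear_pt fg).
Qed.

Lemma ccontD f g z : ccont f z -> ccont g z -> ccont (fun w => f w + g w) z.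
Proof.
move=> cf cg e e0; have e2 : 0 < e / 2 by rewrite divr_gt0.
apply: cnearW (cnearI (cf _ e2) (cg _ e2)) => w [h1 h2].
rewrite opprD addrACA; apply: le_lt_trans (cmodD _ _) _; lra.
Qed.

Lemma ccontN f z : ccont f z -> ccont (fun w => - f w) z.
Proof. by move=> cf e /cf; apply: cnearW => w; rewrite -opprD cmodN. Qed.

Lemma ccontB f g z : ccont f z -> ccont g z -> ccont (fun w => f w - g w) z.
Proof. by move=> cf cg; apply: ccontD => //; apply: ccontN. Qed.

Lemma ccont_comp f g z : ccont f z -> ccont g (f z) -> ccont (fun w => g (f w)) z.
Proof. by move=> cf cg e /cg [d /cf h hg]; apply: cnearW h => w /hg. Qed.

Lemma ccont_bounded f z : ccont f z -> cnear z (fun w => cmod (f w) < cmod (f z) + 1).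
Proof.
move=> /(_ 1 ltr01); apply: cnearW => w h.
by rewrite -(subrK (f z) (f w)); apply: le_lt_trans (cmodD _ _) _; lra.
Qed.

Lemma ccontM f g z : ccont f z -> ccont g z -> ccont (fun w => f w * g w) z.
Proof.
move=> cf cg e e0.
have p1 : 0 < cmod (f z) + 1 by rewrite ltr_wpDl ?cmod_ge0.
have p2 : 0 < cmod (g z) + 1 by rewrite ltr_wpDl ?cmod_ge0.
have e1 : 0 < e / 2 / (cmod (f z) + 1) by rewrite !divr_gt0.
have e2 : 0 < e / 2 / (cmod (g z) + 1) by rewrite !divr_gt0.
apply: cnearW (cnearI (ccont_bounded cf) (cnearI (cf _ e2) (cg _ e1))) => w [b [h1 h2]].
have -> : f w * g w - f z * g z = f w * (g w - g z) + (f w - f z) * g z by ring.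
apply: le_lt_trans (cmodD _ _) _; rewrite !cmodM.
have : cmod (f w) * cmod (g w - g z) <= (cmod (f z) + 1) * (e / 2 / (cmod (f z) + 1)).
  by apply: ler_pM; rewrite ?cmod_ge0 // ltW.
have : cmod (f w - f z) * cmod (g z) < (e / 2 / (cmod (g z) + 1)) * (cmod (g z) + 1).
  apply: (@le_lt_trans _ _ ((e / 2 / (cmod (g z) + 1)) * cmod (g z))).
    by apply: ler_wpM2r; rewrite ?cmod_ge0 // ltW.
  by rewrite ltr_pM2l // ltrDl.
rewrite [X in _ < X]divfK ?gt_eqF // [X in _ <= X]mulrC divfK ?gt_eqF //; lra.
Qed.

Lemma ccont_neq0 f z : ccont f z -> f z != 0 -> cnear z (fun w => cmod (f z) / 2 < cmod (f w)).
Proof.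
move=> cf fz0; have e0 : 0 < cmod (f z) / 2 by rewrite divr_gt0 // cmod_gt0.
apply: cnearW (cf _ e0) => w h.
have := cmodD (f z - f w) (f w); rewrite subrK cmodB; lra.
Qed.

Lemma ccontV f z : ccont f z -> f z != 0 -> ccont (fun w => (f w)^-1) z.
Proof.
move=> cf fz0 e e0; have m0 : 0 < cmod (f z) by rewrite cmod_gt0.
have e1 : 0 < e * (cmod (f z) ^+ 2 / 2) by rewrite mulr_gt0 // divr_gt0 // exprn_gt0.
apply: cnearW (cnearI (ccont_neq0 cf fz0) (cf _ e1)) => w [h1 h2].
have w0 : 0 < cmod (f w) by apply: lt_trans h1; rewrite divr_gt0.
have fw0 : f w != 0 by rewrite -cmod_gt0.
have -> : (f w)^-1 - (f z)^-1 = (f z - f w) / (f w * f z) by field; rewrite fz0 fw0.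
rewrite cmodM cmodV cmodM cmodB ltr_pdivrMr ?mulr_gt0 //.
apply: lt_le_trans h2 _; rewrite ler_pM2l //.
rewrite expr2 mulrAC; apply: ler_wpM2r; [exact: cmod_ge0|exact: ltW].
Qed.

Lemma cnear_neq z w : z != w -> cnear z (fun y => y != w).
Proof.
rewrite -subr_eq0 -cmod_gt0 => h; exists (cmod (z - w)) => // y hy.
by apply/eqP => yw; move: hy; rewrite yw cmodB ltxx.
Qed.

(* Caratheodory's formulation of the complex derivative. *)
Definition cder f z l := exists2 q, ccont q z /\ q z = l &
  cnear z (fun w => f w = f z + q w * (w - z)).

Definition cdiff f z := exists l, cder f z l.

Lemma cder_cont f z l : cder f z l -> ccont f z.
Proof.
move=> [q [cq _] h]; apply: ccont_local (cnearW (fun w (e : _ = _) => esym e) h) _.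
apply: ccontD; first exact: ccont_cst.
by apply: ccontM => //; apply: ccontB; [exact: ccont_id|exact: ccont_cst].
Qed.

Lemma cdiff_cont f z : cdiff f z -> ccont f z. Proof. by case=> l /cder_cont. Qed.

Lemma cder_local f g z l : cnear z (fun w => f w = g w) -> cder f z l -> cder g z l.
Proof.
move=> fg [q hq h]; exists q => //; apply: cnearW (cnearI fg h) => w [<- ->].
by rewrite (cnear_pt fg).
Qed.

Lemma cdiff_local f g z : cnear z (fun w => f w = g w) -> cdiff f z -> cdiff g z.
Proof. by move=> fg [l /(cder_local fg)]; exists l. Qed.

Lemma cder_cst l z : cder (fun=> l) z 0.
Proof.
exists (fun=> 0); first by split=> //; exact: ccont_cst.
by exists 1 => // w _; rewrite mul0r addr0.
Qed.
Lemma cder_id z : cder id z 1.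
Proof.
exists (fun=> 1); first by split=> //; exact: ccont_cst.
by exists 1 => // w _; rewrite mul1r addrC subrK.
Qed.
Lemma cderD f g z a b : cder f z a -> cder g z b -> cder (fun w => f w + g w) z (a + b).
Proof.
move=> [p [cp <-] hp] [q [cq <-] hq]; exists (fun w => p w + q w); first by split=> //; apply: ccontD.
by apply: cnearW (cnearI hp hq) => w [-> ->]; ring.
Qed.
Lemma cderM f g z a b : cder f z a -> cder g z b ->
  cder (fun w => f w * g w) z (a * g z + f z * b).
Proof.
move=> df dg; have cg := cder_cont dg.
move: df dg => [p [cp <-] hp] [q [cq <-] hq].
exists (fun w => p w * g w + f z * q w).
  by split=> //; apply: ccontD; apply: ccontM => //; exact: ccont_cst.
by apply: cnearW (cnearI hp hq) => w [-> ->]; ring.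
Qed.
Lemma cderV f z a : cder f z a -> f z != 0 ->
  cder (fun w => (f w)^-1) z (- a / (f z) ^+ 2).
Proof.
move=> df fz0; have cf := cder_cont df; move: df => [p [cp <-] hp].
exists (fun w => - p w / (f w * f z)).
  split; last by rewrite expr2.
  apply: ccontM; first exact: ccontN.
  by apply: ccontV; [apply: ccontM => //; exact: ccont_cst|rewrite mulf_neq0].
apply: cnearW (cnearI hp (ccont_neq0 cf fz0)) => w [h h1].
have fw0 : f w != 0 by rewrite -cmod_gt0; apply: lt_trans h1; rewrite divr_gt0 // cmod_gt0.
have pe : p w * (w - z) = f w - f z by rewrite h addrAC subrr add0r.
have -> : - p w / (f w * f z) * (w - z) = - (p w * (w - z)) / (f w * f z) by field; rewrite fz0 fw0.
by rewrite pe; field; rewrite fz0 fw0.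
Qed.

Lemma cdiff_cst l z : cdiff (fun=> l) z. Proof. by exists 0; exact: cder_cst. Qed.
Lemma cdiff_id z : cdiff id z. Proof. by exists 1; exact: cder_id. Qed.
Lemma cdiffD f g z : cdiff f z -> cdiff g z -> cdiff (fun w => f w + g w) z.
Proof. by move=> [a ha] [b hb]; exists (a + b); exact: cderD. Qed.
Lemma cdiffM f g z : cdiff f z -> cdiff g z -> cdiff (fun w => f w * g w) z.
Proof. by move=> [a ha] [b hb]; exists (a * g z + f z * b); exact: cderM. Qed.
Lemma cdiffZ l f z : cdiff f z -> cdiff (fun w => l * f w) z.
Proof. by move=> h; apply: cdiffM => //; exact: cdiff_cst. Qed.
Lemma cdiffV f z : cdiff f z -> f z != 0 -> cdiff (fun w => (f w)^-1) z.
Proof. by move=> [a ha] h; exists (- a / (f z) ^+ 2); exact: cderV. Qed.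
Lemma cdiffN f z : cdiff f z -> cdiff (fun w => - f w) z.
Proof.
move=> h; apply: cdiff_local (cdiffZ (-1) h).
by exists 1 => // w _; rewrite mulN1r.
Qed.
Lemma cdiffB f g z : cdiff f z -> cdiff g z -> cdiff (fun w => f w - g w) z.
Proof. by move=> hf hg; apply: cdiffD => //; exact: cdiffN. Qed.

(** A gap between the values at [z] would persist at a nearby point z + d/2, which differs from [z].
    This is the tool by which identities between difference quotients are extended to the
    diagonal. *)
Lemma ccont_unique f g z : ccont f z -> ccont g z ->
  cnear z (fun w => w != z -> f w = g w) -> f z = g z.
Proof.
move=> cf cg h; apply/eqP; rewrite -subr_eq0 -cmod_eq0; apply/negPn/negP => n0.
have e0 : 0 < cmod (f z - g z) by rewrite lt_def n0 cmod_ge0.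
have e2 : 0 < cmod (f z - g z) / 2 by rewrite divr_gt0.
have [d d0 H] := cnearI h (cnearI (cf _ e2) (cg _ e2)).
have [] := H (z + ((d / 2)%:C)%C).
  by rewrite addrC addKr cmod_real ger0_norm ?divr_ge0 ?ltW //; lra.
have nz : z + ((d / 2)%:C)%C != z.
  by rewrite -subr_eq0 addrC addKr -cmod_eq0 cmod_real normr_eq0; lra.
move=> /(_ nz) -> [h1 h2].
have := cmod_triangle (g (z + ((d / 2)%:C)%C)) (f z) (g z).
by rewrite (cmodB (f z) (g (z + _))); lra.
Qed.

Lemma cder_unique f z a b : cder f z a -> cder f z b -> a = b.
Proof.
move=> [p [cp <-] hp] [q [cq <-] hq]; apply: ccont_unique => //.
apply: cnearW (cnearI hp hq) => w [-> /addrI] e wz.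
by apply: (mulIf _ e); rewrite subr_eq0.
Qed.

End ContinuityAndDerivative.
(** * Integration over rectangles and Cauchy's formula *)

Section ComplexIntegral.
Variable R : realType.
Implicit Types (g h : R -> R[i]) (a b c t : R).
Local Notation mu := (@lebesgue_measure R).

Definition rcont g t := forall e : R, 0 < e ->
  exists2 d : R, 0 < d & forall s, `|s - t| < d -> cmod (g s - g t) < e.

Definition rcontin a b g := forall t, a <= t <= b -> rcont g t.

Definition cint a b g : R[i] :=
  Complex (\int[mu]_(t in `[a, b]) complex.Re (g t)) (\int[mu]_(t in `[a, b]) complex.Im (g t)).

Lemma ReD (x y : R[i]) : complex.Re (x + y) = complex.Re x + complex.Re y.
Proof. by case: x; case: y. Qed.
Lemma ImD (x y : R[i]) : complex.Im (x + y) = complex.Im x + complex.Im y.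
Proof. by case: x; case: y. Qed.
Lemma ReB (x y : R[i]) : complex.Re (x - y) = complex.Re x - complex.Re y.
Proof. by case: x; case: y. Qed.
Lemma ImB (x y : R[i]) : complex.Im (x - y) = complex.Im x - complex.Im y.
Proof. by case: x; case: y. Qed.

Lemma rcont_real (g : R -> R[i]) (p : R[i] -> R) t :
  (forall x y, p (x - y) = p x - p y) -> (forall x, `|p x| <= cmod x) ->
  rcont g t -> {for t, continuous (p \o g)}.
Proof.
move=> pB ple cg; apply/cvgrPdist_lt => /= e e0; have [d d0 h] := cg e e0.
near=> s; rewrite -pB; apply: le_lt_trans (ple _) _; rewrite cmodB; apply: h.
rewrite distrC; near: s; exact: cvgr_dist_lt.
Unshelve. all: by end_near. Qed.

Lemma integrable_cont (p : R -> R) a b :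
  (forall t, a <= t <= b -> {for t, continuous p}) ->
  mu.-integrable `[a, b] (EFin \o p).
Proof.
move=> cp; apply: continuous_compact_integrable; first exact: segment_compact.
apply: continuous_in_subspaceT => t /set_mem /=.
by rewrite in_itv /= => /cp.
Qed.

Lemma integrable_Re a b g : rcontin a b g -> mu.-integrable `[a, b] (EFin \o (@complex.Re R \o g)).
Proof.
move=> cg; apply: integrable_cont => t /cg; apply: rcont_real; [exact: ReB|exact: Re_le_cmod].
Qed.
Lemma integrable_Im a b g : rcontin a b g -> mu.-integrable `[a, b] (EFin \o (@complex.Im R \o g)).
Proof.
move=> cg; apply: integrable_cont => t /cg; apply: rcont_real; [exact: ImB|exact: Im_le_cmod].
Qed.

Lemma rcont_comp (F : R[i] -> R[i]) g t : rcont g t -> ccont F (g t) -> rcont (fun s => F (g s)) t.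
Proof. by move=> cg cF e /cF [d /cg [d' d'0 h] hF]; exists d' => // s /h /hF. Qed.

Lemma rcontZ l g t : rcont g t -> rcont (fun s => l * g s) t.
Proof.
move=> cg; apply: (rcont_comp (F := fun z => l * z)) => //.
by apply: ccontM; [exact: ccont_cst|exact: ccont_id].
Qed.

Lemma cintD a b g h : rcontin a b g -> rcontin a b h ->
  cint a b (fun t => g t + h t) = cint a b g + cint a b h.
Proof.
move=> cg ch; rewrite /cint; simpc; congr Complex.
  under eq_Rintegral do rewrite ReD.
  by rewrite RintegralD //; exact: integrable_Re.
under eq_Rintegral do rewrite ImD.
by rewrite RintegralD //; exact: integrable_Im.
Qed.

Lemma cintZ a b l g : rcontin a b g -> cint a b (fun t => l * g t) = l * cint a b g.
Proof.
move=> cg; case: l => x y; rewrite /cint; simpc.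
have iR := integrable_Re cg; have iI := integrable_Im cg.
have Z (k : R) (p : R -> R) : mu.-integrable `[a, b] (EFin \o p) ->
    mu.-integrable `[a, b] (EFin \o (fun t => k * p t)).
  move=> ip; rewrite (_ : _ \o _ = (fun t => (k%:E * (EFin \o p) t)%E)).
    by apply: integrableZl.
  by apply/funext => t /=; rewrite EFinM.
congr Complex.
  rewrite (_ : (fun t => complex.Re _) = (fun t => x * complex.Re (g t) - y * complex.Im (g t))); last first.
    by apply/funext => t; case: (g t).
  rewrite RintegralB //; [|exact: Z..].
  by rewrite !RintegralZl.
rewrite (_ : (fun t => complex.Im _) = (fun t => x * complex.Im (g t) + y * complex.Re (g t))); last first.
  by apply/funext => t; case: (g t).
rewrite RintegralD //; [|exact: Z..].
by rewrite !RintegralZl.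
Qed.

Lemma cintN a b g : rcontin a b g -> cint a b (fun t => - g t) = - cint a b g.
Proof.
move=> cg; rewrite -mulN1r -cintZ //; congr cint.
by apply/funext => t; rewrite mulN1r.
Qed.

Lemma cintB a b g h : rcontin a b g -> rcontin a b h ->
  cint a b (fun t => g t - h t) = cint a b g - cint a b h.
Proof.
move=> cg ch; rewrite -cintN //; apply: cintD => // t /ch ct.
by move: (rcontZ (-1) ct); congr rcont; apply/funext => s; rewrite mulN1r.
Qed.

Lemma Rint_split a b c (p : R -> R) : a <= c -> c <= b -> mu.-integrable `[a, b] (EFin \o p) ->
  \int[mu]_(t in `[a, b]) p t = \int[mu]_(t in `[a, c]) p t + \int[mu]_(t in `[c, b]) p t.
Proof.
move=> ac cb ip.
have h := @Rintegral_itvB R p (BLeft a) (BRight b) c ip.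
rewrite -(@Rintegral_itv_obnd_cbnd R c (BRight b)); last first.
  apply: integrableS ip => //.
  by apply: subset_itvr; rewrite bnd_simp.
by rewrite -h ?bnd_simp // addrC subrK.
Qed.

Lemma cint_split a b c g : a <= c -> c <= b -> rcontin a b g ->
  cint a b g = cint a c g + cint c b g.
Proof.
move=> ac cb cg; rewrite /cint; simpc; congr Complex; apply: Rint_split => //.
  exact: integrable_Re.
exact: integrable_Im.
Qed.

Lemma cint_cst a b l : a <= b -> cint a b (fun=> l) = ((b - a)%:C)%C * l.
Proof.
move=> ab; rewrite /cint !Rintegral_cst //= lebesgue_measure_itv /= lte_fin.
have -> : fine (if (a < b)%R then b%:E - a%:E else 0)%E = b - a.
  by case: ifPn => //; rewrite -leNgt => ba; apply/esym/eqP; rewrite subr_eq0 eq_le ab ba.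
by case: l => x y; simpc; rewrite ![_ * (b - a)]mulrC.
Qed.

Lemma eq_cint a b g h : (forall t, a <= t <= b -> g t = h t) -> cint a b g = cint a b h.
Proof.
move=> gh; rewrite /cint; congr Complex; apply: eq_Rintegral => t /set_mem /=;
by rewrite in_itv /= => /gh ->.
Qed.

Lemma le_Re_cint a b g h : rcontin a b g -> rcontin a b h ->
  (forall t, a <= t <= b -> complex.Re (g t) <= complex.Re (h t)) ->
  complex.Re (cint a b g) <= complex.Re (cint a b h).
Proof.
move=> cg ch gh; by apply: (le_Rintegral _ (integrable_Re cg) (integrable_Re ch)).
Qed.

Lemma Im_cint_eq0 a b g : (forall t, a <= t <= b -> complex.Im (g t) = 0) -> complex.Im (cint a b g) = 0.
Proof.
move=> h; transitivity (\int[mu]_(t in `[a, b]) (0 : R)); last first.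
  by rewrite Rintegral_cst // mul0r.
by apply: eq_Rintegral => t /set_mem /=; rewrite in_itv /= => /h.
Qed.

Lemma cint_conj a b g : rcontin a b g -> cint a b (fun t => conjc (g t)) = conjc (cint a b g).
Proof.
move=> cg; rewrite /cint /=; congr Complex.
  by apply: eq_Rintegral => t _; case: (g t).
rewrite -mulN1r -RintegralZl //; last exact: integrable_Im.
by apply: eq_Rintegral => t _; case: (g t) => x y /=; rewrite mulN1r.
Qed.

(** The factor 2 comes from estimating the real and the imaginary part separately; only finite
    constants matter later. *)
Lemma cint_bound a b g (M : R) : a <= b -> rcontin a b g -> (forall t, a <= t <= b -> cmod (g t) <= M) ->
  cmod (cint a b g) <= 2 * (b - a) * M.
Proof.
move=> ab cg hM.
have ic : mu.-integrable `[a, b] (EFin \o (fun=> M : R)).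
  by apply: integrable_cont => t _; exact: cvg_cst.
have P (p : R[i] -> R) : mu.-integrable `[a, b] (EFin \o (p \o g)) -> (forall z, `|p z| <= cmod z) ->
    `|\int[mu]_(t in `[a, b]) p (g t)| <= (b - a) * M.
  move=> ip hp; apply: le_trans (le_normr_Rintegral _ ip) _ => //.
  have -> : (b - a) * M = \int[mu]_(t in `[a, b]) M.
    have := cint_cst (M%:C)%C ab => /(congr1 (@complex.Re R)) /=.
    by rewrite mulr0 subr0.
  apply: le_Rintegral => //.
    have := integrable_norm ip.
    by apply: eq_integrable.
  by move=> t /=; rewrite in_itv /= => /hM h; apply: le_trans (hp _) h.
apply: le_trans (cmod_le_ReIm _) _.
rewrite /cint /= -mulrA mulr2n mulrDl !mul1r; apply: lerD.
  by apply: P; [exact: integrable_Re|exact: Re_le_cmod].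
by apply: P; [exact: integrable_Im|exact: Im_le_cmod].
Qed.

End ComplexIntegral.
Arguments cint : simpl never.
Section Rectangles.
Variable R : realType.
Implicit Types (F G : R[i] -> R[i]) (a b c d e x y t m : R) (z w : R[i]).
Local Notation Re := (@complex.Re R).
Local Notation Im := (@complex.Im R).

Definition inrect a b c d z := (a <= Re z <= b) && (c <= Im z <= d).
Definition bdrect a b c d z := inrect a b c d z /\
  [|| Re z == a, Re z == b, Im z == c | Im z == d].

Definition hint F y a b := cint a b (fun x => F (Complex x y)).
Definition vint F x c d := cint c d (fun y => F (Complex x y)).

(** The counterclockwise contour integral: the top and left sides enter with a minus sign, and dz =
    i dy on the vertical sides. *)
Definition oint a b c d F : R[i] :=
  hint F c a b - hint F d a b + ('i)%C * (vint F b c d - vint F a c d).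

Definition bdcont a b c d F := forall z, bdrect a b c d z -> ccont F z.

Lemma rcont_hor y t : rcont (fun x : R => Complex x y) t.
Proof.
move=> e e0; exists e => // s h.
by have -> : Complex s y - Complex t y = ((s - t)%:C)%C; [simpc|rewrite cmod_real].
Qed.

Lemma rcont_ver x t : rcont (fun y : R => Complex x y) t.
Proof.
move=> e e0; exists e => // s h.
have -> : Complex x s - Complex x t = ('i)%C * ((s - t)%:C)%C by simpc.
by rewrite cmodM cmod_i mul1r cmod_real.
Qed.

Lemma bdcont_sides a b c d F : a <= b -> c <= d -> bdcont a b c d F ->
  [/\ rcontin a b (fun x => F (Complex x c)), rcontin a b (fun x => F (Complex x d)),
      rcontin c d (fun y => F (Complex a y)) & rcontin c d (fun y => F (Complex b y))].
Proof.
move=> ab cd h; split=> t /andP[t1 t2].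
- apply: (rcont_comp (g := fun x => Complex x c)); first exact: rcont_hor.
  by apply: h; rewrite /bdrect /inrect /= t1 t2 cd lexx eqxx ?orbT.
- apply: (rcont_comp (g := fun x => Complex x d)); first exact: rcont_hor.
  by apply: h; rewrite /bdrect /inrect /= t1 t2 cd lexx eqxx ?orbT.
- apply: (rcont_comp (g := fun y => Complex a y)); first exact: rcont_ver.
  by apply: h; rewrite /bdrect /inrect /= t1 t2 ab lexx eqxx.
- apply: (rcont_comp (g := fun y => Complex b y)); first exact: rcont_ver.
  by apply: h; rewrite /bdrect /inrect /= t1 t2 ab lexx eqxx ?orbT.
Qed.

Lemma ointD a b c d F G : a <= b -> c <= d -> bdcont a b c d F -> bdcont a b c d G ->
  oint a b c d (fun z => F z + G z) = oint a b c d F + oint a b c d G.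
Proof.
move=> ab cd /(bdcont_sides ab cd)[f1 f2 f3 f4] /(bdcont_sides ab cd)[g1 g2 g3 g4].
by rewrite /oint /hint /vint !cintD //; ring.
Qed.

Lemma ointZ a b c d l F : a <= b -> c <= d -> bdcont a b c d F ->
  oint a b c d (fun z => l * F z) = l * oint a b c d F.
Proof.
move=> ab cd /(bdcont_sides ab cd)[f1 f2 f3 f4].
by rewrite /oint /hint /vint !cintZ //; ring.
Qed.

Lemma bdcontZ a b c d l F : bdcont a b c d F -> bdcont a b c d (fun z => l * F z).
Proof. by move=> h z /h; apply: ccontM; exact: ccont_cst. Qed.
Lemma bdcontB a b c d F G : bdcont a b c d F -> bdcont a b c d G -> bdcont a b c d (fun z => F z - G z).
Proof. by move=> f g z zb; apply: ccontB; [exact: f|exact: g]. Qed.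

Lemma ointB a b c d F G : a <= b -> c <= d -> bdcont a b c d F -> bdcont a b c d G ->
  oint a b c d (fun z => F z - G z) = oint a b c d F - oint a b c d G.
Proof.
move=> ab cd /(bdcont_sides ab cd)[f1 f2 f3 f4] /(bdcont_sides ab cd)[g1 g2 g3 g4].
by rewrite /oint /hint /vint !cintB //; ring.
Qed.

Lemma eq_oint a b c d F G : a <= b -> c <= d -> (forall z, bdrect a b c d z -> F z = G z) ->
  oint a b c d F = oint a b c d G.
Proof.
move=> ab cd h; rewrite /oint /hint /vint.
congr (_ - _ + _ * (_ - _)); apply: eq_cint => t /andP[t1 t2]; apply: h;
  by rewrite /bdrect /inrect /= t1 t2 ?ab ?cd lexx eqxx ?orbT.
Qed.

(** The two copies of the integral along the cut cancel. Continuity is asked only on the boundary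
    and on the cut, so a singularity elsewhere inside is allowed; [oint_deform] relies on this. *)
Lemma oint_splitv a b c d m F : a <= m <= b -> c <= d ->
  (forall z, inrect a b c d z -> (Re z == m) || ~~ [&& a < Re z < b & c < Im z < d] -> ccont F z) ->
  oint a b c d F = oint a m c d F + oint m b c d F.
Proof.
move=> /andP[am mb] cd h; have ab := le_trans am mb.
have bc : bdcont a b c d F.
  move=> z [zi zb]; apply: h => //; apply/orP; right.
  by apply/negP => /and3P[/andP[z1 z2] z3 z4]; move: zb; rewrite (gt_eqF z1) (lt_eqF z2) (gt_eqF z3) (lt_eqF z4).
have [f1 f2 f3 f4] := bdcont_sides ab cd bc.
rewrite /oint /hint /vint (cint_split am mb f1) (cint_split am mb f2); ring.
Qed.

Lemma oint_splith a b c d m F : a <= b -> c <= m <= d ->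
  (forall z, inrect a b c d z -> (Im z == m) || ~~ [&& a < Re z < b & c < Im z < d] -> ccont F z) ->
  oint a b c d F = oint a b c m F + oint a b m d F.
Proof.
move=> ab /andP[cm md] h; have cd := le_trans cm md.
have bc : bdcont a b c d F.
  move=> z [zi zb]; apply: h => //; apply/orP; right.
  by apply/negP => /and3P[/andP[z1 z2] z3 z4]; move: zb; rewrite (gt_eqF z1) (lt_eqF z2) (gt_eqF z3) (lt_eqF z4).
have [f1 f2 f3 f4] := bdcont_sides ab cd bc.
rewrite /oint /hint /vint (cint_split cm md f3) (cint_split cm md f4); ring.
Qed.

Lemma oint_bound a b c d F (M : R) : a <= b -> c <= d -> bdcont a b c d F ->
  (forall z, bdrect a b c d z -> cmod (F z) <= M) ->
  cmod (oint a b c d F) <= 4 * ((b - a) + (d - c)) * M.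
Proof.
move=> ab cd bc h; have [f1 f2 f3 f4] := bdcont_sides ab cd bc.
have b1 : cmod (hint F c a b) <= 2 * (b - a) * M.
  by apply: cint_bound => // t /andP[t1 t2]; apply: h; rewrite /bdrect /inrect /= t1 t2 cd lexx eqxx ?orbT.
have b2 : cmod (hint F d a b) <= 2 * (b - a) * M.
  by apply: cint_bound => // t /andP[t1 t2]; apply: h; rewrite /bdrect /inrect /= t1 t2 cd lexx eqxx ?orbT.
have b3 : cmod (vint F a c d) <= 2 * (d - c) * M.
  by apply: cint_bound => // t /andP[t1 t2]; apply: h; rewrite /bdrect /inrect /= t1 t2 ab lexx eqxx ?orbT.
have b4 : cmod (vint F b c d) <= 2 * (d - c) * M.
  by apply: cint_bound => // t /andP[t1 t2]; apply: h; rewrite /bdrect /inrect /= t1 t2 ab lexx eqxx ?orbT.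
rewrite /oint; apply: le_trans (cmodD _ _) _; rewrite cmodM cmod_i mul1r.
have := cmodD (hint F c a b) (- hint F d a b); have := cmodD (vint F b c d) (- vint F a c d).
by rewrite !cmodN; lra.
Qed.

(** Between opposite sides an affine function changes by a constant, and the contributions of the
    two pairs of sides cancel. In [goursat] the function subtracted is the tangent at the limit
    point. *)
Lemma oint_affine a b c d (l k : R[i]) : a <= b -> c <= d -> oint a b c d (fun z => l + k * z) = 0.
Proof.
move=> ab cd.
have cc z : ccont (fun z => l + k * z) z.
  by apply: ccontD; [exact: ccont_cst|apply: ccontM; [exact: ccont_cst|exact: ccont_id]].
have [f1 f2 f3 f4] := bdcont_sides ab cd (fun z _ => cc z).
rewrite /oint /hint /vint -!cintB //.
rewrite (@eq_cint _ a b _ (fun=> k * (('i)%C * ((c - d)%:C)%C))); last first.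
  by move=> t _; rewrite opprD addrACA subrr add0r -mulrBr; congr (k * _); simpc.
rewrite (@eq_cint _ c d _ (fun=> k * (((b - a)%:C)%C))); last first.
  by move=> t _; rewrite opprD addrACA subrr add0r -mulrBr; congr (k * _); simpc.
rewrite !cint_cst //.
have -> : ((c - d)%:C)%C = - (((d - c)%:C)%C) :> R[i] by rewrite -rmorphN opprB.
ring.
Qed.

End Rectangles.
Arguments hint : simpl never.
Arguments vint : simpl never.
Arguments oint : simpl never.

(** * Goursat's theorem by repeated bisection *)

Section Goursat.
Variable R : realType.
Variable F : R[i] -> R[i].
Local Notation Re := (@complex.Re R).
Local Notation Im := (@complex.Im R).

Definition rectangle := (R * R * (R * R))%type.
Implicit Types Q : rectangle.

Definition ointQ Q := oint Q.1.1 Q.1.2 Q.2.1 Q.2.2 F.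
Definition inQ Q z := inrect Q.1.1 Q.1.2 Q.2.1 Q.2.2 z.
Definition okQ Q := (Q.1.1 <= Q.1.2) && (Q.2.1 <= Q.2.2).
Definition subQ Q' Q := [/\ Q.1.1 <= Q'.1.1, Q'.1.2 <= Q.1.2, Q.2.1 <= Q'.2.1 & Q'.2.2 <= Q.2.2].

(** The half that is kept has an integral of at least half the modulus; when the first half fails
    the test, [half_le_other] gives the inequality for the second. *)
Definition halfh Q : rectangle :=
  let m := (Q.1.1 + Q.1.2) / 2 in
  if cmod (ointQ Q) / 2 <= cmod (ointQ (Q.1.1, m, Q.2)) then (Q.1.1, m, Q.2) else (m, Q.1.2, Q.2).
Definition halfv Q : rectangle :=
  let m := (Q.2.1 + Q.2.2) / 2 in
  if cmod (ointQ Q) / 2 <= cmod (ointQ (Q.1, (Q.2.1, m))) then (Q.1, (Q.2.1, m)) else (Q.1, (m, Q.2.2)).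

Lemma half_le_other (x y t : R) : x <= y + t -> ~~ (x / 2 <= y) -> x / 2 <= t.
Proof. by rewrite -ltNge; lra. Qed.

Lemma dist_le_width (x y s t : R) : s <= x -> x <= t -> s <= y -> y <= t -> `|x - y| <= t - s.
Proof. by rewrite ler_norml => *; apply/andP; split; lra. Qed.

Lemma subQ_in Q' Q z : subQ Q' Q -> inQ Q' z -> inQ Q z.
Proof.
move=> [h1 h2 h3 h4] /andP[/andP[z1 z2] /andP[z3 z4]].
by rewrite /inQ /inrect (le_trans h1 z1) (le_trans z2 h2) (le_trans h3 z3) (le_trans z4 h4).
Qed.

Lemma halfhP Q : okQ Q -> (forall z, inQ Q z -> ccont F z) ->
  [/\ okQ (halfh Q), subQ (halfh Q) Q,
      (halfh Q).1.2 - (halfh Q).1.1 = (Q.1.2 - Q.1.1) / 2, (halfh Q).2 = Q.2 &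
      cmod (ointQ Q) / 2 <= cmod (ointQ (halfh Q))].
Proof.
move=> /andP[ab cd] h; rewrite /halfh; set m := (_ + _) / 2.
have am : Q.1.1 <= m by rewrite /m; lra.
have mb : m <= Q.1.2 by rewrite /m; lra.
have e : ointQ Q = ointQ (Q.1.1, m, Q.2) + ointQ (m, Q.1.2, Q.2).
  by apply: oint_splitv; rewrite ?am // => z zi _; exact: h.
case: ifPn => /= h1; split=> //; rewrite /okQ /subQ /= ?am ?mb ?cd ?lexx //=; try by rewrite /m; field.
by apply: half_le_other h1; rewrite e; exact: cmodD.
Qed.

Lemma halfvP Q : okQ Q -> (forall z, inQ Q z -> ccont F z) ->
  [/\ okQ (halfv Q), subQ (halfv Q) Q,
      (halfv Q).2.2 - (halfv Q).2.1 = (Q.2.2 - Q.2.1) / 2, (halfv Q).1 = Q.1 &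
      cmod (ointQ Q) / 2 <= cmod (ointQ (halfv Q))].
Proof.
move=> /andP[ab cd] h; rewrite /halfv; set m := (_ + _) / 2.
have am : Q.2.1 <= m by rewrite /m; lra.
have mb : m <= Q.2.2 by rewrite /m; lra.
have e : ointQ Q = ointQ (Q.1, (Q.2.1, m)) + ointQ (Q.1, (m, Q.2.2)).
  by apply: oint_splith; rewrite ?am // => z zi _; exact: h.
case: ifPn => /= h1; split=> //; rewrite /okQ /subQ /= ?am ?mb ?ab ?lexx //=; try by rewrite /m; field.
by apply: half_le_other h1; rewrite e; exact: cmodD.
Qed.

Lemma subQ_trans Q1 Q2 Q3 : subQ Q1 Q2 -> subQ Q2 Q3 -> subQ Q1 Q3.
Proof.
move=> [a1 a2 a3 a4] [b1 b2 b3 b4]; split;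
  [exact: le_trans b1 a1|exact: le_trans a2 b2|exact: le_trans b3 a3|exact: le_trans a4 b4].
Qed.

Definition quarter Q := halfv (halfh Q).

Lemma quarterP Q : okQ Q -> (forall z, inQ Q z -> ccont F z) ->
  [/\ okQ (quarter Q), subQ (quarter Q) Q,
      (quarter Q).1.2 - (quarter Q).1.1 = (Q.1.2 - Q.1.1) / 2,
      (quarter Q).2.2 - (quarter Q).2.1 = (Q.2.2 - Q.2.1) / 2 &
      cmod (ointQ Q) / 4 <= cmod (ointQ (quarter Q))].
Proof.
move=> ok h; have [ok1 s1 w1 e1 l1] := halfhP ok h.
have [ok2 s2 w2 e2 l2] := halfvP ok1 (fun z zi => h z (subQ_in s1 zi)).
split=> //; [exact: subQ_trans s2 s1|by rewrite /quarter e2|by rewrite /quarter w2 e1|].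
by rewrite /quarter; lra.
Qed.

(** The quarters shrink to a point [p], and the modulus of the integral loses at most a factor 4 at
    each step. Subtracting the tangent at [p] leaves o(|z - p|) on a boundary of length O(2^-n), so
    the integral over the n-th rectangle is o(4^-n), which forces the first one to vanish. *)
Lemma goursat a b c d : a <= b -> c <= d ->
  (forall z, inrect a b c d z -> cdiff F z) -> oint a b c d F = 0.
Proof.
move=> ab cd hF.
pose Q0 : rectangle := (a, b, (c, d)).
pose Q n := iter n quarter Q0.
have ok0 : okQ Q0 by rewrite /okQ /= ab cd.
have key n : [/\ okQ (Q n), subQ (Q n) Q0, (Q n).1.2 - (Q n).1.1 = (b - a) / 2 ^+ n,
     (Q n).2.2 - (Q n).2.1 = (d - c) / 2 ^+ n & cmod (ointQ Q0) / 4 ^+ n <= cmod (ointQ (Q n))].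
  elim: n => [|n [ok s w1 w2 l]].
    by split; rewrite /= ?expr0 ?divr1 //; split; rewrite /= lexx.
  have [ok' s' w1' w2' l'] := quarterP ok (fun z zi => cdiff_cont (hF z (subQ_in s zi))).
  split=> //=; rewrite -/(Q n).
  - exact: subQ_trans s' s.
  - by rewrite w1' w1 exprS invfM mulrA mulrAC.
  - by rewrite w2' w2 exprS invfM mulrA mulrAC.
  - by rewrite exprS invfM mulrCA mulrC; lra.
have mono n m : subQ (Q (n + m)%N) (Q n).
  elim: m => [|m IH]; first by rewrite addn0; split; rewrite lexx.
  have [ok s _ _ _] := key (n + m)%N.
  have [_ s' _ _ _] := quarterP ok (fun z zi => cdiff_cont (hF z (subQ_in s zi))).
  by rewrite addnS; apply: subQ_trans s' IH.
have le_ab n m : (Q n).1.1 <= (Q m).1.2.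
  have [i1 _ _ _] := mono n m; have [_ i2 _ _] := mono m n.
  have [/andP[ok _] _ _ _ _] := key (n + m)%N.
  by apply: le_trans i1 _; apply: le_trans ok _; rewrite addnC.
have le_cd n m : (Q n).2.1 <= (Q m).2.2.
  have [_ _ i1 _] := mono n m; have [_ _ _ i2] := mono m n.
  have [/andP[_ ok] _ _ _ _] := key (n + m)%N.
  by apply: le_trans i1 _; apply: le_trans ok _; rewrite addnC.
(* The left and lower ends increase and stay below every right and upper end, so their suprema are
   the coordinates of a point common to all rectangles. *)
pose A := [set x | exists n, x = (Q n).1.1]; pose B := [set y | exists n, y = (Q n).2.1].
have supA : has_sup A.
  by split; [exists a, 0%N|exists b => _ [n ->]; exact: (le_ab n 0%N)].
have supB : has_sup B.
  by split; [exists c, 0%N|exists d => _ [n ->]; exact: (le_cd n 0%N)].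
pose p : R[i] := Complex (sup A) (sup B).
have pQ n : inQ (Q n) p.
  rewrite /inQ /inrect /=; apply/andP; split; apply/andP; split.
  - by apply: ub_le_sup; [case: supA|exists n].
  - by apply: ge_sup; [case: supA|move=> _ [m ->]].
  - by apply: ub_le_sup; [case: supB|exists n].
  - by apply: ge_sup; [case: supB|move=> _ [m ->]].
have [l [q [cq ql] [r r0 hr]]] := hF p (pQ 0%N).
apply/eqP; rewrite -cmod_eq0; apply/negPn/negP => n0.
pose L := (b - a) + (d - c); have L0 : 0 <= L by rewrite addr_ge0 // subr_ge0.
set I := cmod _ in n0; have I0 : 0 < I by rewrite lt_def n0 cmod_ge0.
(* With this precision the n-th bound 4 (L 2^-n) e (L 2^-n) is at most (I/2) 4^-n. The denominator
   has L + 1 because L vanishes for a degenerate rectangle. *)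
have e0 : 0 < I / (4 * (L + 1) ^+ 2) / 2.
  by rewrite !divr_gt0 // mulr_gt0 // exprn_gt0 // ltr_wpDl.
have [s s0 hs] := cq _ e0.
have rs0 : 0 < Num.min r s by rewrite lt_min r0.
have [n hn] : exists n, L / 2 ^+ n < Num.min r s.
  have [n nP] := exists_pow2_gt (L / Num.min r s).
  exists n; rewrite ltr_pdivrMr ?exprn_gt0 // mulrC -ltr_pdivrMr //.
have [ok sub w1 w2 li] := key n.
have [/andP[p1 p2] /andP[p3 p4]] := andP (pQ n).
have near z : inQ (Q n) z -> cmod (z - p) <= L / 2 ^+ n.
  move=> /andP[/andP[z1 z2] /andP[z3 z4]]; apply: le_trans (cmod_le_ReIm _) _.
  rewrite ReB ImB mulrDl -w1 -w2; by apply: lerD; apply: dist_le_width.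
have /andP[oab ocd] := ok.
have cF : bdcont (Q n).1.1 (Q n).1.2 (Q n).2.1 (Q n).2.2 F.
  by move=> z [zi _]; apply: cdiff_cont; apply: hF; exact: subQ_in sub zi.
have cA : bdcont (Q n).1.1 (Q n).1.2 (Q n).2.1 (Q n).2.2 (fun z => (F p - l * p) + l * z).
  move=> z _; apply: ccontD; first exact: ccont_cst.
  by apply: ccontM; [exact: ccont_cst|exact: ccont_id].
have : cmod (ointQ (Q n)) <= 4 * (L / 2 ^+ n) * (I / (4 * (L + 1) ^+ 2) / 2 * (L / 2 ^+ n)).
  have -> : ointQ (Q n) = oint (Q n).1.1 (Q n).1.2 (Q n).2.1 (Q n).2.2 (fun z => F z - ((F p - l * p) + l * z)).
    by rewrite ointB // oint_affine // subr0.
  have -> : L / 2 ^+ n = ((Q n).1.2 - (Q n).1.1) + ((Q n).2.2 - (Q n).2.1) by rewrite w1 w2 -mulrDl.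
  apply: oint_bound => //; first exact: bdcontB.
  move=> z [zi _]; have zp := near z zi.
  have lt := le_lt_trans zp hn; rewrite lt_min in lt; have /andP[lr ls] := lt.
  rewrite (hr z lr) -ql.
  have -> : F p + q z * (z - p) - (F p - q p * p + q p * z) = (q z - q p) * (z - p) by ring.
  rewrite cmodM w1 w2 -mulrDl -/L; apply: ler_pM; rewrite ?cmod_ge0 //.
  exact: ltW (hs z ls).
apply/negP; rewrite -ltNge; apply: lt_le_trans li.
have -> : 4 ^+ n = (2 ^+ n) ^+ 2 :> R by rewrite -exprM mulnC exprM; congr (_ ^+ n); ring.
have t0 : (0 : R) < 2 ^+ n by rewrite exprn_gt0.
have L1 : 0 < L + 1 by rewrite ltr_wpDl.
have -> : 4 * (L / 2 ^+ n) * (I / (4 * (L + 1) ^+ 2) / 2 * (L / 2 ^+ n)) =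
   (I / 2 * (L / (L + 1)) ^+ 2) / (2 ^+ n) ^+ 2.
  by field; rewrite !gt_eqF.
rewrite ltr_pM2r ?invr_gt0 ?exprn_gt0 // -/I.
have : (L / (L + 1)) ^+ 2 <= 1 by rewrite exprn_ile1 ?divr_ge0 ?(ltW L1) // ler_pdivrMr // mul1r lerDl.
move=> h; apply: (@le_lt_trans _ _ (I / 2)); last lra.
by rewrite ler_piMr // divr_ge0 // ltW.
Qed.

End Goursat.

(** * The integral of 1/(s - w) over a square centred at w *)

Section Kappa.
Variable R : realType.
Implicit Types (m e x : R) (w : R[i]).
Local Notation mu := (@lebesgue_measure R).
Local Notation Re := (@complex.Re R).
Local Notation Im := (@complex.Im R).

Lemma is_derive_scaled_atan m e x : 0 < e ->
  is_derive x 1 (fun t => 2 * atan ((t - m) / e)) (2 * e / ((x - m) ^+ 2 + e ^+ 2)).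
Proof.
move=> e0.
have h1 : is_derive x 1 (fun t : R => (t - m) / e) e^-1.
  rewrite (_ : (fun t => _) = e^-1 \*: (fun t : R => t - m)); last first.
    by apply/funext => t; rewrite mulrC.
  apply: is_derive_eq (is_deriveZ _ _) _; rewrite subr0.
  by rewrite -[RHS]mulr1.
have h2 : is_derive x 1 (atan \o (fun t : R => (t - m) / e)) ((1 + ((x - m) / e) ^+ 2)^-1 * e^-1).
  exact: (@is_derive1_comp R atan (fun t : R => (t - m) / e) x _ _ (is_derive1_atan _) h1).
rewrite (_ : (fun t => _) = 2 \*: (atan \o (fun t : R => (t - m) / e))); last first.
  by apply/funext.
apply: is_derive_eq (is_deriveZ _ h2) _.
have d0 : (x - m) ^+ 2 + e ^+ 2 != 0 by rewrite gt_eqF // ltr_wpDl ?sqr_ge0 // exprn_gt0.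
have d1 : 1 + ((x - m) / e) ^+ 2 != 0 by rewrite gt_eqF // ltr_pwDl // sqr_ge0.
rewrite /GRing.scale /=; field.
by rewrite d0 gt_eqF.
Qed.

Lemma continuous_poisson m e x : 0 < e -> {for x, continuous (fun t : R => 2 * e / ((t - m) ^+ 2 + e ^+ 2))}.
Proof.
move=> e0; have d0 : (x - m) ^+ 2 + e ^+ 2 != 0 by rewrite gt_eqF // ltr_wpDl ?sqr_ge0 // exprn_gt0.
apply: continuousM; first exact: cvg_cst.
apply: continuousV => //; apply: continuousD; last exact: cvg_cst.
rewrite (_ : (fun t => _) = (fun t : R => (t - m) * (t - m))); last by apply/funext => t; rewrite expr2.
by apply: continuousM; apply: continuousB; [exact: cvg_id|exact: cvg_cst|exact: cvg_id|exact: cvg_cst].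
Qed.

Lemma Rint_poisson m e : 0 < e ->
  \int[mu]_(t in `[m - e, m + e]) (2 * e / ((t - m) ^+ 2 + e ^+ 2)) = pi.
Proof.
move=> e0; have ab : m - e < m + e by lra.
have dF x := @is_derive_scaled_atan m e x e0.
have cF x : {for x, continuous (fun t => 2 * atan ((t - m) / e))}.
  by apply: differentiable_continuous; apply/derivable1_diffP; case: (dF x).
rewrite /Rintegral (@continuous_FTC2 R _ (fun t => 2 * atan ((t - m) / e))) //.
- rewrite addrAC subrr add0r divff ?gt_eqF // addrAC subrr add0r mulNr divff ?gt_eqF //.
  by rewrite atanN atan1 /=; field.
- by apply: continuous_subspaceT => x; apply: continuous_poisson.
- split; first by move=> x _; case: (dF x).
    by apply: cvg_at_right_filter; exact: cF.
  by apply: cvg_at_left_filter; exact: cF.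
- by move=> x _; rewrite derive1E; case: (dF x).
Qed.

Definition kappa : R[i] := ('i)%C * ((2 * pi)%:C)%C.

Lemma kappa_neq0 : kappa != 0.
Proof.
rewrite mulf_neq0 //; first by rewrite -cmod_eq0 cmod_i oner_eq0.
by rewrite -cmod_eq0 cmod_real normr_eq0 mulf_neq0 // ?gt_eqF ?pi_gt0.
Qed.

Lemma cdiff_inv w z : z != w -> cdiff (fun s => (s - w)^-1) z.
Proof.
move=> zw; apply: cdiffV; last by rewrite subr_eq0.
by apply: cdiffB; [exact: cdiff_id|exact: cdiff_cst].
Qed.

Lemma bdrect_center w e z : 0 < e -> bdrect (Re w - e) (Re w + e) (Im w - e) (Im w + e) z -> e <= cmod (z - w).
Proof.
move=> e0 [_ /or4P h].
have [h1|h1] : (e <= `|Re (z - w)|) \/ (e <= `|Im (z - w)|).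
  rewrite ReB ImB; case: h => /eqP ->; [left|left|right|right];
  rewrite [X in `|X|]addrAC subrr add0r ?normrN ger0_norm // ltW //.
- exact: le_trans h1 (Re_le_cmod _).
- exact: le_trans h1 (Im_le_cmod _).
Qed.

Lemma cint_real a b (p : R -> R) : cint a b (fun t => ((p t)%:C)%C) = ((\int[mu]_(t in `[a, b]) p t)%:C)%C.
Proof.
rewrite [LHS]complexE (@Im_cint_eq0 _ a b) //.
by rewrite mulr0 addr0.
Qed.

Lemma rcont_poisson m e x : 0 < e ->
  rcont (fun t : R => ((2 * e / ((t - m) ^+ 2 + e ^+ 2))%:C)%C) x.
Proof.
move=> e0 k k0.
have /cvgrPdist_lt/(_ k k0)/nbhs_ballP[d /= d0 h] := @continuous_poisson m e x e0.
exists d => // s sx; rewrite -rmorphB cmod_real distrC; apply: h.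
by rewrite /ball /= distrC.
Qed.

Lemma invcE (t y : R) : (Complex t y)^-1 = Complex (t / (t ^+ 2 + y ^+ 2)) (- y / (t ^+ 2 + y ^+ 2)) :> R[i].
Proof. by rewrite mulNr. Qed.

Lemma invc_hor (t e : R) : t ^+ 2 + e ^+ 2 != 0 ->
  (Complex t (- e))^-1 - (Complex t e)^-1 = ('i)%C * ((2 * e / (t ^+ 2 + e ^+ 2))%:C)%C :> R[i].
Proof.
by move=> d0; rewrite !invcE sqrrN; simpc; congr Complex; field.
Qed.

Lemma invc_ver (t e : R) : t ^+ 2 + e ^+ 2 != 0 ->
  (Complex e t)^-1 - (Complex (- e) t)^-1 = ((2 * e / (t ^+ 2 + e ^+ 2))%:C)%C :> R[i].
Proof.
move=> d0; have d1 : e ^+ 2 + t ^+ 2 != 0 by rewrite addrC.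
by rewrite !invcE sqrrN; simpc; congr Complex; field; rewrite ?d0.
Qed.

(** Opposite sides combine into the Poisson kernel 2e/(t^2 + e^2), with primitive 2 atan(t/e); each
    of the two pairs contributes i pi. *)
Lemma oint_center w e : 0 < e ->
  oint (Re w - e) (Re w + e) (Im w - e) (Im w + e) (fun s => (s - w)^-1) = kappa.
Proof.
move=> e0; have abr : Re w - e <= Re w + e by lra.
have abi : Im w - e <= Im w + e by lra.
have bc : bdcont (Re w - e) (Re w + e) (Im w - e) (Im w + e) (fun s => (s - w)^-1).
  move=> z zb; apply: cdiff_cont; apply: cdiff_inv; rewrite -subr_eq0 -cmod_gt0.
  exact: lt_le_trans (bdrect_center e0 zb).
have [f1 f2 f3 f4] := bdcont_sides abr abi bc.
rewrite /oint /hint /vint -!cintB //.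
have d0 (x m : R) : (x - m) ^+ 2 + e ^+ 2 != 0.
  by rewrite gt_eqF // ltr_wpDl ?sqr_ge0 // exprn_gt0.
have wE (t y : R) : Complex t y - w = Complex (t - Re w) (y - Im w) by case: (w).
have ce (x : R) : x - e - x = - e by ring.
have ce' (x : R) : x + e - x = e by ring.
rewrite (@eq_cint _ (Re w - e) _ _ (fun t => ('i)%C * ((2 * e / ((t - Re w) ^+ 2 + e ^+ 2))%:C)%C)); last first.
  by move=> t _; rewrite !wE ce ce' invc_hor.
rewrite (@eq_cint _ (Im w - e) _ _ (fun t => ((2 * e / ((t - Im w) ^+ 2 + e ^+ 2))%:C)%C)); last first.
  by move=> t _; rewrite !wE ce ce' invc_ver.
rewrite cintZ; last by move=> x _; apply: rcont_poisson.
by rewrite !cint_real !Rint_poisson // /kappa mulr_natl rmorphMn /= mulr2n; ring.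
Qed.
End Kappa.

(** * Cauchy's formula on rectangles *)

Section Cauchy.
Variable R : realType.
Implicit Types (F G : R[i] -> R[i]) (a b c d x y e r : R) (z w s : R[i]).
Local Notation Re := (@complex.Re R).
Local Notation Im := (@complex.Im R).

Definition interiorQ a b c d z := [&& a < Re z, Re z < b, c < Im z & Im z < d].

(** Four cuts along the sides of the small square remove four rectangles that avoid [w], and
    Goursat's theorem makes their integrals vanish. *)
Lemma oint_deform G a b c d w e : 0 < e -> a <= Re w - e -> Re w + e <= b -> c <= Im w - e -> Im w + e <= d ->
  (forall z, inrect a b c d z -> z != w -> cdiff G z) ->
  oint a b c d G = oint (Re w - e) (Re w + e) (Im w - e) (Im w + e) G.
Proof.
move=> e0 h1 h2 h3 h4 hG.
have neqR z : Re z != Re w -> z != w by apply: contraNneq => ->.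
have neqI z : Im z != Im w -> z != w by apply: contraNneq => ->.
have sub a' b' c' d' z : a <= a' -> b' <= b -> c <= c' -> d' <= d -> inrect a' b' c' d' z -> inrect a b c d z.
  move=> i1 i2 i3 i4 /andP[/andP[z1 z2] /andP[z3 z4]].
  by rewrite /inrect (le_trans i1 z1) (le_trans z2 i2) (le_trans i3 z3) (le_trans z4 i4).
have G0 a' b' c' d' : a <= a' -> b' <= b -> c <= c' -> d' <= d -> a' <= b' -> c' <= d' ->
    (forall z, inrect a' b' c' d' z -> z != w) -> oint a' b' c' d' G = 0.
  by move=> i1 i2 i3 i4 ab cd hn; apply: goursat => // z zi; apply: hG; [exact: (sub a' b' c' d')|exact: hn].
have C0 a' b' c' d' z : a <= a' -> b' <= b -> c <= c' -> d' <= d -> inrect a' b' c' d' z -> z != w -> ccont G z.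
  by move=> i1 i2 i3 i4 zi zw; apply: cdiff_cont; apply: hG => //; exact: (sub a' b' c' d').
have nint a' b' c' d' z : a' < Re w < b' -> c' < Im w < d' -> ~~ [&& a' < Re z < b' & c' < Im z < d'] -> z != w.
  move=> /andP[i1 i2] /andP[i3 i4]; apply: contraNneq => ->.
  by rewrite i1 i2 i3 i4.
have [x1 x2 x3] : [/\ Re w - e < Re w, Re w < Re w + e & Re w - e <= Re w + e] by split; lra.
have [y1 y2 y3] : [/\ Im w - e < Im w, Im w < Im w + e & Im w - e <= Im w + e] by split; lra.
have aw := le_lt_trans h1 x1; have wb := lt_le_trans x2 h2.
have cw := le_lt_trans h3 y1; have wd := lt_le_trans y2 h4.
have ax := le_trans h1 x3; have xb := le_trans x3 h2; have ab := le_trans ax h2.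
have cy := le_trans h3 y3; have yd := le_trans y3 h4; have cd := le_trans cy h4.
rewrite (@oint_splitv R a b c d (Re w - e)) ?h1 ?xb //; last first.
  move=> z zi /orP[/eqP h|h].
    by apply: (C0 a b c d) => //; apply: neqR; rewrite h lt_eqF.
  by apply: (C0 a b c d) => //; apply: (nint a b c d) => //; rewrite ?aw ?wb ?cw ?wd.
rewrite (G0 a (Re w - e) c d) ?add0r //; last first.
  by move=> z /andP[/andP[_ z2] _]; apply: neqR; rewrite lt_eqF // (le_lt_trans z2).
rewrite (@oint_splitv R (Re w - e) b c d (Re w + e)) ?x3 ?h2 //; last first.
  move=> z zi /orP[/eqP h|h].
    by apply: (C0 (Re w - e) b c d) => //; apply: neqR; rewrite h gt_eqF.
  by apply: (C0 (Re w - e) b c d) => //; apply: (nint (Re w - e) b c d) => //; rewrite ?x1 ?wb ?cw ?wd.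
rewrite (G0 (Re w + e) b c d) ?addr0 //; last first.
  by move=> z /andP[/andP[z1 _] _]; apply: neqR; rewrite gt_eqF // (lt_le_trans _ z1).
rewrite (@oint_splith R _ _ c d (Im w - e)) ?h3 ?yd //; last first.
  move=> z zi /orP[/eqP h|h].
    by apply: (C0 (Re w - e) (Re w + e) c d) => //; apply: neqI; rewrite h lt_eqF.
  by apply: (C0 (Re w - e) (Re w + e) c d) => //; apply: (nint (Re w - e) (Re w + e) c d) => //; rewrite ?x1 ?x2 ?cw ?wd.
rewrite (G0 (Re w - e) (Re w + e) c (Im w - e)) ?add0r //; last first.
  by move=> z /andP[_ /andP[_ z2]]; apply: neqI; rewrite lt_eqF // (le_lt_trans z2).
rewrite (@oint_splith R _ _ (Im w - e) d (Im w + e)) ?y3 ?h4 //; last first.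
  move=> z zi /orP[/eqP h|h].
    by apply: (C0 (Re w - e) (Re w + e) (Im w - e) d) => //; apply: neqI; rewrite h gt_eqF.
  by apply: (C0 (Re w - e) (Re w + e) (Im w - e) d) => //; apply: (nint (Re w - e) (Re w + e) (Im w - e) d) => //; rewrite ?x1 ?x2 ?y1 ?wd.
rewrite (G0 (Re w - e) (Re w + e) (Im w + e) d) ?addr0 //.
by move=> z /andP[_ /andP[z1 _]]; apply: neqI; rewrite gt_eqF // (lt_le_trans _ z1).
Qed.

Lemma inrect_cball a b c d w : interiorQ a b c d w ->
  exists2 e : R, 0 < e & [/\ a <= Re w - e, Re w + e <= b, c <= Im w - e & Im w + e <= d].
Proof.
move=> /and4P[h1 h2 h3 h4].
exists (Num.min (Num.min (Re w - a) (b - Re w)) (Num.min (Im w - c) (d - Im w))).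
  by rewrite !lt_min !subr_gt0 h1 h2 h3 h4.
have [m1 m2 m3 m4] : let m := Num.min (Num.min (Re w - a) (b - Re w)) (Num.min (Im w - c) (d - Im w)) in
    [/\ m <= Re w - a, m <= b - Re w, m <= Im w - c & m <= d - Im w].
  by split; rewrite !ge_min lexx ?orbT.
split; lra.
Qed.

(** On a small square around [w] of half-side e, the part F w / (s - w) integrates to kappa F w.
    What remains is Caratheodory's quotient [q], bounded near [w], whose integral is O(e). *)
Lemma cauchy_formula F a b c d w : interiorQ a b c d w ->
  (forall z, inrect a b c d z -> cdiff F z) ->
  oint a b c d (fun s => F s / (s - w)) = kappa R * F w.
Proof.
move=> iw hF; have [e1 e10 [m1 m2 m3 m4]] := inrect_cball iw.
have wi : inrect a b c d w by move: iw => /and4P[h1 h2 h3 h4]; rewrite /inrect !ltW.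
have [l [q [cq ql] qF]] := hF w wi.
have [e2 e20 he2] := cnearI qF (ccont_bounded cq).
have hG z : inrect a b c d z -> z != w -> cdiff (fun s => F s / (s - w)) z.
  by move=> zi zw; apply: cdiffM; [exact: hF|exact: cdiff_inv].
apply/eqP; rewrite -subr_eq0 -cmod_eq0; apply/negPn/negP => n0.
set X := cmod _ in n0; have X0 : 0 < X by rewrite lt_def n0 cmod_ge0.
have M0 : 0 < cmod (q w) + 1 by rewrite ltr_wpDl ?cmod_ge0.
(* For half-side e the bound of [oint_bound] is 16 e (cmod (q w) + 1), hence at most X/2; e2/4 keeps
   the square inside the ball where [q] is controlled. *)
pose e := Num.min e1 (Num.min (e2 / 4) (X / (32 * (cmod (q w) + 1)))).
have e0 : 0 < e by rewrite !lt_min e10 !divr_gt0 // mulr_gt0.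
have [l1 l2 l3] : [/\ e <= e1, e <= e2 / 4 & e <= X / (32 * (cmod (q w) + 1))].
  by split; rewrite !ge_min lexx ?orbT.
clearbody e.
have [g1 g2 g3 g4] : [/\ a <= Re w - e, Re w + e <= b, c <= Im w - e & Im w + e <= d].
  by split; clear -m1 m2 m3 m4 l1; lra.
have [abr abi] : Re w - e <= Re w + e /\ Im w - e <= Im w + e by split; clear -e0; lra.
have bnd z : bdrect (Re w - e) (Re w + e) (Im w - e) (Im w + e) z -> z != w /\ cmod (z - w) < e2.
  move=> zb; split.
    by rewrite -subr_eq0 -cmod_gt0; apply: lt_le_trans (bdrect_center e0 zb).
  move: zb => [/andP[/andP[z1 z2] /andP[z3 z4]] _]; apply: le_lt_trans (cmod_le_ReIm _) _.
  have i1 : `|Re (z - w)| <= e by rewrite ReB ler_norml; apply/andP; split; lra.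
  have i2 : `|Im (z - w)| <= e by rewrite ImB ler_norml; apply/andP; split; lra.
  lra.
have sub z : bdrect (Re w - e) (Re w + e) (Im w - e) (Im w + e) z -> inrect a b c d z.
  move=> [/andP[/andP[z1 z2] /andP[z3 z4]] _].
  by rewrite /inrect (le_trans g1 z1) (le_trans z2 g2) (le_trans g3 z3) (le_trans z4 g4).
have c1 : bdcont (Re w - e) (Re w + e) (Im w - e) (Im w + e) (fun s => F w * (s - w)^-1).
  by move=> z /bnd[zw _]; apply: ccontM; [exact: ccont_cst|apply: cdiff_cont; exact: cdiff_inv].
have c2 : bdcont (Re w - e) (Re w + e) (Im w - e) (Im w + e) (fun s => (F s - F w) / (s - w)).
  move=> z zb; have [zw _] := bnd z zb; apply: ccontM; last by apply: cdiff_cont; exact: cdiff_inv.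
  by apply: ccontB; [apply: cdiff_cont; apply: hF; exact: sub|exact: ccont_cst].
have eX : oint a b c d (fun s => F s / (s - w)) - kappa R * F w =
    oint (Re w - e) (Re w + e) (Im w - e) (Im w + e) (fun s => (F s - F w) / (s - w)).
  rewrite (oint_deform (w := w) e0) //.
  rewrite (@eq_oint R _ _ _ _ _ (fun s => F w * (s - w)^-1 + (F s - F w) / (s - w))) //; last first.
    by move=> z _; rewrite -mulrDl [F w + _]addrC subrK.
  rewrite ointD // ointZ //; first by rewrite oint_center // addrC mulrC addrA [- _ + _]addrC subrr add0r.
  by move=> z /bnd[zw _]; apply: cdiff_cont; exact: cdiff_inv.
have : X <= 4 * ((Re w + e - (Re w - e)) + (Im w + e - (Im w - e))) * (cmod (q w) + 1).
  rewrite /X eX; apply: oint_bound => // z zb; have [zw z2] := bnd z zb.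
  have [-> hq] := he2 z z2.
  by rewrite addrC addKr mulfK ?subr_eq0 // ltW.
have -> : (Re w + e - (Re w - e)) + (Im w + e - (Im w - e)) = 4 * e by ring.
have : e * (32 * (cmod (q w) + 1)) <= X by rewrite -ler_pdivlMr // mulr_gt0.
lra.
Qed.

Lemma ccont_bounded_side (h : R -> R[i]) a b : a <= b -> rcontin a b h ->
  exists2 M : R, 0 < M & forall t, a <= t <= b -> cmod (h t) <= M.
Proof.
move=> ab ch.
have cm t : a <= t <= b -> {for t, continuous (fun u => cmod (h u))}.
  move=> /ch ct; apply/cvgrPdist_lt => /= e e0; have [d d0 hd] := ct e e0.
  near=> u; apply: le_lt_trans (cmod_dist_dist _ _) _; rewrite cmodB; apply: hd.
  by rewrite distrC; near: u; exact: cvgr_dist_lt.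
have : {within `[a, b], continuous (fun u => cmod (h u))}.
  by apply: continuous_in_subspaceT => t /set_mem /=; rewrite in_itv /= => /cm.
move=> /(EVT_max ab)[c cab hc].
exists (cmod (h c) + 1); first by rewrite ltr_wpDl ?cmod_ge0.
move=> t tab; have tin : t \in `[a, b] by rewrite in_itv.
have := hc t tin; lra.
Unshelve. all: by end_near. Qed.

Lemma bdcont_bounded F a b c d : a <= b -> c <= d -> bdcont a b c d F ->
  exists2 M : R, 0 < M & forall z, bdrect a b c d z -> cmod (F z) <= M.
Proof.
move=> ab cd /(bdcont_sides ab cd)[f1 f2 f3 f4].
have [M1 M10 h1] := ccont_bounded_side ab f1; have [M2 M20 h2] := ccont_bounded_side ab f2.
have [M3 M30 h3] := ccont_bounded_side cd f3; have [M4 M40 h4] := ccont_bounded_side cd f4.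
exists (M1 + M2 + M3 + M4); first by rewrite !addr_gt0.
move=> [x y] [/andP[xab ycd] /or4P[] /eqP /= e]; move: xab ycd; rewrite /= => xab ycd.
- by have := h3 y ycd; rewrite -e; lra.
- by have := h4 y ycd; rewrite -e; lra.
- by have := h1 x xab; rewrite -e; lra.
- by have := h2 x xab; rewrite -e; lra.
Qed.

(** Half the distance from [w] to the sides works for all nearby parameters [v] and all boundary
    points at once; this uniformity gives the continuity in [cder_cauchy_integral]. *)
Lemma interior_bd_dist a b c d w : interiorQ a b c d w ->
  exists2 r : R, 0 < r & forall v z, cmod (v - w) < r -> bdrect a b c d z -> r <= cmod (z - v) /\ interiorQ a b c d v.
Proof.
move=> /inrect_cball[e e0 [h1 h2 h3 h4]]; exists (e / 2); first by rewrite divr_gt0.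
move=> v z vw [_ zb].
have v1 : `|Re v - Re w| < e / 2 by rewrite -ReB; apply: le_lt_trans (Re_le_cmod _) vw.
have v2 : `|Im v - Im w| < e / 2 by rewrite -ImB; apply: le_lt_trans (Im_le_cmod _) vw.
move: v1 v2; rewrite !ltr_norml => /andP[v1 v1'] /andP[v2 v2'].
split; last by rewrite /interiorQ; apply/and4P; split; lra.
have [k|k] : (e / 2 <= `|Re (z - v)|) \/ (e / 2 <= `|Im (z - v)|).
  rewrite ReB ImB; case/or4P: zb => /eqP ->; [left|left|right|right].
  - by rewrite ler0_norm; lra.
  - by rewrite ger0_norm; lra.
  - by rewrite ler0_norm; lra.
  - by rewrite ger0_norm; lra.
- exact: le_trans k (Re_le_cmod _).
- exact: le_trans k (Im_le_cmod _).
Qed.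

Lemma bdrect_neq a b c d w z : interiorQ a b c d w -> bdrect a b c d z -> z != w.
Proof.
move=> iw zb; have [r r0 h] := interior_bd_dist iw.
have [] := h w z _ zb; first by rewrite subrr cmod0.
by move=> k _; rewrite -subr_eq0 -cmod_gt0; apply: lt_le_trans k.
Qed.

Lemma bdcont_cauchy F a b c d w : interiorQ a b c d w -> bdcont a b c d F ->
  bdcont a b c d (fun s => F s / (s - w)).
Proof.
move=> iw bF z zb; apply: ccontM; first exact: bF.
by apply: cdiff_cont; apply: cdiff_inv; exact: bdrect_neq iw zb.
Qed.

(** Since 1/(s - v) - 1/(s - w) = (v - w)/((s - v)(s - w)), the slope is itself a contour integral,
    continuous in [v]. Only boundary continuity of [F] is involved, which is what allows the passage
    to limits in [holo_limit]. *)
Lemma cder_cauchy_integral F a b c d w : interiorQ a b c d w -> bdcont a b c d F ->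
  cder (fun v => oint a b c d (fun s => F s / (s - v))) w
       (oint a b c d (fun s => F s / (s - w) / (s - w))).
Proof.
move=> iw bF; have [r r0 hr] := interior_bd_dist iw.
have /and4P[a1 a2 a3 a4] := iw; have ab := ltW (lt_trans a1 a2); have cd := ltW (lt_trans a3 a4).
have [M M0 hM] := bdcont_bounded ab cd bF.
have bc2 v : interiorQ a b c d v -> bdcont a b c d (fun s => F s / (s - v) / (s - w)).
  by move=> iv; apply: (bdcont_cauchy (F := fun s => F s / (s - v)) iw); exact: bdcont_cauchy.
have eqd v : cmod (v - w) < r -> oint a b c d (fun s => F s / (s - v)) =
   oint a b c d (fun s => F s / (s - w)) + oint a b c d (fun s => F s / (s - v) / (s - w)) * (v - w).
  move=> vw; have iv : interiorQ a b c d v.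
    have [z zb] : exists z, bdrect a b c d z.
      by exists (Complex a c); rewrite /bdrect /inrect /= !lexx ab cd eqxx.
    by have [] := hr v z vw zb.
  rewrite mulrC -ointZ //; last exact: bc2.
  rewrite -ointD //; last by apply: bdcontZ; exact: bc2.
    apply: eq_oint => // z zb.
    have := bdrect_neq iv zb; have := bdrect_neq iw zb; rewrite -!(subr_eq0 z) => n1 n2.
    by field; rewrite n1 n2.
  exact: bdcont_cauchy.
exists (fun v => oint a b c d (fun s => F s / (s - v) / (s - w))); last first.
  by exists r => // v /eqd.
split=> // e e0.
have [L eL L0] : exists2 L : R, L = 4 * ((b - a) + (d - c)) & 0 < L.
  by exists (4 * ((b - a) + (d - c))) => //; clear -a1 a2 a3 a4; lra.
have q1 : 0 < e * r ^+ 3 by rewrite mulr_gt0 // exprn_gt0.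
have q2 : 0 < 2 * L * M by rewrite !mulr_gt0.
exists (Num.min r (e * r ^+ 3 / (2 * L * M))).
  by rewrite lt_min r0 divr_gt0.
move=> v; rewrite lt_min => /andP[vr ve].
have iv : interiorQ a b c d v.
  have [z zb] : exists z, bdrect a b c d z.
    by exists (Complex a c); rewrite /bdrect /inrect /= !lexx ab cd eqxx.
  by have [] := hr v z vr zb.
rewrite -ointB //; [|exact: bc2..].
apply: (@le_lt_trans _ _ (L * (M / r ^+ 3 * cmod (v - w)))).
  rewrite eL; apply: oint_bound => //; first by apply: bdcontB; exact: bc2.
  move=> z zb; have [d1 _] := hr v z vr zb.
  have [d2 _] : r <= cmod (z - w) /\ interiorQ a b c d w by apply: hr zb; rewrite subrr cmod0.
  have := bdrect_neq iv zb; have := bdrect_neq iw zb; rewrite -!(subr_eq0 z) => n1 n2.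
  have -> : F z / (z - v) / (z - w) - F z / (z - w) / (z - w) = F z / ((z - v) * (z - w) * (z - w)) * (v - w).
    by field; rewrite n1 n2.
  rewrite !cmodM cmodV !cmodM; apply: ler_wpM2r; first exact: cmod_ge0.
  apply: ler_pM; rewrite ?cmod_ge0 ?invr_ge0 ?mulr_ge0 ?cmod_ge0 //; first exact: hM.
  rewrite lef_pV2 ?posrE ?exprn_gt0 //; last first.
    by rewrite !mulr_gt0 // ?(lt_le_trans r0 d1) ?(lt_le_trans r0 d2).
  rewrite exprS expr2 mulrA; apply: ler_pM => //; rewrite ?mulr_ge0 ?(ltW r0) //.
  by apply: ler_pM; rewrite ?(ltW r0).
move: ve; rewrite ltr_pdivlMr ?mulr_gt0 // => ve.
rewrite mulrA mulrC mulrA mulrA ltr_pdivrMr ?exprn_gt0 //.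
apply: le_lt_trans ve; apply: ler_wpM2l; first exact: cmod_ge0.
by rewrite -mulrA ler_peMl ?ler1n // mulr_ge0 // ltW.
Qed.

End Cauchy.
(** * Comparison with the topology of numClosedFieldType *)

Section Bridge.
Variable R : realType.
Local Notation C := (R[i] : numClosedFieldType).
Implicit Types (f g : R[i] -> R[i]) (z w l : R[i]).

(** Radii in the topology of [C] are elements of [R[i]]; a positive one is real, so its real part is
    a radius in [R]. *)
Lemma nbhs_cnear (P : R[i] -> Prop) z : (\forall w \near (z : C), P w) <-> cnear z P.
Proof.
split.
  move=> /nbhs_ballP[e /= e0 h]; move: e0 h; case: e => x y; rewrite ltcE /= => /andP[/eqP -> x0] h.
  exists x => // w wz; apply: h; rewrite -ball_normE /ball_ /= cmodE.
  by rewrite -[X in _ < X]/((x%:C)%C) ltcR cmodB.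
move=> [d d0 h]; apply/nbhs_ballP; exists ((d%:C)%C); first by rewrite /= ltcR.
by move=> w; rewrite -ball_normE /ball_ /= cmodE ltcR cmodB => /h.
Qed.

Lemma dnbhs_cnear (P : R[i] -> Prop) z : (\forall w \near (z : C)^', P w) <-> cnear z (fun w => w != z -> P w).
Proof. exact: nbhs_cnear. Qed.

Lemma cvg_cnear (T : Type) (F : set_system T) (FF : Filter F) (f : T -> R[i]) l :
  (f x @[x --> F] --> (l : C)) <-> (forall e : R, 0 < e -> \forall x \near F, cmod (f x - l) < e).
Proof.
split=> [h e e0|h P].
  have : \forall w \near (l : C), cmod (w - l) < e by apply/nbhs_cnear; exists e.
  by move=> /h.
by move=> /nbhs_cnear[d d0 hP]; apply: filterS (h d d0) => x /hP.
Qed.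

Definition slope f z (h : R[i]) := h^-1 * (f (z + h) - f z).

Lemma derive_quotientE f z :
  (fun h : C => h^-1 *: ((f \o shift (z : C)) (h *: (1 : C)) - f z : C)) = slope f z.
Proof.
apply/funext => h; rewrite /slope /shift /= [in LHS]addrC.
by rewrite /GRing.scale /= mulr1 addrC [_ + z]addrC.
Qed.

Lemma cder_slope f z l : cder f z l <-> forall e : R, 0 < e ->
  cnear 0 (fun h => h != 0 -> cmod (slope f z h - l) < e).
Proof.
split.
  move=> [q [cq <-] hq] e e0; have [d d0 hd] := cnearI hq (cq e e0).
  exists d => // h; rewrite subr0 => hd' h0.
  have [] := hd (z + h); first by rewrite addrAC subrr add0r.
  by rewrite /slope => ->; rewrite [_ + h - _]addrAC subrr add0r [f z + _]addrC addrK mulrC mulfK.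
move=> H; exists (fun w => if w == z then l else slope f z (w - z)).
  rewrite eqxx; split=> // e e0; have [d d0 hd] := H e e0.
  exists d => // w wz; case: (eqVneq w z) => [_|n]; first by rewrite eqxx subrr cmod0.
  by rewrite eqxx; apply: hd; rewrite ?subr0 ?subr_eq0.
exists 1 => // w _; case: (eqVneq w z) => [->|n]; first by rewrite subrr mulr0 addr0.
rewrite /slope [z + _]addrC subrK mulrC mulrA divff ?subr_eq0 // mul1r.
by rewrite addrC subrK.
Qed.

Lemma cder_cvg f z l : cder f z l <-> (slope f z h @[h --> (0 : C)^'] --> (l : C)).
Proof.
rewrite cder_slope cvg_cnear; split=> H e e0; first by apply/dnbhs_cnear; exact: H.
by apply/dnbhs_cnear; exact: H.
Qed.

Lemma derivable_cdiff f z : derivable (f : C -> C) (z : C) (1 : C) <-> cdiff f z.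
Proof.
rewrite /derivable derive_quotientE; split.
  by move=> /cvg_ex[l h]; exists l; apply/cder_cvg.
by move=> [l /cder_cvg h]; apply/cvg_ex; exists l.
Qed.

Lemma cder_derive1 f z l : cder f z l -> derive1 (f : C -> C) (z : C) = l.
Proof.
move=> h; rewrite derive1E /derive derive_quotientE.
by apply: cvg_lim => //; apply/cder_cvg.
Qed.

Lemma cdiff_derive1 f z : cdiff f z -> cder f z (derive1 (f : C -> C) (z : C)).
Proof. by move=> [l h]; rewrite (cder_derive1 h). Qed.

Lemma analytic_atP f z : analytic_at (f : C -> C) z <-> cnear z (cdiff f).
Proof.
rewrite -nbhs_cnear /analytic_at.
by split; apply: filterS => w /derivable_cdiff.
Qed.

Lemma pole_atP f z : pole_at (f : C -> C) z ->
  cnear z (fun w => w != z -> cdiff f w) /\ forall M : R, cnear z (fun w => w != z -> M < cmod (f w)).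
Proof.
move=> [h1 h2]; split.
  by apply/dnbhs_cnear; apply: filterS h1 => w /derivable_cdiff.
move=> M; apply/dnbhs_cnear.
have hM : (+oo : set_system C) [set x | ((M%:C)%C) < x].
  exists ((M%:C)%C); split=> //.
  by rewrite realE; case: (ltP 0 M) => h; rewrite !lecR ?(ltW h) // h orbT.
have := h2 _ hM; rewrite /fmap /= => h3.
by apply/dnbhs_cnear; move: h3 => /dnbhs_cnear; apply: cnearW => w h wz; move: (h wz) => /=; rewrite cmodE ltcR.
Qed.

Definition copen (V : set R[i]) := forall z, V z -> cnear z V.

Lemma openP (V : set R[i]) : open (V : set C) <-> copen V.
Proof.
rewrite openE; split=> h z /h; first by move=> /nbhs_cnear.
by move=> ?; apply/nbhs_cnear.
Qed.

(** The last hypothesis makes the filter proper, so that the limit is determined. The values of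
    [fext] at real points are such limits, taken along [nonreal]. *)
Lemma lim_within f g z (D : set R[i]) : ccont g z -> cnear z (fun w => D w -> f w = g w) ->
  (forall P, cnear z P -> exists2 w, D w & P w) ->
  lim ((f : C -> C) w @[w --> within D (nbhs (z : C))]) = g z.
Proof.
move=> cg fg hD.
have PF : ProperFilter (within D (nbhs (z : C))).
  apply: Build_ProperFilter_ex => P /= /nbhs_cnear/hD[w Dw Pw].
  by exists w; exact: Pw.
apply: cvg_lim => //; apply/cvg_cnear => e e0.
apply/(@nbhs_cnear (fun w => D w -> cmod (f w - g z) < e)).
by apply: cnearW (cnearI fg (cg e e0)) => w [h1 h2] Dw; rewrite h1.
Qed.

Lemma near_oo_nat (P : nat -> Prop) : (\forall n \near \oo, P n) <-> exists N, forall n, (N <= n)%N -> P n.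
Proof. by split=> [[N _ h]|[N h]]; exists N. Qed.

Lemma near2_oo_nat (P : nat -> nat -> Prop) : (\forall m & n \near \oo, P m n) ->
  exists N, forall m n, (N <= m)%N -> (N <= n)%N -> P m n.
Proof.
move=> [[A B] /= [[N1 _ h1] [N2 _ h2]] h]; exists (maxn N1 N2) => m n.
by rewrite !geq_max => /andP[m1 _] /andP[_ n2]; apply: (h (m, n)); split; [exact: h1|exact: h2].
Qed.
End Bridge.
(** * Mean-square estimates on squares *)

Section BoundaryForm.
Variable R : realType.
Implicit Types (F G h : R[i] -> R[i]) (a b c d : R) (z w : R[i]).
Local Notation Re := (@complex.Re R).
Local Notation Im := (@complex.Im R).

Lemma conjcM z w : conjc (z * w) = conjc z * conjc w. Proof. exact: rmorphM. Qed.
Lemma conjcD z w : conjc (z + w) = conjc z + conjc w. Proof. exact: rmorphD. Qed.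
Lemma conjcN z : conjc (- z) = - conjc z. Proof. exact: rmorphN. Qed.
Lemma conjcB z w : conjc (z - w) = conjc z - conjc w. Proof. exact: rmorphB. Qed.
Lemma real_cM (x y : R) : ((x * y)%:C)%C = ((x%:C)%C * (y%:C)%C) :> R[i]. Proof. exact: rmorphM. Qed.
Lemma real_cD (x y : R) : ((x + y)%:C)%C = ((x%:C)%C + (y%:C)%C) :> R[i]. Proof. exact: rmorphD. Qed.
Lemma Re_real_cM (x : R) z : Re ((x%:C)%C * z) = x * Re z.
Proof. by case: z => p q /=; rewrite mul0r subr0. Qed.
Lemma Re_conjc z : Re (conjc z) = Re z. Proof. by case: z. Qed.

(** The choice l = k / B minimises the quadratic; when B = 0, a large multiple of [k] contradicts
    the hypothesis unless k = 0. As no form is mentioned, this serves for boundary integrals, for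
    forms on a subspace and for the limit inequality in [riesz]. *)
Lemma discriminant_le (A B : R) (k : R[i]) : 0 <= A -> 0 <= B ->
  (forall l : R[i], 0 <= A - 2 * Re (conjc l * k) + cmod l ^+ 2 * B) ->
  cmod k ^+ 2 <= A * B.
Proof.
move=> A0 B0 H; have [B1|B1] := eqVneq B 0.
  have [k0|k0] := eqVneq k 0; first by rewrite k0 cmod0 expr0n mulr_ge0.
  have k1 : 0 < cmod k ^+ 2 by rewrite exprn_gt0 // cmod_gt0.
  have := H ((((A + 1) / cmod k ^+ 2)%:C)%C * k).
  rewrite conjcM conjc_real -mulrA [conjc k * k]mulrC mul_conjc B1 mulr0 addr0.
  by rewrite -real_cM /= divfK ?gt_eqF //; lra.
have Bp : 0 < B by rewrite lt_def B1.
have := H (((B^-1)%:C)%C * k).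
rewrite conjcM conjc_real -mulrA [conjc k * k]mulrC mul_conjc cmodM cmod_real.
rewrite -real_cM /= ger0_norm ?invr_ge0 // exprMn -mulrA.
have -> : (B^-1) ^+ 2 * (cmod k ^+ 2 * B) = B^-1 * cmod k ^+ 2 by field.
by move=> h; rewrite -ler_pdivrMr // mulrC; lra.
Qed.

(** The arc-length integral: all four sides count positively, in contrast with [oint]. *)
Definition bdint a b c d F : R[i] :=
  hint F c a b + hint F d a b + (vint F a c d + vint F b c d).
Definition bdip a b c d F G := bdint a b c d (fun z => F z * conjc (G z)).
Definition bdn a b c d F : R := Re (bdip a b c d F F).
Definition bdlen a b c d : R := 2 * (b - a) + 2 * (d - c).

Variables (a b c d : R) (ab : a <= b) (cd : c <= d).
Local Notation bc := (bdcont a b c d).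
Local Notation bd := (bdrect a b c d).

Lemma bdcontM F G : bc F -> bc G -> bc (fun z => F z * G z).
Proof. by move=> f g z zb; apply: ccontM; [exact: f|exact: g]. Qed.
Lemma bdcontD F G : bc F -> bc G -> bc (fun z => F z + G z).
Proof. by move=> f g z zb; apply: ccontD; [exact: f|exact: g]. Qed.
Lemma bdcont_conj F : bc F -> bc (fun z => conjc (F z)).
Proof. by move=> f z zb; apply: (ccont_comp (f := F)); [exact: f|exact: ccont_conj]. Qed.
Lemma bdcont_cst l : bc (fun=> l). Proof. by move=> z _; exact: ccont_cst. Qed.

Lemma bdintD F G : bc F -> bc G ->
  bdint a b c d (fun z => F z + G z) = bdint a b c d F + bdint a b c d G.
Proof.
move=> /(bdcont_sides ab cd)[f1 f2 f3 f4] /(bdcont_sides ab cd)[g1 g2 g3 g4].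
by rewrite /bdint /hint /vint !cintD //; ring.
Qed.

Lemma bdintZ l F : bc F -> bdint a b c d (fun z => l * F z) = l * bdint a b c d F.
Proof.
move=> /(bdcont_sides ab cd)[f1 f2 f3 f4].
by rewrite /bdint /hint /vint !cintZ //; ring.
Qed.

Lemma bdint_conj F : bc F -> bdint a b c d (fun z => conjc (F z)) = conjc (bdint a b c d F).
Proof.
move=> /(bdcont_sides ab cd)[f1 f2 f3 f4].
by rewrite /bdint /hint /vint !cint_conj // !conjcD.
Qed.

Lemma eq_bdint F G : (forall z, bd z -> F z = G z) -> bdint a b c d F = bdint a b c d G.
Proof.
move=> h; rewrite /bdint /hint /vint.
congr (_ + _ + (_ + _)); apply: eq_cint => t /andP[t1 t2]; apply: h;
  by rewrite /bdrect /inrect /= t1 t2 ?ab ?cd lexx eqxx ?orbT.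
Qed.

Lemma le_Re_bdint F G : bc F -> bc G -> (forall z, bd z -> Re (F z) <= Re (G z)) ->
  Re (bdint a b c d F) <= Re (bdint a b c d G).
Proof.
move=> /(bdcont_sides ab cd)[f1 f2 f3 f4] /(bdcont_sides ab cd)[g1 g2 g3 g4] h.
by rewrite /bdint /hint /vint !ReD; apply: lerD; apply: lerD; apply: le_Re_cint => // t /andP[t1 t2];
  apply: h; rewrite /bdrect /inrect /= t1 t2 ?ab ?cd lexx eqxx ?orbT.
Qed.

Lemma bdint_cst l : bdint a b c d (fun=> l) = ((bdlen a b c d)%:C)%C * l.
Proof. by rewrite /bdint /hint /vint !cint_cst // /bdlen !mulr_natl real_cD !mulr2n !real_cD; ring. Qed.

Lemma bdip_lin l F G h : bc F -> bc G -> bc h ->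
  bdip a b c d (fun z => l * F z + G z) h = l * bdip a b c d F h + bdip a b c d G h.
Proof.
move=> f g k; have k' := bdcont_conj k.
rewrite -bdintZ; last exact: bdcontM.
rewrite -bdintD; [|by apply: bdcontZ; exact: bdcontM|exact: bdcontM].
by congr bdint; apply/funext => z; ring.
Qed.

Lemma bdip_conj F G : bc F -> bc G -> bdip a b c d G F = conjc (bdip a b c d F G).
Proof.
move=> f g; rewrite -bdint_conj; last by apply: bdcontM => //; exact: bdcont_conj.
by congr bdint; apply/funext => z; rewrite conjcM conjcK mulrC.
Qed.

Lemma Re_mul_conjc z : Re (z * conjc z) = cmod z ^+ 2.
Proof. by rewrite mul_conjc. Qed.

Lemma bdcont_sq F : bc F -> bc (fun z => F z * conjc (F z)).
Proof. by move=> f; apply: bdcontM => //; exact: bdcont_conj. Qed.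

Lemma bdn_le F G : bc F -> bc G -> (forall z, bd z -> cmod (F z) <= cmod (G z)) ->
  bdn a b c d F <= bdn a b c d G.
Proof.
move=> f g h; apply: le_Re_bdint; [exact: bdcont_sq..|].
by move=> z zb; rewrite !Re_mul_conjc lerXn2r ?nnegrE ?cmod_ge0 //; exact: h.
Qed.

Lemma bdn_ge0 F : bc F -> 0 <= bdn a b c d F.
Proof.
move=> f; have := @bdn_le (fun=> 0) F (bdcont_cst 0) f.
rewrite {1}/bdn /bdip bdint_cst mul0r mulr0; apply => z _.
by rewrite cmod0 cmod_ge0.
Qed.

Lemma bdip_self F : bc F -> bdip a b c d F F = ((bdn a b c d F)%:C)%C.
Proof.
move=> f; rewrite [LHS]complexE /bdn.
suff -> : Im (bdip a b c d F F) = 0 by rewrite mulr0 addr0.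
have := bdip_conj f f; case: (bdip a b c d F F) => x y /= [] /eqP.
by rewrite -addr_eq0 -mulr2n mulrn_eq0 => /eqP.
Qed.

Lemma bdip_CS F G : bc F -> bc G ->
  cmod (bdip a b c d F G) ^+ 2 <= bdn a b c d F * bdn a b c d G.
Proof.
move=> f g; apply: discriminant_le; [exact: bdn_ge0..|move=> l].
have e : bdip a b c d (fun z => (- l) * G z + F z) (fun z => (- l) * G z + F z) =
   bdip a b c d F F - (conjc l * bdip a b c d F G + conjc (conjc l * bdip a b c d F G)) + l * conjc l * bdip a b c d G G.
  have h : bc (fun z => (- l) * G z + F z) by apply: bdcontD => //; exact: bdcontZ.
  rewrite bdip_lin // (bdip_conj h g) (bdip_conj h f) !bdip_lin // (bdip_conj f g).
  have := bdip_conj f f; have := bdip_conj g g.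
  move: (bdip a b c d F F) (bdip a b c d G G) (bdip a b c d F G) => X Y Z eY eX.
  by rewrite !conjcD !conjcM !conjcN !conjcK -eX -eY; ring.
have h : bc (fun z => (- l) * G z + F z) by apply: bdcontD => //; exact: bdcontZ.
have := bdn_ge0 h; rewrite {1}/bdn e !bdip_self // mul_conjc -real_cM.
move: (conjc l * _) (bdn _ _ _ _ F) (cmod l ^+ 2 * _) => [x y] p q /=; lra.
Qed.

End BoundaryForm.

(** * Cauchy estimates in terms of the mean square on a boundary *)

Section SquareEstimates.
Variable R : realType.
Implicit Types (F G h : R[i] -> R[i]) (a b c d r : R) (z w u v : R[i]).
Local Notation Re := (@complex.Re R).
Local Notation Im := (@complex.Im R).
Local Notation mu := (@lebesgue_measure R).

Definition cabs z : R[i] := ((cmod z)%:C)%C.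

Lemma ccont_abs F z : ccont F z -> ccont (fun w => cabs (F w)) z.
Proof.
move=> cF e /cF [d d0 h]; exists d => // w /h; apply: le_lt_trans.
by rewrite /cabs -rmorphB cmod_real cmod_dist_dist.
Qed.

Lemma cint_norm a b (g : R -> R[i]) : rcontin a b g ->
  cmod (cint a b g) <= 2 * Re (cint a b (fun t => cabs (g t))).
Proof.
move=> cg.
have cn : rcontin a b (fun t => cabs (g t)).
  move=> t /cg ct; apply: (rcont_comp (F := fun z => cabs z) ct).
  by apply: (ccont_abs (F := id)); exact: ccont_id.
have P (p : R[i] -> R) : mu.-integrable `[a, b] (EFin \o (p \o g)) -> (forall z, `|p z| <= cmod z) ->
    `|\int[mu]_(t in `[a, b]) p (g t)| <= Re (cint a b (fun t => cabs (g t))).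
  move=> ip hp; apply: le_trans (le_normr_Rintegral _ ip) _ => //.
  by apply: (le_Rintegral _ (integrable_norm ip) (integrable_Re cn)) => // t _; exact: hp.
apply: le_trans (cmod_le_ReIm _) _; rewrite mulr2n mulrDl !mul1r; apply: lerD.
  by apply: P; [exact: integrable_Re|exact: Re_le_cmod].
by apply: P; [exact: integrable_Im|exact: Im_le_cmod].
Qed.

(** The contour integral is at most twice the arc-length integral of |F h|, and Cauchy-Schwarz
    against the constant 1 brings in the length of the boundary; 4 is the square of the factor 2 of
    [cint_norm]. *)
Lemma oint_CS a b c d F h (H : R) : a <= b -> c <= d -> bdcont a b c d F -> bdcont a b c d h -> 0 <= H ->
  (forall z, bdrect a b c d z -> cmod (h z) <= H) ->
  cmod (oint a b c d (fun z => F z * h z)) ^+ 2 <= 4 * H ^+ 2 * bdlen a b c d * bdn a b c d F.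
Proof.
move=> ab cd f k H0 hH.
have cA G : bdcont a b c d G -> bdcont a b c d (fun z => cabs (G z)).
  by move=> g z zb; apply: ccont_abs; exact: g.
have fk := bdcontM f k.
have c1 := bdcont_cst (a := a) (b := b) (c := c) (d := d) (1 : R[i]).
have [f1 f2 f3 f4] := bdcont_sides ab cd fk.
pose I := Re (bdint a b c d (fun z => cabs (F z))).
have le1 : cmod (oint a b c d (fun z => F z * h z)) <= 2 * Re (bdint a b c d (fun z => cabs (F z * h z))).
  rewrite /oint /bdint; apply: le_trans (cmodD _ _) _; rewrite cmodM cmod_i mul1r.
  apply: le_trans (lerD (cmodD _ _) (cmodD _ _)) _; rewrite !cmodN !ReD.
  have := cint_norm f1; have := cint_norm f2; have := cint_norm f3; have := cint_norm f4.
  by rewrite /hint /vint; lra.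
have le2 : Re (bdint a b c d (fun z => cabs (F z * h z))) <= H * I.
  rewrite /I -Re_real_cM -bdintZ //; last exact: cA.
  apply: le_Re_bdint => //; [exact: cA|by apply: bdcontZ; exact: cA|].
  by move=> z zb; rewrite /cabs -real_cM /= cmodM mulrC; apply: ler_wpM2r; [exact: cmod_ge0|exact: hH].
have I0 : 0 <= I.
  rewrite /I; have := le_Re_bdint ab cd (bdcont_cst (0 : R[i])) (cA _ f).
  by rewrite bdint_cst // mulr0 /=; apply => z _ /=; exact: cmod_ge0.
have le3 : I ^+ 2 <= bdlen a b c d * bdn a b c d F.
  have := bdip_CS ab cd (cA _ f) c1.
  have -> : bdip a b c d (fun z => cabs (F z)) (fun=> 1) = bdint a b c d (fun z => cabs (F z)).
    by congr bdint; apply/funext => z; rewrite rmorph1 mulr1.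
  have -> : bdn a b c d (fun=> 1) = bdlen a b c d.
    by rewrite /bdn /bdip rmorph1 mulr1 bdint_cst // mulr1.
  have -> : bdn a b c d (fun z => cabs (F z)) = bdn a b c d F.
    congr Re; apply: eq_bdint => // z _.
    by rewrite mul_conjc /cabs cmod_real ger0_norm ?cmod_ge0 // mul_conjc.
  rewrite mulrC; apply: le_trans; rewrite -/I.
  have -> : I ^+ 2 = `|I| ^+ 2 by rewrite real_normK ?num_real.
  by rewrite lerXn2r ?nnegrE ?cmod_ge0 //; exact: Re_le_cmod.
have le4 : cmod (oint a b c d (fun z => F z * h z)) <= 2 * (H * I) by lra.
apply: (@le_trans _ _ ((2 * (H * I)) ^+ 2)).
  by rewrite lerXn2r ?nnegrE ?cmod_ge0 // !mulr_ge0.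
rewrite !exprMn -[4 * _ * _ * _]mulrA -[4 * _ * _]mulrA.
have -> : (2 : R) ^+ 2 = 4 by ring.
by apply: ler_wpM2l => //; apply: ler_wpM2l => //; exact: sqr_ge0.
Qed.

Definition insq z r := inrect (Re z - r) (Re z + r) (Im z - r) (Im z + r).
Definition bdsq z r := bdrect (Re z - r) (Re z + r) (Im z - r) (Im z + r).
Definition osq z r := oint (Re z - r) (Re z + r) (Im z - r) (Im z + r).
Definition sqn z r := bdn (Re z - r) (Re z + r) (Im z - r) (Im z + r).

Lemma bdsq_insq z r w : bdsq z r w -> insq z r w. Proof. by case. Qed.

Lemma sq_le (x r : R) : 0 <= r -> x - r <= x + r. Proof. by lra. Qed.

Lemma insq_cmod z r w : insq z r w -> cmod (w - z) <= 2 * r.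
Proof.
move=> /andP[/andP[z1 z2] /andP[z3 z4]]; apply: le_trans (cmod_le_ReIm _) _.
have i1 : `|Re (w - z)| <= r by rewrite ReB ler_norml; apply/andP; split; lra.
have i2 : `|Im (w - z)| <= r by rewrite ImB ler_norml; apply/andP; split; lra.
lra.
Qed.

Lemma cmod_interior z r w : cmod (w - z) < r -> interiorQ (Re z - r) (Re z + r) (Im z - r) (Im z + r) w.
Proof.
move=> h; have := le_lt_trans (Re_le_cmod _) h; have := le_lt_trans (Im_le_cmod _) h.
rewrite ReB ImB !ltr_norml => /andP[a1 a2] /andP[a3 a4].
by apply/and4P; split; lra.
Qed.

Lemma cmod_insq z r w : cmod (w - z) < r -> insq z r w.
Proof. by move=> /cmod_interior/and4P[h1 h2 h3 h4]; rewrite /insq /inrect !ltW. Qed.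

Lemma bdsq_far z r w u : 0 < r -> bdsq z r w -> cmod (u - z) < r / 2 -> r / 2 <= cmod (w - u).
Proof.
move=> r0 wb uz; have := bdrect_center r0 wb; have := cmod_triangle u w z; lra.
Qed.

Lemma cauchy_sq F z r w : cmod (w - z) < r -> (forall s, insq z r s -> cdiff F s) ->
  osq z r (fun s => F s / (s - w)) = kappa R * F w.
Proof. by move=> wz hF; apply: cauchy_formula => //; exact: cmod_interior. Qed.

Lemma cdiff_bdcont F z r : (forall s, insq z r s -> cdiff F s) ->
  bdcont (Re z - r) (Re z + r) (Im z - r) (Im z + r) F.
Proof. by move=> hF s sb; apply: cdiff_cont; apply: hF; exact: bdsq_insq. Qed.

(** For distinct points, partial fractions turn the product of two Cauchy kernels into a difference
    of two Cauchy formulas. For equal points the integral is the derivative of the Cauchy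
    integral. *)
Lemma diff_quot_sq F z r u w : cmod (u - z) < r -> cmod (w - z) < r ->
  (forall s, insq z r s -> cdiff F s) ->
  osq z r (fun s => F s / (s - u) / (s - w)) = kappa R * diff_quot u F w.
Proof.
move=> uz wz hF; have r0 : 0 < r by apply: le_lt_trans uz; exact: cmod_ge0.
have bF := cdiff_bdcont hF.
have iu := cmod_interior uz; have iw := cmod_interior wz.
have abr := sq_le (Re z) (ltW r0); have abi := sq_le (Im z) (ltW r0).
rewrite /diff_quot; have [->|wu] := eqVneq w u.
  apply: (@cder_unique R (fun v => osq z r (fun s => F s / (s - v))) u).
    exact: cder_cauchy_integral.
  have dF := cdiff_derive1 (hF u (cmod_insq uz)).
  have := cderM (cder_cst (kappa R) u) dF; rewrite mul0r add0r.
  apply: cder_local; apply: cnearW (cnear_open uz) => v vz.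
  by rewrite cauchy_sq.
apply: (mulIf (x := w - u)); first by rewrite subr_eq0.
rewrite -(mulrA (kappa R)) divfK ?subr_eq0 // [RHS]mulrBr -(cauchy_sq wz hF) -(cauchy_sq uz hF).
rewrite mulrC -ointZ //; last by apply: (bdcont_cauchy (F := fun s => F s / (s - u))) => //; exact: bdcont_cauchy.
rewrite -ointB //; [|exact: bdcont_cauchy..].
apply: eq_oint => // s sb.
have := bdrect_neq iu sb; have := bdrect_neq iw sb; rewrite -!(subr_eq0 s) => n1 n2.
by field; rewrite n1 n2.
Qed.

(** The singularity is removable because near [u] the quotient is, up to the factor kappa, the
    Cauchy integral of the boundary function F s / (s - u). *)
Lemma cdiff_diff_quot_center F z r u : cmod (u - z) < r ->
  (forall s, insq z r s -> cdiff F s) -> cdiff (diff_quot u F) u.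
Proof.
move=> uz hF; have bF := cdiff_bdcont hF; have iu := cmod_interior uz.
have := cder_cauchy_integral iu (bdcont_cauchy iu bF).
move=> h; have := cderM (cder_cst (kappa R)^-1 u) h; rewrite mul0r add0r => h2.
apply: cdiff_local (ex_intro _ _ h2).
apply: cnearW (cnear_open uz) => v vz.
by rewrite -[X in _ = X](mulKf (kappa_neq0 R)) -(diff_quot_sq uz vz hF).
Qed.

(** The constants of [oint_CS] for one and for two Cauchy kernels: a kernel is at most 2/r on the
    boundary when its pole is within r/2 of the centre, and the perimeter is 8 r. *)
Definition sqK r : R := 4 * (2 / r) ^+ 2 * (8 * r) / cmod (kappa R) ^+ 2.
Definition sqK2 r : R := 4 * ((2 / r) * (2 / r)) ^+ 2 * (8 * r) / cmod (kappa R) ^+ 2.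

Lemma bdlen_sq z r : bdlen (Re z - r) (Re z + r) (Im z - r) (Im z + r) = 8 * r.
Proof. by rewrite /bdlen; ring. Qed.

Lemma inv_far z r w u : 0 < r -> bdsq z r w -> cmod (u - z) < r / 2 -> cmod (w - u)^-1 <= 2 / r.
Proof.
move=> r0 wb uz; have far := bdsq_far r0 wb uz.
rewrite cmodV -[2 / r]invrK invf_div lef_pV2 ?posrE ?divr_gt0 //.
by apply: lt_le_trans far; rewrite divr_gt0.
Qed.

Lemma eval_bound F z r w : 0 < r -> cmod (w - z) < r / 2 -> (forall s, insq z r s -> cdiff F s) ->
  cmod (F w) ^+ 2 <= sqK r * sqn z r F.
Proof.
move=> r0 wz hF; have wz' : cmod (w - z) < r by apply: lt_trans wz _; lra.
have bF := cdiff_bdcont hF; have iw := cmod_interior wz'.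
have abr := sq_le (Re z) (ltW r0); have abi := sq_le (Im z) (ltW r0).
have bI : bdcont (Re z - r) (Re z + r) (Im z - r) (Im z + r) (fun s => (s - w)^-1).
  by move=> s sb; apply: cdiff_cont; apply: cdiff_inv; exact: bdrect_neq iw sb.
have := oint_CS abr abi bF bI (H := 2 / r) _ (fun s sb => inv_far r0 sb wz).
rewrite -/(osq z r) (cauchy_sq wz' hF) cmodM exprMn bdlen_sq -/(sqn z r F) => /(_ _) h.
have k0 : 0 < cmod (kappa R) ^+ 2 by rewrite exprn_gt0 // cmod_gt0 kappa_neq0.
rewrite /sqK mulrAC ler_pdivlMr // mulrC; apply: h.
by rewrite divr_ge0 // ltW.
Qed.

(** The bound is uniform up to the diagonal u = w, where an estimate from |F w| and |F u| alone
    would blow up. *)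
Lemma diff_quot_bound F z r u w : 0 < r -> cmod (u - z) < r / 2 -> cmod (w - z) < r / 2 ->
  (forall s, insq z r s -> cdiff F s) ->
  cmod (diff_quot u F w) ^+ 2 <= sqK2 r * sqn z r F.
Proof.
move=> r0 uz wz hF; have wz' : cmod (w - z) < r by apply: lt_trans wz _; lra.
have uz' : cmod (u - z) < r by apply: lt_trans uz _; lra.
have bF := cdiff_bdcont hF; have iw := cmod_interior wz'; have iu := cmod_interior uz'.
have abr := sq_le (Re z) (ltW r0); have abi := sq_le (Im z) (ltW r0).
have bI : bdcont (Re z - r) (Re z + r) (Im z - r) (Im z + r) (fun s => (s - u)^-1 * (s - w)^-1).
  by move=> s sb; apply: ccontM; apply: cdiff_cont; apply: cdiff_inv; [exact: bdrect_neq iu sb|exact: bdrect_neq iw sb].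
have r2 : 0 <= 2 / r by rewrite divr_ge0 // ltW.
have := oint_CS abr abi bF bI (H := (2 / r) * (2 / r)) (mulr_ge0 r2 r2).
have -> : (fun s => F s * ((s - u)^-1 * (s - w)^-1)) = (fun s => F s / (s - u) / (s - w)).
  by apply/funext => s; rewrite mulrA.
rewrite -/(osq z r) (diff_quot_sq uz' wz' hF) cmodM exprMn bdlen_sq -/(sqn z r F) => h.
have k0 : 0 < cmod (kappa R) ^+ 2 by rewrite exprn_gt0 // cmod_gt0 kappa_neq0.
rewrite /sqK2 mulrAC ler_pdivlMr // mulrC; apply: h => s sb.
by rewrite cmodM; apply: ler_pM; rewrite ?cmod_ge0 //; exact: (inv_far r0 sb).
Qed.

End SquareEstimates.

(** * Compactness of squares and locally uniform limits *)

Section LocalToGlobal.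
Variable R : realType.
Implicit Types (F G : R[i] -> R[i]) (z w u c : R[i]) (r : R).
Local Notation Re := (@complex.Re R).
Local Notation Im := (@complex.Im R).

(** A compactness argument along the filter at +oo: constants exist locally, and monotonicity of [Q]
    in the constant lets a single large one serve the whole square. *)
Lemma insq_bounded (Q : R -> R[i] -> Prop) c r :
  (forall M M' z, M <= M' -> Q M z -> Q M' z) ->
  (forall z, insq c r z -> exists M, cnear z (Q M)) ->
  exists2 M : R, 0 < M & forall z, insq c r z -> Q M z.
Proof.
move=> mono loc.
pose K : set (R * R) := `[Re c - r, Re c + r] `*` `[Im c - r, Im c + r].
have cK : compact K by apply: compact_setX; exact: segment_compact.
have : \forall M \near +oo, K `<=` (fun p => Q M (Complex p.1 p.2)).
  have PF : Filter (+oo : set_system R) by typeclasses eauto.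
  move: cK => /compact_near_coveringP/(_ R (+oo) (fun M p => Q M (Complex p.1 p.2)) PF); apply.
  move=> [s t] [/= sI tI]; rewrite !in_itv /= in sI tI.
  have [M [d d0 hd]] := loc (Complex s t) (introT andP (conj sI tI)).
  exists ([set p : R * R | `|s - p.1| < d / 2 /\ `|t - p.2| < d / 2], [set M' | M <= M']).
    split=> /=; last by apply: nbhs_pinfty_ge; exact: num_real.
    exists ([set x | `|s - x| < d / 2], [set x | `|t - x| < d / 2]).
      by split; apply/nbhs_ballP; exists (d / 2) => //=; rewrite divr_gt0.
    by move=> [x y] /=.
  move=> [[x y] M'] [/= [h1 h2] MM']; apply: mono MM' _; apply: hd.
  apply: le_lt_trans (cmod_le_ReIm _) _; rewrite ReB ImB /=.
  by rewrite distrC [X in _ + X]distrC; lra.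
move=> [M0 [_ h]]; exists (Num.max 1 (M0 + 1)); first by rewrite lt_max ltr01.
move=> z /andP[zR zI].
have := h (Num.max 1 (M0 + 1)) _ (Re z, Im z); rewrite /K /=; case: z zR zI => x y /= zR zI; apply.
  by rewrite lt_max ltrDl ltr01 orbT.
by split; rewrite /= in_itv.
Unshelve. all: by end_near. Qed.

Variable O : set R[i].
Hypothesis oO : copen O.

Definition holo F := forall z, O z -> cdiff F z.

Lemma exists_sq z : O z -> exists2 r : R, 0 < r & forall w, insq z r w -> O w.
Proof.
move=> /oO[d d0 h]; exists (d / 3); first by rewrite divr_gt0.
by move=> w /insq_cmod wz; apply: h; lra.
Qed.

Lemma holo_diff_quot F u : O u -> holo F -> holo (diff_quot u F).
Proof.
move=> Ou hF z Oz; have [->|zu] := eqVneq z u.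
  have [r r0 hr] := exists_sq Ou.
  by apply: (@cdiff_diff_quot_center R F u r); [rewrite subrr cmod0|move=> s /hr/hF].
apply: (@cdiff_local R (fun w => (F w - F u) / (w - u))).
  by apply: cnearW (cnear_neq zu) => w wu; rewrite /diff_quot (negbTE wu).
apply: cdiffM; last exact: cdiff_inv.
by apply: cdiffB; [exact: hF|exact: cdiff_cst].
Qed.

(** Weierstrass' theorem: [F] is continuous as a local uniform limit, the Cauchy formula for the
    approximants passes to the limit, and a Cauchy integral with continuous boundary values is
    differentiable. *)
Lemma holo_limit F : (forall z, O z -> exists2 d : R, 0 < d & forall e : R, 0 < e ->
    exists2 G, holo G & forall w, cmod (w - z) < d -> O w -> cmod (F w - G w) < e) -> holo F.
Proof.
move=> H.
have cF z : O z -> ccont F z.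
  move=> Oz e e0; have [d d0 hd] := H z Oz.
  have e3 : 0 < e / 3 by rewrite divr_gt0.
  have [G hG FG] := hd _ e3.
  apply: cnearW (cnearI (cnearI (oO Oz) (cnear_cball z d0)) (cdiff_cont (hG z Oz) e3)) => w [[Ow wd] h].
  have h1 := FG w wd Ow; have h2 : cmod (F z - G z) < e / 3 by apply: FG => //; rewrite subrr cmod0.
  have := cmod_triangle (G w) (F w) (F z); have := cmod_triangle (G z) (G w) (F z).
  by rewrite [cmod (G z - F z)]cmodB; lra.
move=> z Oz; have [r0 r00 hr0] := exists_sq Oz; have [d d0 hd] := H z Oz.
pose r := Num.min r0 (d / 3).
have r0p : 0 < r by rewrite lt_min r00 divr_gt0.
have rr0 : r <= r0 by rewrite ge_min lexx.
have rd : r <= d / 3 by rewrite ge_min lexx orbT.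
clearbody r.
have sub w : insq z r w -> O w /\ cmod (w - z) < d.
  move=> wi; split; last by have := insq_cmod wi; lra.
  by apply: hr0; move: wi => /andP[/andP[a1 a2] /andP[a3 a4]]; apply/andP; split; apply/andP; split; lra.
have bF : bdcont (Re z - r) (Re z + r) (Im z - r) (Im z + r) F.
  by move=> s sb; apply: cF; have [] := sub s (bdsq_insq sb).
have abr := sq_le (Re z) (ltW r0p); have abi := sq_le (Im z) (ltW r0p).
have r2 : 0 < r / 2 by rewrite divr_gt0.
have key w : cmod (w - z) < r / 2 -> osq z r (fun s => F s / (s - w)) = kappa R * F w.
  move=> wz; have wz' : cmod (w - z) < r by lra.
  have iw := cmod_interior wz'.
  apply/eqP; rewrite -subr_eq0 -cmod_eq0; apply/negPn/negP => n0.
  set X := cmod _ in n0; have X0 : 0 < X by rewrite lt_def n0 cmod_ge0.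
  (* Replacing [F] by [G] with error e costs at most 32 e on the boundary and cmod (kappa R) * e at
     [w]. As L exceeds the sum of both factors, e = X/(2 L) gives X <= X/2. *)
  pose L := 64 + cmod (kappa R) + 1.
  have L0 : 0 < L by rewrite /L; have := cmod_ge0 (kappa R); lra.
  have e0 : 0 < X / (2 * L) by rewrite divr_gt0 // mulr_gt0.
  have [G hG FG] := hd _ e0.
  have hGs s : insq z r s -> cdiff G s by move=> /sub[+ _]; exact: hG.
  have bG := cdiff_bdcont hGs.
  have bFG := bdcontB bF bG.
  have e : osq z r (fun s => F s / (s - w)) - kappa R * F w =
      osq z r (fun s => (F s - G s) / (s - w)) - kappa R * (F w - G w).
    rewrite (_ : (fun s => (F s - G s) / (s - w)) = (fun s => F s / (s - w) - G s / (s - w))); last first.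
      by apply/funext => s; rewrite mulrBl.
    by rewrite /osq ointB //; [rewrite -/(osq z r) (cauchy_sq wz' hGs); ring|exact: bdcont_cauchy..].
  have b1 : cmod (osq z r (fun s => (F s - G s) / (s - w))) <= 4 * ((Re z + r - (Re z - r)) + (Im z + r - (Im z - r))) * (X / (2 * L) * (2 / r)).
    apply: oint_bound => //; first exact: bdcont_cauchy.
    move=> s sb; rewrite cmodM; apply: ler_pM; rewrite ?cmod_ge0 //.
      by have [Os sd] := sub s (bdsq_insq sb); apply: ltW; exact: FG.
    exact: (inv_far r0p sb wz).
  have b2 : cmod (F w - G w) <= X / (2 * L).
    by have [Ow wd] := sub w (cmod_insq wz'); apply: ltW; exact: FG.
  have b3 : X <= 32 * (X / (2 * L)) + cmod (kappa R) * (X / (2 * L)).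
    rewrite {1}/X e; apply: le_trans (cmodD _ _) _; rewrite cmodN cmodM; apply: lerD.
      apply: le_trans b1 _; rewrite le_eqVlt; apply/orP; left; apply/eqP; field.
      by rewrite !gt_eqF.
    by apply: ler_wpM2l => //; exact: cmod_ge0.
  move: b3; rewrite -mulrDl => b3.
  have : X <= L * (X / (2 * L)).
    by apply: le_trans b3 _; apply: ler_wpM2r; [exact: ltW|rewrite /L; lra].
  have -> : L * (X / (2 * L)) = X / 2 by field; rewrite gt_eqF.
  lra.
have iz : interiorQ (Re z - r) (Re z + r) (Im z - r) (Im z + r) z.
  by apply: cmod_interior; rewrite subrr cmod0.
have := cderM (cder_cst (kappa R)^-1 z) (cder_cauchy_integral iz bF); rewrite mul0r add0r => h2.
apply: cdiff_local (ex_intro _ _ h2).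
apply: cnearW (cnear_cball z r2) => w wz.
by rewrite -/(osq z r _) key // mulKf // kappa_neq0.
Qed.

End LocalToGlobal.
(** * Hilbert spaces *)

Section PsdForms.
Variables (R : realType) (V : lmodType R[i]) (S : set V) (b : V -> V -> R[i]).
Hypotheses (hS : is_subspace S) (hb : hermitian_on S b) (b0 : forall x, S x -> 0 <= complex.Re (b x x)).
Local Notation Re := (@complex.Re R).

Lemma form_self x : S x -> b x x = ((Re (b x x))%:C)%C.
Proof.
move=> Sx; have : b x x = conjc (b x x) := hb.2 x x Sx Sx; case: (b x x) => p q [] /eqP.
by rewrite -addr_eq0 -mulr2n mulrn_eq0 => /eqP ->.
Qed.

Lemma psd_CS_on x y : S x -> S y -> cmod (b x y) ^+ 2 <= Re (b x x) * Re (b y y).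
Proof.
move=> Sx Sy; apply: discriminant_le; [exact: b0|exact: b0|move=> l].
have [hl hc] := hb; have Sz : S ((- l) *: y + x) by exact: hS.2.
have bc u w : S u -> S w -> b w u = conjc (b u w) := hc u w.
have := b0 Sz.
rewrite hl // (bc _ y Sz Sy) (bc _ x Sz Sx) !hl // (bc x y Sx Sy).
rewrite !conjcD !conjcM !conjcN !conjcK (form_self Sx) (form_self Sy) !conjc_real.
move: (b x y) => [p q]; case: l {Sz} => l1 l2; rewrite cmod_sqr /= => h.
by apply: le_trans h _; rewrite le_eqVlt; apply/orP; left; apply/eqP; ring.
Qed.
End PsdForms.

(** Hilbert spaces as types with a total inner product, so that operators are plain functions;
    [is_hilbert_image] translates back to [is_hilbert], which speaks of a subset of an ambient
    space. *)
Record hilbert (R : realType) := Hilbert {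
  hsort :> lmodType R[i];
  ip : hsort -> hsort -> R[i];
  ip_linear : forall a x y z, ip (a *: x + y) z = a * ip x z + ip y z;
  ip_conj : forall x y, ip y x = conjc (ip x y);
  ip_ge0 : forall x, 0 <= complex.Re (ip x x);
  ip_def : forall x, complex.Re (ip x x) = 0 -> x = 0;
  ip_complete : forall u : nat -> hsort,
    (forall e : R, 0 < e -> exists N, forall m n, (N <= m)%N -> (N <= n)%N ->
       Num.sqrt (complex.Re (ip (u m - u n) (u m - u n))) < e) ->
    exists l, forall e : R, 0 < e -> exists N, forall n, (N <= n)%N ->
       Num.sqrt (complex.Re (ip (u n - l) (u n - l))) < e }.

Section HilbertBasics.
Variables (R : realType) (H : hilbert R).
Implicit Types (x y z w m : H) (a b : R[i]) (u v : nat -> H).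
Local Notation Re := (@complex.Re R).

Definition nsq x : R := Re (ip x x).
Definition nr x : R := Num.sqrt (nsq x).

Lemma ip0l x : ip 0 x = 0.
Proof. by have := ip_linear (-1) 0 0 x; rewrite scaler0 addr0 mulN1r addNr. Qed.
Lemma ipDl x y z : ip (x + y) z = ip x z + ip y z.
Proof. by rewrite -[x]scale1r ip_linear mul1r scale1r. Qed.
Lemma ipZl a x z : ip (a *: x) z = a * ip x z.
Proof. by rewrite -[_ *: _]addr0 ip_linear ip0l addr0. Qed.
Lemma ip0r x : ip x 0 = 0.
Proof. by rewrite ip_conj ip0l conjc0. Qed.
Lemma ipDr x y z : ip z (x + y) = ip z x + ip z y.
Proof. by rewrite ip_conj ipDl conjcD -!ip_conj. Qed.
Lemma ipZr a x z : ip z (a *: x) = conjc a * ip z x.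
Proof. by rewrite ip_conj ipZl conjcM -!ip_conj. Qed.
Lemma ipNl x z : ip (- x) z = - ip x z.
Proof. by rewrite -scaleN1r ipZl mulN1r. Qed.
Lemma ipNr x z : ip z (- x) = - ip z x.
Proof. by rewrite ip_conj ipNl conjcN -ip_conj. Qed.
Lemma ipBl x y z : ip (x - y) z = ip x z - ip y z.
Proof. by rewrite ipDl ipNl. Qed.
Lemma ipBr x y z : ip z (x - y) = ip z x - ip z y.
Proof. by rewrite ipDr ipNr. Qed.

Lemma ip_self x : ip x x = ((nsq x)%:C)%C.
Proof.
rewrite /nsq; have := ip_conj x x; case: (ip x x) => p q [] /eqP.
by rewrite -addr_eq0 -mulr2n mulrn_eq0 => /eqP ->.
Qed.

Lemma nsq_ge0 x : 0 <= nsq x. Proof. exact: ip_ge0. Qed.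
Lemma nr_ge0 x : 0 <= nr x. Proof. exact: sqrtr_ge0. Qed.
Lemma nr_sq x : nr x ^+ 2 = nsq x. Proof. by rewrite sqr_sqrtr // nsq_ge0. Qed.
Lemma nr_eq0 x : (nr x == 0) = (x == 0).
Proof.
apply/eqP/eqP => [h|->]; last by rewrite /nr /nsq ip0l sqrtr0.
by apply: ip_def; rewrite -/(nsq x) -nr_sq h expr0n.
Qed.
Lemma nr0 : nr 0 = 0. Proof. by apply/eqP; rewrite nr_eq0. Qed.

Lemma le_nr x (c : R) : 0 <= c -> nsq x <= c ^+ 2 -> nr x <= c.
Proof. by move=> c0; rewrite -nr_sq => h; exact: sqr_le_of_le2 c0 h. Qed.

Lemma nsqZ a x : nsq (a *: x) = cmod a ^+ 2 * nsq x.
Proof. by rewrite {1}/nsq ipZl ipZr mulrA mul_conjc ip_self -real_cM. Qed.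

Lemma nrZ a x : nr (a *: x) = cmod a * nr x.
Proof. by rewrite /nr nsqZ sqrtrM ?sqr_ge0 // sqrtr_sqr ger0_norm // cmod_ge0. Qed.
Lemma nrN x : nr (- x) = nr x.
Proof. by rewrite -scaleN1r nrZ cmodN cmod1 mul1r. Qed.
Lemma nrB x y : nr (x - y) = nr (y - x). Proof. by rewrite -nrN opprB. Qed.

Lemma nsqD x y : nsq (x + y) = nsq x + nsq y + 2 * Re (ip x y).
Proof.
rewrite {1}/nsq ipDl !ipDr (ip_conj x y) !ReD Re_conjc /nsq; ring.
Qed.

Lemma psd_CS (b : H -> H -> R[i]) : (forall a x y z, b (a *: x + y) z = a * b x z + b y z) ->
  (forall x y, b y x = conjc (b x y)) -> (forall x, 0 <= Re (b x x)) ->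
  forall x y, cmod (b x y) ^+ 2 <= Re (b x x) * Re (b y y).
Proof.
by move=> bl bc bp x y; apply: (@psd_CS_on R H setT b).
Qed.

Lemma ip_CS x y : cmod (ip x y) ^+ 2 <= nsq x * nsq y.
Proof. by apply: psd_CS; [exact: ip_linear|exact: ip_conj|exact: ip_ge0]. Qed.

Lemma ip_CS_nr x y : cmod (ip x y) <= nr x * nr y.
Proof.
apply: sqr_le_of_le2; first by rewrite mulr_ge0 ?nr_ge0.
by rewrite exprMn !nr_sq ip_CS.
Qed.

Lemma nrD x y : nr (x + y) <= nr x + nr y.
Proof.
apply: le_nr; first by rewrite addr_ge0 ?nr_ge0.
rewrite nsqD sqrrD !nr_sq.
have : Re (ip x y) <= nr x * nr y by apply: le_trans (ler_norm _) _; apply: le_trans (Re_le_cmod _) (ip_CS_nr _ _).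
by rewrite -mulr_natl; lra.
Qed.

Lemma nr_triangle y x z : nr (x - z) <= nr (x - y) + nr (y - z).
Proof. by rewrite -[x - z](subrKA y) nrD. Qed.

Lemma parallelogram x y : nsq (x - y) = 2 * nsq x + 2 * nsq y - nsq (x + y).
Proof.
have nn : nsq (- y) = nsq y by rewrite -!nr_sq nrN.
rewrite !nsqD ipNr nn; move: (ip x y) => [p q] /=; ring.
Qed.

Definition cvgH u x := forall e : R, 0 < e -> exists N, forall n, (N <= n)%N -> nr (u n - x) < e.

Lemma completeH u : (forall e : R, 0 < e -> exists N, forall i j : nat, (N <= i)%N -> (N <= j)%N -> nr (u i - u j) < e) ->
  exists x, cvgH u x.
Proof. exact: ip_complete. Qed.

Lemma cvgH_le u x (f : H -> R) (c K : R) : 0 <= K -> cvgH u x -> (forall y z, f z <= f y + K * nr (y - z)) ->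
  (forall n, f (u n) <= c) -> f x <= c.
Proof.
move=> K0 ux fL fc; apply/ler_addgt0Pr => e e0.
have e1 : 0 < e / (K + 1) by rewrite divr_gt0 // ltr_wpDl.
have [N hN] := ux _ e1; apply: le_trans (fL (u N) x) _; apply: lerD; first exact: fc.
have := hN N (leqnn N); rewrite ltr_pdivlMr ?ltr_wpDl // => h.
have := nr_ge0 (u N - x); nra.
Qed.

Lemma ip_eq0 x : (forall y, ip y x = 0) -> x = 0.
Proof. by move=> h; apply: ip_def; rewrite h. Qed.

Lemma ip_injl x y : (forall z, ip x z = ip y z) -> x = y.
Proof. by move=> h; apply/eqP; rewrite -subr_eq0; apply/eqP/ip_eq0 => z; rewrite ip_conj ipBl h subrr conjc0. Qed.

Lemma nr_le0 x : (forall e : R, 0 < e -> nr x <= e) -> x = 0.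
Proof.
move=> h; apply/eqP; rewrite -nr_eq0 eq_le nr_ge0 andbT.
by apply/ler_addgt0Pr => e e0; rewrite add0r h.
Qed.

Definition closureH (W : H -> Prop) x := exists u, (forall n, W (u n)) /\ cvgH u x.

Lemma Re_conj_expand (l b c : R[i]) : Re (conjc l * - conjc (conjc c - b)) = Re (l * b) - Re (conjc l * c).
Proof. by case: l => l1 l2; case: b => b1 b2; case: c => c1 c2 /=; ring. Qed.

(** The functional |w|^2 - 2 Re (phi w) should be |w - m|^2 - |m|^2, so [m] is found as the limit of
    a minimising sequence. [W] is an arbitrary subspace, whence the clause on its closure.
    Projections, adjoints, evaluation vectors, Douglas' factorization and density are all drawn from
    this statement. *)
Lemma riesz (W : H -> Prop) (phi : H -> R[i]) (s : R) : is_subspace W -> 0 <= s ->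
  (forall a x y, W x -> W y -> phi (a *: x + y) = a * phi x + phi y) ->
  (forall x, W x -> cmod (phi x) <= s * nr x) ->
  exists m, [/\ forall w, W w -> phi w = ip w m, nr m <= s & closureH W m].
Proof.
move=> [W0 WL] s0 phL phB.
pose q w := nsq w - 2 * Re (phi w).
have qlb w : W w -> - s ^+ 2 <= q w.
  move=> /phB h; rewrite /q -nr_sq.
  have : Re (phi w) <= s * nr w by apply: le_trans (ler_norm _) _; apply: le_trans (Re_le_cmod _) h.
  have := sqr_ge0 (nr w - s); rewrite sqrrB; lra.
pose I := inf [set q w | w in W].
have hI : has_inf [set q w | w in W].
  by split; [exists (q 0), 0|exists (- s ^+ 2) => _ [w Ww <-]; exact: qlb].
have Ile w : W w -> I <= q w by move=> Ww; apply: ge_inf; [case: hI|exists w].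
have ex (n : nat) : exists w, W w /\ q w < I + (n.+1%:R)^-1.
  have [|x [w Ww <-] h] := @inf_adherent R [set q w | w in W] (n.+1%:R)^-1 _ hI; first by rewrite invr_gt0.
  by exists w.
have [u uP] := boolp.choice ex.
have small (e : R) : 0 < e -> exists N : nat, forall n, (N <= n)%N -> (n.+1%:R)^-1 < e.
  move=> e0; have [N hN] : exists N : nat, e^-1 < N.+1%:R.
    exists (Num.bound e^-1); apply: lt_trans (archi_boundP _) _; first by rewrite invr_ge0 ltW.
    by rewrite ltr_nat.
  exists N => n Nn; rewrite -[e]invrK ltf_pV2 ?posrE ?invr_gt0 //.
  by apply: lt_le_trans hN _; rewrite ler_nat.
have phD x y : W x -> W y -> phi (x + y) = phi x + phi y.
  by move=> Wx Wy; rewrite -[x in LHS]scale1r phL // mul1r.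
have ph0 : phi 0 = 0 by have := phL (-1) 0 0 W0 W0; rewrite scaler0 addr0 mulN1r addNr.
have phZ a x : W x -> phi (a *: x) = a * phi x.
  by move=> Wx; rewrite -[_ *: _]addr0 phL // ph0 addr0.
have WD x y : W x -> W y -> W (x + y) by move=> Wx Wy; rewrite -[x]scale1r; exact: WL.
have WZ a x : W x -> W (a *: x) by move=> Wx; rewrite -[_ *: _]addr0; exact: WL.
(* The midpoint of two almost minimisers does not go below the infimum, and the parallelogram law
   turns this into a Cauchy estimate. *)
have [m um] : exists m, cvgH u m.
  apply: completeH => e e0.
  have e2 : 0 < e ^+ 2 / 4 by rewrite divr_gt0 // exprn_gt0.
  have [N hN] := small _ e2; exists N => i j Ni Nj.
  have [Wi qi] := uP i; have [Wj qj] := uP j.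
  have lt1 : q (u i) < I + e ^+ 2 / 4 by apply: lt_trans qi _; rewrite ltrD2l hN.
  have lt2 : q (u j) < I + e ^+ 2 / 4 by apply: lt_trans qj _; rewrite ltrD2l hN.
  have := Ile (((2^-1)%:C)%C *: (u i + u j)) (WZ _ _ (WD _ _ Wi Wj)).
  rewrite {1}/q nsqZ phZ; last exact: WD.
  rewrite phD // Re_real_cM ReD cmod_real ger0_norm ?invr_ge0 // => h3.
  have n0 := nr_ge0 (u i - u j).
  rewrite -(ltr_pXn2r (n := 2)) ?nnegrE ?(ltW e0) // nr_sq parallelogram.
  move: lt1 lt2 h3; rewrite /q.
  have -> : (2^-1 : R) ^+ 2 = 4^-1 by field.
  lra.
(* Adding [l *: w] to an almost minimiser cannot bring [q] below its infimum. In the limit this is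
   the quadratic inequality of [discriminant_le] with A = 0, so the defect phi w - <w, m>
   vanishes. *)
have key w : W w -> phi w = ip w m.
  move=> Ww; apply/eqP; rewrite eq_sym -subr_eq0 -cmod_eq0 -sqrf_eq0.
  rewrite eq_le sqr_ge0 andbT -(mul0r (nsq w)).
  rewrite -cmod_conj -cmodN.
  apply: discriminant_le => //; first exact: nsq_ge0.
  move=> l.
  apply/ler_addgt0Pr => e e0.
  have e2 : 0 < e / 2 by rewrite divr_gt0.
  have [N1 hN1] := small _ e2.
  have C0 : 0 < 4 * (cmod l * nr w + 1) by rewrite mulr_gt0 // ltr_wpDl // mulr_ge0 ?cmod_ge0 ?nr_ge0.
  have e4 : 0 < e / (4 * (cmod l * nr w + 1)) by rewrite divr_gt0.
  have [N2 hN2] := um _ e4.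
  pose n := maxn N1 N2.
  have [Wn qn] := uP n.
  have := Ile (l *: w + u n) (WL _ _ _ Ww Wn).
  rewrite /q phL // [l *: w + _]addrC nsqD nsqZ => h.
  have h1 := hN1 n (leq_maxl _ _); have h2 := hN2 n (leq_maxr _ _).
  have h3 : cmod (ip (u n - m) (l *: w)) <= e / 4.
    apply: le_trans (ip_CS_nr _ _) _; rewrite nrZ.
    move: h2; rewrite ltr_pdivlMr // => h2.
    have := nr_ge0 (u n - m); have : 0 <= cmod l * nr w by rewrite mulr_ge0 ?cmod_ge0 ?nr_ge0.
    nra.
  have h4 : Re (ip (u n) (l *: w)) <= Re (ip m (l *: w)) + e / 4.
    have : Re (ip (u n - m) (l *: w)) <= e / 4.
      by apply: le_trans (ler_norm _) _; apply: le_trans (Re_le_cmod _) h3.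
    by rewrite ipBl ReB; lra.
  move: qn h h4; rewrite /q !ipZr (ip_conj m w) ReD.
  have E (b c : R[i]) : Re (conjc l * - conjc (conjc c - b)) = Re (l * b) - Re (conjc l * c).
    exact: Re_conj_expand.
  rewrite E; move: h1.
  move: (Re (phi (u n))) (Re (l * phi w)) (Re (conjc l * ip m w)) (Re (conjc l * ip (u n) w)) => a1 b1 c1 d1.
  move: (cmod l ^+ 2 * nsq w) (nsq (u n)) (n.+1%:R^-1) => X Y Z.
  clear; lra.
exists m; split=> //.
- have n0 := nr_ge0 m.
  have h : nr m ^+ 2 <= s * nr m.
    apply/ler_addgt0Pr => e e0.
    have p0 : 0 < s + nr m + 1 by lra.
    have e1 : 0 < e / (s + nr m + 1) by rewrite divr_gt0.
    have [N /(_ N (leqnn N))] := um _ e1; rewrite ltr_pdivlMr // => hN.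
    have [WN _] := uP N.
    rewrite nr_sq /nsq -[X in ip X m](subrK (u N)) ipDl ReD.
    have h1 : Re (ip (u N) m) <= s * nr (u N).
      by rewrite -key //; apply: le_trans (ler_norm _) _; apply: le_trans (Re_le_cmod _) (phB _ WN).
    have h2 : Re (ip (m - u N) m) <= nr (u N - m) * nr m.
      by rewrite nrB; apply: le_trans (ler_norm _) _; apply: le_trans (Re_le_cmod _) (ip_CS_nr _ _).
    have h3 : nr (u N) <= nr (u N - m) + nr m by have := nrD (u N - m) m; rewrite subrK.
    have h4 := nr_ge0 (u N - m).
    have h5 : s * nr (u N) <= s * (nr (u N - m) + nr m) by apply: ler_wpM2l.
    by move: hN h1 h2 h5 h4; clear; move: (nr (u N - m)) (nr m) => p t; nra.
  have [->//|m0] := eqVneq (nr m) 0.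
  by move: h; rewrite expr2 ler_pM2r // lt_def m0.
- by exists u; split=> // n; have [] := uP n.
Qed.

Definition closedH (W : H -> Prop) := forall x, closureH W x -> W x.

Lemma projection (W : H -> Prop) : is_subspace W -> closedH W -> forall x,
  exists m, W m /\ forall w, W w -> ip (x - m) w = 0.
Proof.
move=> sW cW x.
have [|a y z Wy Wz|y Wy|m [h _ /cW Wm]] := @riesz W (fun w => ip w x) (nr x) sW.
- exact: nr_ge0.
- exact: ip_linear.
- by rewrite mulrC; exact: ip_CS_nr.
exists m; split=> // w Ww; rewrite ip_conj ipBr h // subrr; exact: conjc0.
Qed.

Definition lin (B : H -> H) := forall a x y, B (a *: x + y) = a *: B x + B y.
Definition bnd (B : H -> H) (b : R) := 0 <= b /\ forall x, nr (B x) <= b * nr x.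
Definition selfadj (B : H -> H) := forall x y, ip (B x) y = ip x (B y).

Section LinearMaps.
Variables (B : H -> H) (lB : lin B).
Lemma lin0 : B 0 = 0.
Proof. by have := lB (-1) 0 0; rewrite scaler0 addr0 scaleN1r addNr. Qed.
Lemma linD x y : B (x + y) = B x + B y.
Proof. by have := lB 1 x y; rewrite !scale1r. Qed.
Lemma linZ a x : B (a *: x) = a *: B x.
Proof. by have := lB a x 0; rewrite !addr0 lin0 addr0. Qed.
Lemma linN x : B (- x) = - B x.
Proof. by rewrite -scaleN1r linZ scaleN1r. Qed.
Lemma linB x y : B (x - y) = B x - B y.
Proof. by rewrite linD linN. Qed.
End LinearMaps.

Lemma adjoint_exists (B : H -> H) (b : R) : lin B -> bnd B b ->
  exists B', [/\ lin B', bnd B' b & forall x y, ip (B x) y = ip x (B' y)].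
Proof.
move=> lB [b0 bB].
have ex y : exists m, (forall x, ip (B x) y = ip x m) /\ nr m <= b * nr y.
  have [|||x _|m [h h2 _]] := @riesz (fun=> True) (fun x => ip (B x) y) (b * nr y).
  - by [].
  - by rewrite mulr_ge0 ?nr_ge0.
  - by move=> a x z _ _; rewrite lB ip_linear.
  - apply: le_trans (ip_CS_nr _ _) _; rewrite mulrAC; apply: ler_wpM2r; [exact: nr_ge0|exact: bB].
  - by exists m; split=> // x; exact: h.
have [B' hB'] := boolp.choice ex.
exists B'; split; [|by split=> // y; have [] := hB' y|by move=> x y; have [] := hB' y].
move=> a x y; apply: ip_injl => z; apply: (can_inj (@conjcK R)); rewrite -!ip_conj.
have h w : ip z (B' w) = ip (B z) w by have [->] := hB' w.
by rewrite h !ipDr !ipZr !h.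
Qed.

End HilbertBasics.
(** * Polar decomposition *)

Section SquareRoot.
Variables (R : realType) (H : hilbert R).
Implicit Types (x y z w m : H) (a b : R[i]) (u v : nat -> H) (B C : H -> H).
Local Notation Re := (@complex.Re R).
Local Notation half := (((2^-1 : R)%:C)%C : R[i]).

Lemma nr_le_add y z : nr z <= nr y + nr (y - z).
Proof. by have := nrD y (z - y); rewrite addrC subrK nrB. Qed.

Lemma lin_id : lin (id : H -> H). Proof. by []. Qed.
Lemma lin_sub B C : lin B -> lin C -> lin (fun x => B x - C x).
Proof. by move=> lB lC a x y; rewrite lB lC scalerBr opprD addrACA. Qed.

Definition commute B C := forall x, B (C x) = C (B x).

Lemma nr_half x : nr (half *: x) = 2^-1 * nr x.
Proof. by rewrite nrZ cmod_real ger0_norm. Qed.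

Lemma selfadj_conj B x y : selfadj B -> ip (B y) x = conjc (ip (B x) y).
Proof. by move=> sB; rewrite sB -ip_conj. Qed.

(** Cauchy-Schwarz for the semidefinite form <B x, y> at y = B x gives |B x|^4 <= <B x, x> <B B x, B
    x> <= |x|^2 |B x|^2. *)
Lemma psd_contraction B : lin B -> selfadj B -> (forall x, 0 <= Re (ip (B x) x) <= nsq x) ->
  forall x, nr (B x) <= nr x.
Proof.
move=> lB sB B01 x.
have CS := @psd_CS R H (fun x y => ip (B x) y) _ _ _ x (B x).
have {CS} : cmod (ip (B x) (B x)) ^+ 2 <= Re (ip (B x) x) * Re (ip (B (B x)) (B x)).
  apply: CS; first by move=> a y z t; rewrite lB ip_linear.
  - by move=> y z; exact: selfadj_conj.
  - by move=> y; have /andP[] := B01 y.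
rewrite ip_self cmod_real ger0_norm ?nsq_ge0 // => h.
have /andP[p1 p2] := B01 x; have /andP[p3 p4] := B01 (B x).
apply: le_nr; first exact: nr_ge0.
rewrite nr_sq; have n1 := nsq_ge0 (B x).
have [->|n0] := eqVneq (nsq (B x)) 0; first exact: nsq_ge0.
have np : 0 < nsq (B x) by rewrite lt_def n0.
rewrite -(ler_pM2r np) -expr2; apply: le_trans h _.
by apply: ler_pM.
Qed.

Lemma cvgH_unique u x y : cvgH u x -> cvgH u y -> x = y.
Proof.
move=> ux uy; apply/eqP; rewrite -subr_eq0; apply/eqP/nr_le0 => e e0.
have e2 : 0 < e / 2 by rewrite divr_gt0.
have [N1 h1] := ux _ e2; have [N2 h2] := uy _ e2.
have := h1 (maxn N1 N2) (leq_maxl _ _); have := h2 (maxn N1 N2) (leq_maxr _ _).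
by have := nr_triangle (u (maxn N1 N2)) x y; rewrite (nrB x (u _)); lra.
Qed.

Section Iteration.
Variables (B : H -> H) (lB : lin B) (sB : selfadj B) (B1 : forall x, nr (B x) <= nr x).

(* Visser's iteration: the limit Y satisfies 2 Y = B + Y^2, so that 1 - Y is a
   square root of 1 - B; [sqy] is its scalar majorant. *)
Fixpoint sqY n x : H := if n is n'.+1 then half *: (B x + sqY n' (sqY n' x)) else 0.
Fixpoint sqy n : R := if n is n'.+1 then 2^-1 * (1 + sqy n' ^+ 2) else 0.

Lemma sqY_lin n : lin (sqY n).
Proof.
elim: n => [|n IH] a x y /=; first by rewrite scaler0 addr0.
rewrite lB IH IH !scalerDr !scalerA [half * a]mulrC -!addrA; congr (_ + _).
by rewrite addrCA.
Qed.

Lemma sqY_selfadj n : selfadj (sqY n).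
Proof.
elim: n => [|n IH] x y /=; first by rewrite ip0l ip0r.
by rewrite ipZl ipZr !ipDl !ipDr sB !IH conjc_real.
Qed.

Lemma sqY_commute n C : lin C -> commute B C -> commute (sqY n) C.
Proof.
move=> lC BC; elim: n => [|n IH] x /=; first by rewrite lin0.
by rewrite BC !IH (linZ lC) (linD lC).
Qed.

Lemma sqy_ge0 n : 0 <= sqy n.
Proof. by case: n => [|n] //=; rewrite mulr_ge0 ?invr_ge0 // addr_ge0 // sqr_ge0. Qed.

Lemma sqy_le1 n : sqy n <= 1.
Proof.
elim: n => [|n IH] //=; have := sqy_ge0 n => h.
have : sqy n ^+ 2 <= 1 by rewrite exprn_ile1.
lra.
Qed.

Lemma sqy_mono n : sqy n <= sqy n.+1.
Proof. by rewrite /=; have := sqr_ge0 (sqy n - 1); rewrite sqrrB1; lra. Qed.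

Lemma sqY_bound n x : nr (sqY n x) <= sqy n * nr x.
Proof.
elim: n x => [|n IH] x /=; first by rewrite nr0 mul0r.
rewrite nr_half -mulrA; apply: ler_wpM2l; first by rewrite invr_ge0.
apply: le_trans (nrD _ _) _; rewrite mulrDl mul1r; apply: lerD; first exact: B1.
apply: le_trans (IH _) _; rewrite expr2 -mulrA; apply: ler_wpM2l; [exact: sqy_ge0|exact: IH].
Qed.

Lemma sqY_commute2 i j : commute (sqY i) (sqY j).
Proof.
apply: sqY_commute; first exact: sqY_lin.
by move=> x; rewrite (@sqY_commute j B lB).
Qed.

(** The iterates commute, so Y_{n+1}^2 - Y_n^2 factors as (Y_{n+1} + Y_n)(Y_{n+1} - Y_n). The scalar
    iteration factors in the same way and dominates the operator one step by step. *)
Lemma sqY_step n x : nr (sqY n.+1 x - sqY n x) <= (sqy n.+1 - sqy n) * nr x.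
Proof.
elim: n x => [|n IH] x; first by have := sqY_bound 1 x; rewrite /= !subr0.
have -> : sqY n.+2 x - sqY n.+1 x =
    half *: (sqY n.+1 (sqY n.+1 x - sqY n x) + sqY n (sqY n.+1 x - sqY n x)).
  rewrite -[sqY n.+2 x]/(half *: (B x + sqY n.+1 (sqY n.+1 x))) -[X in _ - X]/(half *: (B x + sqY n (sqY n x))).
  rewrite -scalerBr (linB (sqY_lin n.+1)) (linB (sqY_lin n)).
  rewrite (sqY_commute2 n n.+1) opprD addrACA subrr add0r; congr (_ *: _).
  by rewrite addrA subrK.
rewrite nr_half.
have -> : sqy n.+2 - sqy n.+1 = 2^-1 * ((sqy n.+1 + sqy n) * (sqy n.+1 - sqy n)).
  by rewrite -[sqy n.+2]/(2^-1 * (1 + sqy n.+1 ^+ 2)) -[X in _ - X]/(2^-1 * (1 + sqy n ^+ 2)); ring.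
rewrite -mulrA; apply: ler_wpM2l; first by rewrite invr_ge0.
apply: le_trans (nrD _ _) _; rewrite -mulrA mulrDl; apply: lerD.
  by apply: le_trans (sqY_bound _ _) _; apply: ler_wpM2l; [exact: sqy_ge0|exact: IH].
by apply: le_trans (sqY_bound _ _) _; apply: ler_wpM2l; [exact: sqy_ge0|exact: IH].
Qed.

Lemma sqY_tail n k x : nr (sqY (n + k) x - sqY n x) <= (sqy (n + k) - sqy n) * nr x.
Proof.
elim: k => [|k IH]; first by rewrite addn0 !subrr nr0 mul0r.
rewrite addnS; apply: le_trans (nr_triangle (sqY (n + k) x) _ _) _.
have -> : sqy (n + k).+1 - sqy n = (sqy (n + k).+1 - sqy (n + k)) + (sqy (n + k) - sqy n) by ring.
by rewrite mulrDl; apply: lerD => //; exact: sqY_step.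
Qed.

(** The scalar majorant increases and stays below 1. Through [sqY_tail] its convergence gives that
    of the operator iterates, at a rate proportional to the norm of the argument. *)
Lemma sqy_tail (e : R) : 0 < e -> exists N, forall k, sqy (N + k) - sqy N < e.
Proof.
move=> e0; have hs : has_sup [set sqy n | n in setT].
  by split; [exists (sqy 0), 0%N|exists 1 => _ [n _ <-]; exact: sqy_le1].
have [_ [N _ <-] hN] := sup_adherent e0 hs.
exists N => k; have : sqy (N + k) <= sup [set sqy n | n in setT].
  by apply: ub_le_sup; [case: hs|exists (N + k)%N].
lra.
Qed.

Lemma sqY_unif (e : R) : 0 < e -> exists N, forall n, (N <= n)%N -> forall k x, nr (sqY (n + k) x - sqY n x) <= e * nr x.
Proof.
move=> /sqy_tail[N hN]; exists N => n Nn k x.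
apply: le_trans (sqY_tail _ _ _) _; apply: ler_wpM2r; first exact: nr_ge0.
have := hN (n - N + k)%N; rewrite addnA subnKC //.
have : sqy N <= sqy n.
  rewrite -(subnKC Nn); elim: (n - N)%N => [|j IH]; first by rewrite addn0.
  by rewrite addnS; apply: le_trans IH (sqy_mono _).
lra.
Qed.

Lemma sqY_limit : exists Y : H -> H, forall e : R, 0 < e -> exists N, forall n, (N <= n)%N -> forall x, nr (sqY n x - Y x) <= e * nr x.
Proof.
have ex x : exists l, cvgH (fun n => sqY n x) l.
  apply: completeH => e e0.
  have p0 : 0 < nr x + 1 by rewrite ltr_wpDl ?nr_ge0.
  have e1 : 0 < e / (2 * (nr x + 1)) by rewrite divr_gt0 // mulr_gt0.
  have [N hN] := sqY_unif e1; exists N => i j Ni Nj.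
  have h1 := hN N (leqnn N) (i - N)%N x; have h2 := hN N (leqnn N) (j - N)%N x.
  rewrite !subnKC // in h1 h2.
  apply: le_lt_trans (nr_triangle (sqY N x) _ _) _.
  rewrite [X in _ + X]nrB.
  have : e / (2 * (nr x + 1)) * nr x < e / 2.
    rewrite mulrAC ltr_pdivrMr ?mulr_gt0 // mulrA divfK // ltr_pM2l // ltrDl //.
  lra.
have [Y hY] := boolp.choice ex; exists Y => e e0.
have [N hN] := sqY_unif e0; exists N => n Nn x.
apply/ler_addgt0Pr => d d0; have [M hM] := hY x d d0.
apply: le_trans (nr_triangle (sqY (n + M) x) _ _) _; apply: lerD.
  by rewrite nrB; exact: hN.
by apply: ltW; apply: hM; exact: leq_addl.
Qed.

(** The last clause, inherited from the iterates, is what makes [T], its absolute value and the root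
    of the latter commute in the polar decomposition. *)
Lemma sqrt_iteration : exists Y : H -> H, [/\ lin Y, selfadj Y, forall x, nr (Y x) <= nr x,
  forall x, Y x = half *: (B x + Y (Y x)) & forall C c, lin C -> bnd C c -> commute B C -> commute Y C].
Proof.
have [Y hY] := sqY_limit.
have cY x : cvgH (fun n => sqY n x) (Y x).
  move=> e e0; have p0 : 0 < nr x + 1 by rewrite ltr_wpDl ?nr_ge0.
  have e1 : 0 < e / (nr x + 1) by rewrite divr_gt0.
  have [N hN] := hY _ e1; exists N => n Nn; apply: le_lt_trans (hN n Nn x) _.
  by rewrite mulrAC ltr_pdivrMr // ltr_pM2l // ltrDl.
have Y1 x : nr (Y x) <= nr x.
  apply: (cvgH_le (f := @nr R H) ler01 (cY x)).
    by move=> y z; rewrite mul1r; exact: nr_le_add.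
  move=> n; apply: le_trans (sqY_bound n x) _; rewrite -[leRHS]mul1r.
  by apply: ler_wpM2r; [exact: nr_ge0|exact: sqy_le1].
have lY : lin Y.
  move=> a x y; apply: (cvgH_unique (cY _)) => e e0.
  have p0 : 0 < 2 * (cmod a + 1) by rewrite mulr_gt0 // ltr_wpDl // cmod_ge0.
  have e1 : 0 < e / (2 * (cmod a + 1)) by rewrite divr_gt0.
  have e2 : 0 < e / 2 by rewrite divr_gt0.
  have [N1 h1] := cY x _ e1; have [N2 h2] := cY y _ e2.
  exists (maxn N1 N2) => n; rewrite geq_max => /andP[/h1 k1 /h2 k2].
  rewrite sqY_lin opprD addrACA -scalerBr; apply: le_lt_trans (nrD _ _) _; rewrite nrZ.
  move: k1; rewrite ltr_pdivlMr // => k1; have := cmod_ge0 a; have := nr_ge0 (sqY n x - Y x); nra.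
have sY : selfadj Y.
  move=> x y; apply/eqP; rewrite -subr_eq0 -cmod_eq0 eq_le cmod_ge0 andbT.
  apply/ler_addgt0Pr => e e0; rewrite add0r.
  have p0 : 0 < nr x * nr y + nr x * nr y + 1 by rewrite ltr_wpDl // addr_ge0 // mulr_ge0 ?nr_ge0.
  have e1 : 0 < e / (nr x * nr y + nr x * nr y + 1) by rewrite divr_gt0.
  have [N hN] := hY _ e1.
  have -> : ip (Y x) y - ip x (Y y) = ip x (sqY N y - Y y) - ip (sqY N x - Y x) y.
    by rewrite ipBr ipBl sqY_selfadj; ring.
  apply: le_trans (cmodD _ _) _; rewrite cmodN.
  have h1 := hN N (leqnn N) x; have h2 := hN N (leqnn N) y.
  have k1 := ip_CS_nr x (sqY N y - Y y); have k2 := ip_CS_nr (sqY N x - Y x) y.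
  have k3 : nr x * nr (sqY N y - Y y) <= nr x * (e / (nr x * nr y + nr x * nr y + 1) * nr y).
    by apply: ler_wpM2l => //; exact: nr_ge0.
  have k4 : nr (sqY N x - Y x) * nr y <= e / (nr x * nr y + nr x * nr y + 1) * nr x * nr y.
    by apply: ler_wpM2r => //; exact: nr_ge0.
  have : (e / (nr x * nr y + nr x * nr y + 1)) * (nr x * nr y + nr x * nr y + 1) = e by rewrite divfK ?gt_eqF.
  move: k1 k2 k3 k4 (ltW e1); move: (e / _) => E; clear; nra.
exists Y; split=> //.
- move=> x; apply: (cvgH_unique (u := fun n => sqY n.+1 x)).
    move=> e /(cY x e)[N hN]; exists N => n Nn; apply: hN; exact: leqW.
  move=> e e0; have p0 : 0 < nr x + 1 by rewrite ltr_wpDl ?nr_ge0.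
  have e1 : 0 < e / (nr x + 1) by rewrite divr_gt0.
  have [N hN] := hY _ e1; exists N => n Nn.
  rewrite /= -scalerBr opprD addrACA subrr add0r nr_half.
  have t := nr_triangle (sqY n (Y x)) (sqY n (sqY n x)) (Y (Y x)).
  rewrite -(linB (sqY_lin n)) in t.
  have h1 := hN n Nn x; have h2 := hN n Nn (Y x).
  have h3 : nr (sqY n (sqY n x - Y x)) <= nr (sqY n x - Y x).
    apply: le_trans (sqY_bound n _) _; rewrite -[leRHS]mul1r.
    by apply: ler_wpM2r; [exact: nr_ge0|exact: sqy_le1].
  have h4 : e / (nr x + 1) * nr (Y x) <= e / (nr x + 1) * nr x by rewrite ler_pM2l.
  have h5 : e / (nr x + 1) * (nr x + 1) = e by rewrite divfK ?gt_eqF.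
  have h6 : e / (nr x + 1) * nr x < e by rewrite -[ltRHS]h5 ltr_pM2l // ltrDl.
  lra.
- move=> C c lC [c0 bC] BC x; apply: (cvgH_unique (cY _)) => e e0.
  have p0 : 0 < c + 1 by rewrite ltr_wpDl.
  have e1 : 0 < e / (c + 1) by rewrite divr_gt0.
  have [N hN] := cY x _ e1; exists N => n /hN; rewrite ltr_pdivlMr // => k.
  rewrite sqY_commute // -linB //; apply: le_lt_trans (bC _) _.
  have := nr_ge0 (sqY n x - Y x); nra.
Qed.

End Iteration.

(** With B = 1 - A and 2 Y = B + Y^2, the operator 1 - Y squares to A. Positivity and the upper
    bound, with 2 in place of 1, are both read off |Y x| <= |x|. *)
Lemma sqrt_exists (A : H -> H) : lin A -> selfadj A -> (forall x, 0 <= Re (ip (A x) x) <= nsq x) ->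
  exists S, [/\ lin S, selfadj S, forall x, 0 <= Re (ip (S x) x) <= 2 * nsq x, forall x, S (S x) = A x &
    forall C c, lin C -> bnd C c -> commute A C -> commute S C].
Proof.
move=> lA sA A01; pose B x := x - A x.
have lB : lin B by move=> a x y; rewrite /B lA scalerBr opprD addrACA.
have sB : selfadj B by move=> x y; rewrite /B ipBl ipBr sA.
have B01 x : 0 <= Re (ip (B x) x) <= nsq x.
  by rewrite /B ipBl ReB -/(nsq x); have /andP[] := A01 x; lra.
have B1 := psd_contraction lB sB B01.
have [Y [lY sY Y1 fY cY]] := sqrt_iteration lB sB B1.
have Yb x : `|Re (ip (Y x) x)| <= nsq x.
  apply: le_trans (Re_le_cmod _) _; apply: le_trans (ip_CS_nr _ _) _.
  by rewrite -nr_sq expr2; apply: ler_wpM2r; [exact: nr_ge0|exact: Y1].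
exists (fun x => x - Y x); split.
- by move=> a x y; rewrite lY scalerBr opprD addrACA.
- by move=> x y; rewrite ipBl ipBr sY.
- move=> x; rewrite ipBl ReB -/(nsq x); have := Yb x; rewrite ler_norml; lra.
- move=> x; rewrite linB //.
  have h : Y x + Y x = B x + Y (Y x).
    rewrite {1 2}fY -scalerDl -real_cD (_ : 2^-1 + 2^-1 = 1); last by field.
    by rewrite scale1r.
  have -> : x - Y x - (Y x - Y (Y x)) = x + Y (Y x) - (Y x + Y x).
    by rewrite opprB addrA [x - Y x + _]addrAC opprD addrA.
  by rewrite h opprD addrA addrAC addrK /B opprB addrC subrK.
- move=> C c lC bC AC x; rewrite (linB lC); congr (_ - _).
  by apply: (cY C c) => // y; rewrite /B (linB lC) AC.
Qed.

(* J is the sign of T, defined to be the identity on the kernel of |T| - T (which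
   contains the kernel of T) and minus the identity on its orthogonal complement;
   S is the fourth root of T^2. *)
Lemma polar_decomposition (T : H -> H) : lin T -> selfadj T -> (forall x, nr (T x) <= nr x) ->
  exists S J, [/\ lin S /\ selfadj S, exists s, bnd S s, lin J /\ selfadj J, forall x, J (J x) = x &
    (forall x, J (S x) = S (J x)) /\ (forall x, T x = J (S (S x)))].
Proof.
move=> lT sT T1.
have bT : bnd T 1 by split=> // x; rewrite mul1r.
(* [P] is the absolute value of [T], and [S] below is the square root of [P]. *)
have [||x|P [lP sP P2 PP cP]] := @sqrt_exists (fun x => T (T x)).
- by move=> a x y; rewrite !lT.
- by move=> x y; rewrite !sT.
- rewrite sT ip_self /= nsq_ge0 -!nr_sq /=.
  by rewrite lerXn2r ?nnegrE ?nr_ge0.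
have PT : commute P T by apply: (cP T 1) => // x.
have P1 x : nr (P x) <= nr x.
  apply: le_nr; first exact: nr_ge0.
  rewrite nr_sq /nsq sP PP -sT -!/(nsq _) -!nr_sq.
  by rewrite lerXn2r ?nnegrE ?nr_ge0.
have bP : bnd P 1 by split=> // x; rewrite mul1r.
have [//|//|x|S [lS sS S2 SS cS]] := @sqrt_exists P.
  have /andP[-> _] := P2 x; rewrite /=.
  apply: le_trans (ler_norm _) _; apply: le_trans (Re_le_cmod _) _; apply: le_trans (ip_CS_nr _ _) _.
  by rewrite -nr_sq expr2; apply: ler_wpM2r; [exact: nr_ge0|exact: P1].
have ST : commute S T by apply: (cS T 1).
have SP : commute S P by apply: (cS P 1).
have bS : bnd S 1.
  split=> // x; rewrite mul1r; apply: le_nr; first exact: nr_ge0.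
  rewrite nr_sq /nsq sS SS (ip_conj (P x)) Re_conjc.
  apply: le_trans (ler_norm _) _; apply: le_trans (Re_le_cmod _) _; apply: le_trans (ip_CS_nr _ _) _.
  by rewrite -/(nsq x) -nr_sq expr2; apply: ler_wpM2r; [exact: nr_ge0|exact: P1].
pose M x := P x = T x.
have sM : is_subspace M.
  split; first by rewrite /M (lin0 lP) (lin0 lT).
  by move=> a x y Mx My; rewrite /M lP lT Mx My.
have cM : closedH M.
  move=> x [u [Mu ux]]; apply: (cvgH_unique (u := fun n => P (u n))).
    move=> e /ux[N hN]; exists N => n /hN; apply: le_lt_trans.
    by rewrite -(linB lP).
  move=> e /ux[N hN]; exists N => n /hN; apply: le_lt_trans.
  by rewrite Mu -(linB lT).
have [q hq] := boolp.choice (projection sM cM).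
have Mq x : M (q x) by have [] := hq x.
have oq x w : M w -> ip (x - q x) w = 0 by have [_] := hq x; apply.
(* Every vector P y + T y lies in [M], because P and T commute and have the same square. A vector
   orthogonal to [M] is therefore annihilated by P + T. *)
have anti n : (forall w, M w -> ip n w = 0) -> P n = - T n.
  move=> hn; apply/eqP; rewrite -addr_eq0; apply/eqP/ip_eq0 => y.
  rewrite ip_conj ipDl sP sT -ipDr hn ?conjc0 //.
  by rewrite /M (linD lP) (linD lT) PP PT addrC.
have uniq x m n : x = m + n -> M m -> (forall w, M w -> ip n w = 0) -> q x = m.
  move=> -> Mm hn.
  have Md : M (q (m + n) - m) by rewrite -scaleN1r addrC; apply: sM.2.
  apply/eqP; rewrite -subr_eq0; apply/eqP/ip_def.
  have := oq (m + n) _ Md.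
  have -> : m + n - q (m + n) = n - (q (m + n) - m) by rewrite opprB addrA [n + m]addrC.
  by rewrite ipBl (hn _ Md) sub0r => /eqP; rewrite oppr_eq0 => /eqP ->.
pose J x := q x - (x - q x).
have dec x : x = q x + (x - q x) by rewrite addrC subrK.
have lq : lin q.
  move=> a x y; apply: (uniq _ _ (a *: (x - q x) + (y - q y))).
  - by rewrite addrACA -scalerDr [q x + _]addrC subrK [q y + _]addrC subrK.
  - by apply: sM.2.
  - by move=> w Mw; rewrite ip_linear !oq // mulr0 addr0.
have lJ : lin J.
  by apply: lin_sub => //; apply: lin_sub => //; exact: lin_id.
have Jm m : M m -> J m = m.
  by move=> Mm; rewrite /J (uniq m m 0) ?addr0 // ?subrr ?subr0 // => w _; rewrite ip0l.
have Jn n : (forall w, M w -> ip n w = 0) -> J n = - n.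
  by move=> hn; rewrite /J (uniq n 0 n) ?add0r // ?sub0r ?subr0 //; exact: sM.1.
have on x w : M w -> ip (x - q x) w = 0 by exact: oq.
have J2 x y : ip (J x) y = ip (q x) (q y) - ip (x - q x) (y - q y).
  have E : ip (q x) (y - q y) = 0 by rewrite ip_conj on ?conjc0.
  by rewrite {1}(dec y) /J ipBl [ip (q x) (_ + _)]ipDr E [ip (x - q x) (_ + _)]ipDr on // addr0 add0r.
have sJ : selfadj J.
  by move=> x y; rewrite J2 (ip_conj (J y)) J2 conjcB -!ip_conj.
have JJ x : J (J x) = x.
  by rewrite -[J x]/(q x - (x - q x)) (linB lJ) Jm // Jn ?opprK -?dec // => w; exact: on.
have MB C c : lin C -> bnd C c -> commute P C -> commute T C -> forall x, M x -> M (C x).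
  by move=> _ _ PC TC x Mx; rewrite /M PC TC Mx.
have nB C : selfadj C -> (forall x, M x -> M (C x)) -> forall x, (forall w, M w -> ip x w = 0) -> forall w, M w -> ip (C x) w = 0.
  by move=> sC MC x hx w Mw; rewrite sC hx //; exact: MC.
have MS x : M x -> M (S x) by apply: (MB S 1) => // y; rewrite ?SP ?ST.
have MP x : M x -> M (P x) by apply: (MB P 1) => // y; rewrite PT.
exists S, J; split.
- by [].
- by exists 1.
- by [].
- exact: JJ.
- split=> x.
    rewrite {1}(dec x) (linD lS) (linD lJ) Jm; last exact: MS.
    rewrite Jn; last by apply: nB => //; exact: on.
    by rewrite -(linB lS).
  rewrite {1}(dec x) (linD lT) SS [in RHS](dec x) (linD lP) (linD lJ) Jm; last exact: MP.
  rewrite (Jn (P _)); last by apply: nB => //; exact: on.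
  by rewrite -(Mq x) (anti (x - q x)) ?opprK //; exact: on.
Qed.
End SquareRoot.

(** * Symmetrizable operators *)

Section Lax.
Variables (R : realType) (H : hilbert R).
Implicit Types (x y : H).

Lemma bernoulli (d : R) n : 0 <= d -> 1 + n%:R * d <= (1 + d) ^+ n.
Proof.
move=> d0; elim: n => [|n IH]; first by rewrite mul0r addr0 expr0.
have d1 : 0 <= 1 + d by lra.
rewrite exprS -natr1; have := ler_wpM2l d1 IH.
have : 0 <= n%:R * d * d by rewrite !mulr_ge0.
nra.
Qed.

(** The sequence grows at least like q^n, and Bernoulli's inequality applied to (q/e)^n contradicts
    any bound K e^n. *)
Lemma ratio_growth (b : nat -> R) (q e K : R) : 0 < e -> e < q -> 0 < b 0%N ->
  (forall n, q * b n <= b n.+1) -> ~ (forall n, b n <= K * e ^+ n).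
Proof.
move=> e0 eq b0 hb hK.
have q0 : 0 < q := lt_trans e0 eq.
have lb n : q ^+ n * b 0%N <= b n.
  elim: n => [|n IH]; first by rewrite expr0 mul1r.
  by apply: le_trans (hb n); rewrite exprS -mulrA; apply: ler_wpM2l => //; exact: ltW.
have d0 : 0 < q / e - 1 by rewrite subr_gt0 ltr_pdivlMr // mul1r.
have bd n : n%:R * ((q / e - 1) * b 0%N) <= K.
  rewrite mulrA; apply: (@le_trans _ _ ((q / e) ^+ n * b 0%N)).
    apply: ler_wpM2r; first exact: ltW.
    by have := bernoulli n (ltW d0); rewrite [1 + (q / e - 1)]addrC subrK; lra.
  rewrite expr_div_n mulrAC ler_pdivrMr ?exprn_gt0 //.
  exact: le_trans (lb n) (hK n).
have p0 : 0 < (q / e - 1) * b 0%N by rewrite mulr_gt0.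
have K0 : 0 <= K by have := bd 0%N; rewrite mul0r.
have := archi_boundP (divr_ge0 K0 (ltW p0)); rewrite ltr_pdivrMr // ltNge.
by rewrite bd.
Qed.

Variables (S : H -> H) (lS : lin S) (sS : selfadj S).
Local Notation Re := (@complex.Re R).

(* By symmetry the sequence [nr (S (E^n x))] is log-convex; if its first ratio
   exceeded e, it would grow faster than e^n. *)
Lemma lax (E : H -> H) (e : R) : lin E -> bnd E e ->
  (forall x y, ip (S (E x)) (S y) = ip (S x) (S (E y))) -> forall s, bnd S s ->
  forall x, nr (S (E x)) <= e * nr (S x).
Proof.
move=> lE [e0 bE] symE s [s0 bS] x.
pose b n := nr (S (iter n E x)).
have conv n : b n.+1 ^+ 2 <= b n * b n.+2.
  rewrite nr_sq /nsq symE; apply: le_trans (ler_norm _) _.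
  by apply: le_trans (Re_le_cmod _) _; exact: ip_CS_nr.
have bb n : b n <= s * (e ^+ n * nr x).
  apply: le_trans (bS _) _; apply: ler_wpM2l => //.
  elim: n => [|n IH]; first by rewrite expr0 mul1r.
  by apply: le_trans (bE _) _; rewrite exprS -mulrA; apply: ler_wpM2l.
have b_ge0 n : 0 <= b n by exact: nr_ge0.
rewrite leNgt; apply/negP => lt.
have {lt} lt : e * b 0%N < b 1%N by [].
have b0 : 0 < b 0%N.
  rewrite lt_def b_ge0 andbT; apply/eqP => bz.
  by have := conv 0%N; move: lt; rewrite bz mulr0 mul0r => p1; rewrite leNgt exprn_gt0.
pose q := b 1%N / b 0%N.
have grow n : 0 < b n /\ q * b n <= b n.+1.
  elim: n => [|n [p h]]; first by split=> //; rewrite /q divfK // gt_eqF.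
  have q0 : 0 < q by rewrite /q divr_gt0 //; apply: le_lt_trans lt; rewrite mulr_ge0.
  have p' : 0 < b n.+1 by apply: lt_le_trans h; rewrite mulr_gt0.
  split=> //; rewrite -(ler_pM2l p); apply: le_trans (conv n).
  by rewrite mulrCA mulrA expr2; apply: ler_wpM2r => //; exact: ltW.
have eq : e < q by rewrite /q ltr_pdivlMr.
(* A value strictly between e and q is positive even when e = 0, as [ratio_growth] requires. *)
pose e' := (e + q) / 2.
have e'0 : 0 < e' by rewrite /e'; lra.
apply: (@ratio_growth b q e' (s * nr x) e'0 _ b0 (fun n => (grow n).2)); first by rewrite /e'; lra.
move=> n; apply: le_trans (bb n) _; rewrite mulrCA mulrC; apply: ler_wpM2l; first by rewrite mulr_ge0 ?nr_ge0.
by apply: lerXn2r; rewrite ?nnegrE ?(ltW e'0) // /e'; lra.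
Qed.

(** The operator C' C is symmetric for the form <S x, S y>, so [lax] bounds it in the seminorm |S
    x|; then |S C x|^2 = <S x, S C' C x> <= c' c |S x|^2. *)
Lemma krein_lax (C C' : H -> H) (c c' s : R) : lin C -> lin C' -> bnd C c -> bnd C' c' -> bnd S s ->
  (forall x y, ip (S (C x)) (S y) = ip (S x) (S (C' y))) ->
  exists2 k : R, 0 <= k & forall x, nr (S (C x)) <= k * nr (S x).
Proof.
move=> lC lC' [c0 bC] [c'0 bC'] bS sCC.
have sCC' x y : ip (S (C' x)) (S y) = ip (S x) (S (C y)).
  by rewrite ip_conj -sCC -ip_conj.
have lE : lin (fun x => C' (C x)) by move=> a x y; rewrite lC lC'.
have bE : bnd (fun x => C' (C x)) (c' * c).
  split; first exact: mulr_ge0.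
  by move=> x; apply: le_trans (bC' _) _; rewrite -mulrA; apply: ler_wpM2l.
have h := lax lE bE _ bS.
exists (Num.sqrt (c' * c)); first exact: sqrtr_ge0.
move=> x; apply: le_nr; first by rewrite mulr_ge0 ?sqrtr_ge0 ?nr_ge0.
rewrite exprMn sqr_sqrtr ?mulr_ge0 // /nsq sCC.
apply: le_trans (ler_norm _) _; apply: le_trans (Re_le_cmod _) _; apply: le_trans (ip_CS_nr _ _) _.
rewrite mulrC expr2 mulrA; apply: ler_wpM2r; first exact: nr_ge0.
by apply: h => y z; rewrite sCC' sCC.
Qed.

Lemma closure_orth (W : H -> Prop) (m y : H) : closureH W m -> (forall w, W w -> ip w y = 0) -> ip m y = 0.
Proof.
move=> [u [Wu um]] h; apply/eqP; rewrite -cmod_eq0 eq_le cmod_ge0 andbT.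
apply/ler_addgt0Pr => e e0; rewrite add0r.
have p0 : 0 < nr y + 1 by rewrite ltr_wpDl ?nr_ge0.
have e1 : 0 < e / (nr y + 1) by rewrite divr_gt0.
have [N /(_ N (leqnn N))] := um _ e1; rewrite ltr_pdivlMr // => hN.
have -> : ip m y = ip (m - u N) y by rewrite ipBl (h _ (Wu N)) subr0.
apply: le_trans (ip_CS_nr _ _) _; rewrite nrB.
have := nr_ge0 (u N - m); nra.
Qed.

(* Douglas' lemma: the estimate of [krein_lax] factors [S] out of the adjoint of [C]. *)
Lemma douglas (C D : H -> H) (k : R) : lin C -> 0 <= k -> (forall x, nr (S (C x)) <= k * nr (S x)) ->
  (forall x y, ip (D x) y = ip x (C y)) -> forall x, exists m, [/\ D (S x) = S m, nr m <= k * nr x &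
    forall y, S y = 0 -> ip m y = 0].
Proof.
move=> lC k0 hC DC x.
pose W w := exists y, w = S y.
have [g hg] : exists g : H -> H, forall w, W w -> w = S (g w).
  have /boolp.choice[g hg] : forall w, exists y, W w -> w = S y.
    by move=> w; case: (EM (W w)) => [[y ->]|h]; [exists y|exists 0].
  by exists g => w /hg.
have W_sub : is_subspace W.
  split; first by exists 0; rewrite (lin0 lS).
  by move=> a _ _ [y ->] [z ->]; exists (a *: y + z); rewrite lS.
(* By the estimate S C y depends on S y alone, so the functional S y |-> <S C y, x> is well defined
   on the range of [S] and bounded by k |x|. *)
have SC y z : S y = S z -> S (C y) = S (C z).
  move=> yz; apply/eqP; rewrite -subr_eq0 -(linB lS) -(linB lC) -nr_eq0 eq_le nr_ge0 andbT.
  by apply: le_trans (hC _) _; rewrite (linB lS) yz subrr nr0 mulr0.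
have SCg y : S (C (g (S y))) = S (C y) by apply: SC; rewrite -hg //; exists y.
have [|a _ _ [y ->] [z ->]|_ [y ->]|m [hm nm clm]] := @riesz R H W (fun w => ip (S (C (g w))) x) (k * nr x) W_sub.
- by rewrite mulr_ge0 ?nr_ge0.
- by rewrite -lS !SCg lC lS ip_linear.
- rewrite SCg; apply: le_trans (ip_CS_nr _ _) _; rewrite mulrAC.
  by apply: ler_wpM2r; [exact: nr_ge0|exact: hC].
exists m; split=> //.
  apply: ip_injl => y; rewrite DC sS [RHS]ip_conj ip_conj; congr conjc.
  have Wy : W (S y) by exists y.
  by rewrite -(SCg y) hm // -sS.
by move=> y Sy; apply: closure_orth clm _ => _ [z ->]; rewrite sS Sy ip0r.
Qed.
End Lax.

(** * Subspaces as types, and closed subspaces of a Hilbert space *)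

Section Subspaces.
Variables (R : realType) (V : lmodType R[i]) (S : set V).

Definition subspace_pred (hS : is_subspace S) : {pred V} := fun x => `[< S x >].

Lemma subspace_predP hS x : reflect (S x) (x \in subspace_pred hS).
Proof. by rewrite unfold_in; exact: asboolP. Qed.

Fact subspace_pred_closed hS : submod_closed (subspace_pred hS).
Proof.
split; first by apply/subspace_predP; exact: hS.1.
by move=> a x y /subspace_predP Sx /subspace_predP Sy; apply/subspace_predP; exact: hS.2.
Qed.

HB.instance Definition _ hS := GRing.isSubmodClosed.Build R[i] V (subspace_pred hS) (subspace_pred_closed hS).

Record subspace_type (hS : is_subspace S) := SubspaceType { subval : V; _ : subval \in subspace_pred hS }.
HB.instance Definition _ hS := [isSub for @subval hS].
HB.instance Definition _ hS := [Choice of subspace_type hS by <:].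
HB.instance Definition _ hS := [SubChoice_isSubLmodule of subspace_type hS by <:].

Lemma subvalP hS (x : subspace_type hS) : S (subval x).
Proof. by apply/(subspace_predP hS); exact: (valP x). Qed.

Definition subof hS (x : V) (Sx : S x) : subspace_type hS := SubspaceType (introT (subspace_predP hS x) Sx).

Lemma subval_inj hS : injective (@subval hS). Proof. exact: val_inj. Qed.
End Subspaces.

Section ClosedSubspace.
Variables (R : realType) (H : hilbert R) (S : set H) (hS : is_subspace S) (cS : closedH S).
Local Notation M := (subspace_type hS).

Fact sub_ip_complete (u : nat -> M) :
    (forall e : R, 0 < e -> exists N, forall m n, (N <= m)%N -> (N <= n)%N ->
       Num.sqrt (complex.Re (ip (subval (u m - u n)) (subval (u m - u n)))) < e) ->
    exists l : M, forall e : R, 0 < e -> exists N, forall n, (N <= n)%N ->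
       Num.sqrt (complex.Re (ip (subval (u n - l)) (subval (u n - l)))) < e.
Proof.
move=> cu; have [l ul] := completeH (u := fun n => subval (u n)) cu.
have Sl : S l by apply: cS; exists (fun n => subval (u n)); split=> // n; exact: subvalP.
by exists (subof hS Sl).
Qed.

Definition sub_hilbert : hilbert R := @Hilbert R M (fun x y => ip (subval x) (subval y))
  (fun a x y z => ip_linear a (subval x) (subval y) (subval z))
  (fun x y => ip_conj (subval x) (subval y))
  (fun x => ip_ge0 (subval x))
  (fun x hx => @subval_inj R H S hS x 0 (ip_def hx))
  sub_ip_complete.
End ClosedSubspace.
(** * Krein spaces from a symmetry of a Hilbert space *)

Section CoordinateKrein.
Variables (R : realType) (M : hilbert R) (V : lmodType R[i]).
Variables (J : M -> M) (E : M -> V).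
Hypotheses (lJ : lin J) (sJ : selfadj J) (JJ : forall x, J (J x) = x).
Hypotheses (lE : forall a x y, E (a *: x + y) = a *: E x + E y) (injE : forall x, E x = 0 -> x = 0).
Implicit Types (x y : M) (g h : V).

Lemma E0 : E 0 = 0.
Proof. by have := lE (-1) 0 0; rewrite scaler0 addr0 scaleN1r addNr. Qed.
Lemma ED x y : E (x + y) = E x + E y.
Proof. by have := lE 1 x y; rewrite !scale1r. Qed.
Lemma EZ a x : E (a *: x) = a *: E x.
Proof. by have := lE a x 0; rewrite !addr0 E0 addr0. Qed.
Lemma EB x y : E (x - y) = E x - E y.
Proof. by rewrite ED -scaleN1r EZ scaleN1r. Qed.
Lemma E_inj : injective E.
Proof. by move=> x y xy; apply/eqP; rewrite -subr_eq0; apply/eqP/injE; rewrite EB xy subrr. Qed.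

Definition coord g : M := xget 0 [set x | E x = g].

Lemma coordK x : coord (E x) = x.
Proof. by apply: E_inj; rewrite /coord; case: xgetP => [y _ /= h|/(_ x) []]. Qed.

Definition crange : set V := [set g | exists x, g = E x].
(** The form of a [kreinSpace] is a total function on [V]; off [crange] the coordinate takes the
    default value 0. *)
Definition cform g h : R[i] := ip (J (coord g)) (coord h).

Lemma cformE x y : cform (E x) (E y) = ip (J x) y.
Proof. by rewrite /cform !coordK. Qed.

Lemma crange_subspace : is_subspace crange.
Proof.
split; first by exists 0; rewrite E0.
by move=> a _ _ [x ->] [y ->]; exists (a *: x + y); rewrite lE.
Qed.

Lemma cform_hermitian : hermitian_on crange cform.
Proof.
split=> [a _ _ _ [x ->] [y ->] [z ->]|_ _ [x ->] [y ->]].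
  by rewrite -lE !cformE lJ ip_linear.
by rewrite !cformE sJ ip_conj.
Qed.

Lemma form_norm_nr (form : V -> V -> R[i]) g x : form g g = ip x x -> form_norm form g = ((nr x)%:C)%C.
Proof.
move=> h; rewrite /form_norm h ip_self -nr_sq.
rewrite (_ : ((nr x ^+ 2)%:C)%C = ((nr x)%:C)%C ^+ 2); last by rewrite expr2 real_cM -expr2.
by rewrite sqrCK // lecR nr_ge0.
Qed.

(** [E] is isometric on [W], so completeness of the image comes from closedness of [W]. The form is
    a parameter because the negative part of a Krein space uses the negated form. *)
Lemma is_hilbert_image (W : set M) (form : V -> V -> R[i]) : is_subspace W -> closedH W ->
  (forall x y, W x -> W y -> form (E x) (E y) = ip x y) ->
  is_hilbert [set g | exists2 x, W x & g = E x] form.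
Proof.
move=> [W0 WL] cW fE.
have WB x y : W x -> W y -> W (x - y).
  by move=> Wx Wy; rewrite -scaleN1r addrC; exact: WL.
split.
- split; first by exists 0; rewrite ?E0.
  by move=> a _ _ [x Wx ->] [y Wy ->]; exists (a *: x + y); rewrite ?lE //; exact: WL.
- split=> [a _ _ _ [x Wx ->] [y Wy ->] [z Wz ->]|_ _ [x Wx ->] [y Wy ->]].
    by rewrite -lE !fE ?ip_linear //; exact: WL.
  by rewrite (fE y x) // (fE x y) //; exact: ip_conj.
- move=> _ [x Wx ->] Ex; rewrite fE // ip_self.
  have x0 : x != 0 by apply: contraNneq Ex => ->; rewrite E0.
  by rewrite ltcR -nr_sq exprn_gt0 // lt_def nr_ge0 nr_eq0 x0.
- move=> u Wu cu.
  have [x hx] : exists x : nat -> M, forall n, W (x n) /\ u n = E (x n).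
    have /boolp.choice[x hx] : forall n, exists y, W y /\ u n = E y by move=> n; have [y Wy ->] := Wu n; exists y.
    by exists x.
  have Wx n := (hx n).1; have ux n := (hx n).2.
  have fn i j : form_norm form (u i - u j) = ((nr (x i - x j))%:C)%C.
    by rewrite !ux -EB; apply: form_norm_nr; rewrite fE //; exact: WB.
  have [l xl] : exists l, cvgH x l.
    apply: completeH => e e0.
    have [N hN] := near2_oo_nat (cu ((e%:C)%C) (eq_ind_r is_true e0 (ltcR 0 e))).
    by exists N => i j Ni Nj; have := hN i j Ni Nj; rewrite fn ltcR.
  have Wl : W l by apply: cW; exists x.
  exists (E l); first by exists l.
  apply/cvg_cnear => e e0; apply/near_oo_nat.
  have [N hN] := xl e e0; exists N => n /hN h.
  rewrite subr0 ux -EB (form_norm_nr (x := x n - l)); last by rewrite fE //; exact: WB.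
  by rewrite cmod_real ger0_norm // nr_ge0.
Qed.

(** The eigenspaces of [J]. Since [J] is a self-adjoint involution, those of 1 and -1 are orthogonal
    and together span [M]; they give the fundamental decomposition. *)
Definition Wpm (s : R[i]) : set M := [set x | J x = s *: x].

Lemma Wpm_subspace s : is_subspace (Wpm s).
Proof.
split; first by rewrite /Wpm /= (lin0 lJ) scaler0.
by move=> a x y; rewrite /Wpm /= lJ => -> ->; rewrite scalerDr !scalerA mulrC.
Qed.

Lemma nrJ x : nr (J x) = nr x.
Proof. by rewrite /nr /nsq sJ JJ. Qed.

Lemma Wpm_closed s : closedH (Wpm s).
Proof.
move=> x [u [Wu ux]]; apply: (cvgH_unique (u := fun n => J (u n))).
  by move=> e /ux[N hN]; exists N => n /hN; apply: le_lt_trans; rewrite -(linB lJ) nrJ.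
move=> e e0; have p0 : 0 < cmod s + 1 by rewrite ltr_wpDl ?cmod_ge0.
have e1 : 0 < e / (cmod s + 1) by rewrite divr_gt0.
have [N hN] := ux _ e1; exists N => n /hN; rewrite ltr_pdivlMr // => h.
rewrite (Wu n) -scalerBr nrZ; have := nr_ge0 (u n - x); have := cmod_ge0 s; nra.
Qed.

Definition Kp : set V := [set g | exists2 x, Wpm 1 x & g = E x].
Definition Km : set V := [set g | exists2 x, Wpm (-1) x & g = E x].

Definition half : R[i] := ((2^-1)%:C)%C.
Definition Jp x : M := half *: (x + J x).
Definition Jm x : M := half *: (x - J x).

Lemma half2 (x : M) : half *: (x + x) = x.
Proof.
rewrite -mulr2n -scaler_nat scalerA /half.
have -> : ((2^-1 : R)%:C)%C * 2%:R = 1 :> R[i].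
  by rewrite -[2%:R]/(1 + 1) mulrDr mulr1 -real_cD (_ : 2^-1 + 2^-1 = 1) //; field.
by rewrite scale1r.
Qed.

Lemma Jpm x : x = Jp x + Jm x.
Proof. by rewrite /Jp /Jm -scalerDr addrACA subrr addr0 half2. Qed.
Lemma Jp_in x : Wpm 1 (Jp x).
Proof. by rewrite /Wpm /= /Jp (linZ lJ) (linD lJ) JJ scale1r addrC. Qed.
Lemma Jm_in x : Wpm (-1) (Jm x).
Proof. by rewrite /Wpm /= /Jm (linZ lJ) (linB lJ) JJ scaleN1r -scalerN opprB. Qed.

Lemma Wpm_orth x y : Wpm 1 x -> Wpm (-1) y -> ip x y = 0.
Proof.
rewrite /Wpm /= scale1r scaleN1r => Jx Jy; have := sJ x y.
rewrite Jx Jy ipNr => /eqP; rewrite -addr_eq0 -mulr2n mulrn_eq0 /=.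
by move=> /eqP.
Qed.

Lemma Wpm_cap x : Wpm 1 x -> Wpm (-1) x -> x = 0.
Proof. by move=> h1 h2; apply: ip_def; rewrite Wpm_orth. Qed.

Lemma cdecomposition : fundamental_decomposition crange cform Kp Km.
Proof.
split.
- by split=> [_ [x _ ->]|_ [x _ ->]]; exists x.
- move=> _ [x ->]; exists (E (Jp x)), (E (Jm x)); split.
  + by exists (Jp x) => //; exact: Jp_in.
  + by exists (Jm x) => //; exact: Jm_in.
  + by rewrite -ED -Jpm.
- split.
    apply/seteqP; split=> [g [[x Wx ->] [y Wy /E_inj xy]]|_ ->].
      by rewrite -xy in Wy; rewrite (Wpm_cap Wx Wy) E0.
    by split; exists 0; rewrite ?E0 //; exact: (Wpm_subspace _).1.
  by move=> _ _ [x Wx ->] [y Wy ->]; rewrite cformE sJ Wy scaleN1r ipNr Wpm_orth ?oppr0.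
- apply: is_hilbert_image; [exact: Wpm_subspace|exact: Wpm_closed|].
  by move=> x y Wx _; rewrite cformE Wx scale1r.
- apply: is_hilbert_image; [exact: Wpm_subspace|exact: Wpm_closed|].
  by move=> x y Wx _; rewrite cformE Wx scaleN1r ipNl opprK.
Qed.

Definition cKrein : kreinSpace V := @KreinSpace _ V crange cform crange_subspace cform_hermitian
  (ex_intro _ Kp (ex_intro _ Km cdecomposition)).

(** For the decomposition into eigenspaces the Krein norm pulls back to the Hilbert norm of [M]: the
    form changes sign exactly on the eigenspace of -1. Boundedness on [M] thus transfers to the
    Krein space. *)
Lemma cknorm x : knorm cKrein Kp Km (E x) = ((nr x)%:C)%C.
Proof.
have -> : knorm cKrein Kp Km (E x) = sqrtC (cform (E (Jp x)) (E (Jp x)) - cform (E (Jm x)) (E (Jm x))).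
  rewrite /knorm; set p := xget _ _.
  have -> : p = E (Jp x).
    rewrite /p; case: xgetP => [y _ [[z Wz ->] [t Wt e]]|].
      congr E; have {}e : x = z + t by apply: E_inj; rewrite ED -e addrC subrK.
      rewrite e /Jp (linD lJ) Wz Wt scale1r scaleN1r addrACA subrr addr0.
      by rewrite half2.
    move=> /(_ (E (Jp x)))[]; split; first by exists (Jp x) => //; exact: Jp_in.
    by exists (Jm x); [exact: Jm_in|rewrite -EB {1}(Jpm x) addrC addKr].
  by rewrite /= -EB {3 5}(Jpm x) [Jp x + _]addrC addrK.
rewrite !cformE (Jp_in x) (Jm_in x) scale1r scaleN1r ipNl opprK.
have -> : ip (Jp x) (Jp x) + ip (Jm x) (Jm x) = ip x x.
  rewrite {5 6}(Jpm x) ipDl !ipDr (Wpm_orth (Jp_in x) (Jm_in x)).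
  by rewrite (ip_conj (Jp x) (Jm x)) (Wpm_orth (Jp_in x) (Jm_in x)) conjc0 addr0 add0r.
by have := @form_norm_nr (fun _ _ => ip x x) 0 x erefl.
Qed.

Lemma cbounded (T : V -> V) (D : M -> M) d : lin D -> bnd D d -> (forall x, T (E x) = E (D x)) ->
  bounded_operator cKrein T.
Proof.
move=> lD [d0 bD] TE; split.
- by move=> _ [x ->]; exists (D x); rewrite TE.
- by move=> a _ _ [x ->] [y ->]; rewrite -lE !TE lD lE.
exists Kp, Km; split; first exact: cdecomposition.
exists ((d%:C)%C) => _ [x ->]; rewrite TE !cknorm -real_cM lecR; exact: bD.
Qed.

End CoordinateKrein.
(** * A Hilbert space of holomorphic functions *)

Section ComplexLimits.
Variable R : realType.
Implicit Types (u v : nat -> R[i]) (l k : R[i]).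

Definition clim u l := forall e : R, 0 < e -> exists N, forall n, (N <= n)%N -> cmod (u n - l) < e.

Lemma clim_unique u l k : clim u l -> clim u k -> l = k.
Proof.
move=> ul uk; apply/eqP; rewrite -subr_eq0 -cmod_eq0 eq_le cmod_ge0 andbT.
apply/ler_addgt0Pr => e e0; rewrite add0r.
have e2 : 0 < e / 2 by rewrite divr_gt0.
have [N1 h1] := ul _ e2; have [N2 h2] := uk _ e2.
have := h1 (maxn N1 N2) (leq_maxl _ _); have := h2 (maxn N1 N2) (leq_maxr _ _).
by have := cmod_triangle (u (maxn N1 N2)) l k; rewrite (cmodB l (u _)); lra.
Qed.

Lemma climD u v l k : clim u l -> clim v k -> clim (fun n => u n + v n) (l + k).
Proof.
move=> ul vk e e0; have e2 : 0 < e / 2 by rewrite divr_gt0.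
have [N1 h1] := ul _ e2; have [N2 h2] := vk _ e2.
exists (maxn N1 N2) => n; rewrite geq_max => /andP[/h1 k1 /h2 k2].
by rewrite opprD addrACA; apply: le_lt_trans (cmodD _ _) _; lra.
Qed.

Lemma climZ a u l : clim u l -> clim (fun n => a * u n) (a * l).
Proof.
move=> ul e e0; have p0 : 0 < cmod a + 1 by rewrite ltr_wpDl ?cmod_ge0.
have e1 : 0 < e / (cmod a + 1) by rewrite divr_gt0.
have [N hN] := ul _ e1; exists N => n /hN; rewrite ltr_pdivlMr // => h.
by rewrite -mulrBr cmodM; have := cmod_ge0 (u n - l); have := cmod_ge0 a; nra.
Qed.

Lemma clim_conj u l : clim u l -> clim (fun n => conjc (u n)) (conjc l).
Proof. by move=> ul e /ul[N hN]; exists N => n /hN; rewrite -conjcB cmod_conj. Qed.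

Lemma monotone_tail (s : nat -> R) (B : R) : (forall n, s n <= s n.+1) -> (forall n, s n <= B) ->
  forall e : R, 0 < e -> exists N, forall n, (N <= n)%N -> s n - s N < e.
Proof.
move=> mono bd e e0.
have hs : has_sup [set s n | n in setT].
  by split; [exists (s 0%N), 0%N|exists B => _ [n _ <-]].
have [_ [N _ <-] hN] := sup_adherent e0 hs.
exists N => n Nn; have : s n <= sup [set s n | n in setT].
  by apply: ub_le_sup; [case: hs|exists n].
lra.
Qed.

Lemma clim_ge (u : nat -> R[i]) l (c : R) : clim u l -> (exists N, forall n, (N <= n)%N -> complex.Re (u n) >= c) ->
  c <= complex.Re l.
Proof.
move=> ul [N hN]; apply/ler_addgt0Pr => e e0; have [N' hN'] := ul _ e0.
have h1 := hN (maxn N N') (leq_maxl _ _); have h2 := hN' (maxn N N') (leq_maxr _ _).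
have := le_lt_trans (Re_le_cmod _) h2; rewrite ReB ltr_norml; lra.
Qed.

Lemma clim_le (u : nat -> R[i]) l (c : R) : clim u l -> (exists N, forall n, (N <= n)%N -> complex.Re (u n) <= c) ->
  complex.Re l <= c.
Proof.
move=> ul [N hN]; apply/ler_addgt0Pr => e e0; have [N' hN'] := ul _ e0.
have h1 := hN (maxn N N') (leq_maxl _ _); have h2 := hN' (maxn N N') (leq_maxr _ _).
have := le_lt_trans (Re_le_cmod _) h2; rewrite ReB ltr_norml; lra.
Qed.

Lemma real_cauchy (u : nat -> R) : (forall e : R, 0 < e -> exists N, forall m n, (N <= m)%N -> (N <= n)%N -> `|u m - u n| < e) ->
  exists l : R, forall e : R, 0 < e -> exists N, forall n, (N <= n)%N -> `|u n - l| < e.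
Proof.
move=> cu.
have : cvg (u n @[n --> \oo]).
  apply/cauchy_cvgP/cauchy_exP => e e0; have [N hN] := cu _ e0.
  exists (u N); exists N => // n /= Nn; rewrite /ball /=; exact: hN.
move=> /cvg_ex[l /cvgrPdist_lt ul]; exists l => e /ul[N _ hN]; exists N => n Nn.
by rewrite distrC; exact: hN.
Qed.

Lemma clim_cauchy u : (forall e : R, 0 < e -> exists N, forall m n, (N <= m)%N -> (N <= n)%N -> cmod (u m - u n) < e) ->
  exists l, clim u l.
Proof.
move=> cu.
have [a ha] : exists l : R, forall e : R, 0 < e -> exists N, forall n, (N <= n)%N -> `|complex.Re (u n) - l| < e.
  apply: real_cauchy => e /cu[N hN]; exists N => m n Nm Nn.
  by rewrite -ReB; apply: le_lt_trans (Re_le_cmod _) _; exact: hN.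
have [b hb] : exists l : R, forall e : R, 0 < e -> exists N, forall n, (N <= n)%N -> `|complex.Im (u n) - l| < e.
  apply: real_cauchy => e /cu[N hN]; exists N => m n Nm Nn.
  by rewrite -ImB; apply: le_lt_trans (Im_le_cmod _) _; exact: hN.
exists (Complex a b) => e e0; have e2 : 0 < e / 2 by rewrite divr_gt0.
have [N1 h1] := ha _ e2; have [N2 h2] := hb _ e2.
exists (maxn N1 N2) => n; rewrite geq_max => /andP[/h1 k1 /h2 k2].
by apply: le_lt_trans (cmod_le_ReIm _) _; rewrite ReB ImB /=; lra.
Qed.

Lemma clim_dominated u (s : nat -> R) (B : R) : (forall n, s n <= s n.+1) -> (forall n, s n <= B) ->
  (forall n, cmod (u n.+1 - u n) <= s n.+1 - s n) -> exists l, clim u l.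
Proof.
move=> mono bd dom; apply: clim_cauchy => e e0.
have e2 : 0 < e / 2 by rewrite divr_gt0.
have [N hN] := monotone_tail mono bd e2.
have tail n : (N <= n)%N -> cmod (u n - u N) <= s n - s N.
  move=> /subnKC <-; elim: (n - N)%N => [|k IH]; first by rewrite addn0 !subrr cmod0.
  rewrite addnS; apply: le_trans (cmod_triangle (u (N + k)%N) _ _) _.
  by have := dom (N + k)%N; lra.
exists N => m n Nm Nn; apply: le_lt_trans (cmod_triangle (u N) _ _) _.
by rewrite (cmodB (u N)); have := tail m Nm; have := tail n Nn; have := hN m Nm; have := hN n Nn; lra.
Qed.

End ComplexLimits.

(** * Weights dominating a double sequence *)

Section Weights.
Variable R : realType.

(** S j dominates all m i k with i, k <= j, so in a product of two weights the one with the larger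
    index absorbs [m j k] while the other keeps its power of 2. The summand 1 in S j keeps each
    weight below its power of 2. *)
Lemma weights_exist (m : nat -> nat -> R) : (forall j k, 0 <= m j k) ->
  exists rho : nat -> R, [/\ forall j, 0 < rho j, forall j, rho j <= 2^-1 ^+ j.+1 &
    forall j k, rho j * rho k * m j k <= 2^-1 ^+ j.+1 * 2^-1 ^+ k.+1].
Proof.
move=> m0.
pose S j : R := 1 + \sum_(i < j.+1) \sum_(k < j.+1) m i k.
have S1 j : 1 <= S j by rewrite lerDl; apply: sumr_ge0 => i _; apply: sumr_ge0 => k _.
have Sm j i k : (i <= j)%N -> (k <= j)%N -> m i k <= S j.
  move=> ij kj; apply: (@le_trans _ _ (\sum_(i < j.+1) \sum_(k < j.+1) m i k)); last by rewrite lerDr.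
  have ij' : (i < j.+1)%N by []. have kj' : (k < j.+1)%N by [].
  rewrite (bigD1 (Ordinal ij')) //= (bigD1 (Ordinal kj')) //= -addrA lerDl.
  by rewrite addr_ge0 //; apply: sumr_ge0 => // p _; apply: sumr_ge0.
have p2 j : (0 : R) < 2^-1 ^+ j.+1 by rewrite exprn_gt0 // invr_gt0.
exists (fun j => 2^-1 ^+ j.+1 / S j).
have Sp j : 0 < S j by exact: lt_le_trans (S1 j).
have r1 j : 2^-1 ^+ j.+1 / S j <= 2^-1 ^+ j.+1 by rewrite ler_pdivrMr // ler_peMr // ltW.
split=> [j|j|j k]; [by rewrite divr_gt0|exact: r1|].
have [kj|jk] := leqP k j.
  rewrite mulrAC; apply: ler_pM => //.
  - by rewrite mulr_ge0 // divr_ge0 // ltW.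
  - by rewrite divr_ge0 // ltW.
  - by rewrite mulrAC ler_pdivrMr // ler_pM2l // Sm.
rewrite -mulrA; apply: ler_pM => //.
- by rewrite divr_ge0 // ltW.
- by rewrite mulr_ge0 // divr_ge0 // ltW.
- by rewrite mulrAC ler_pdivrMr // ler_pM2l // Sm // ltnW.
Qed.

Lemma geometric_sum N : \sum_(j < N) (2^-1 : R) ^+ j.+1 <= 1.
Proof.
suff -> : \sum_(j < N) (2^-1 : R) ^+ j.+1 = 1 - 2^-1 ^+ N.
  by rewrite lerBlDr lerDl exprn_ge0 // invr_ge0.
elim: N => [|N IH]; first by rewrite big_ord0 expr0 subrr.
by rewrite big_ord_recr IH /= exprS; field.
Qed.
End Weights.
Section SquareFamily.
Variable R : realType.
Implicit Types (z w : R[i]).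
Local Notation Re := (@complex.Re R).
Local Notation Im := (@complex.Im R).

(* A countable family of squares with rational centres and half-sides 1/(n+1);
   it contains arbitrarily small squares around every point. *)
Definition sq_code (j : nat) : rat * rat * nat := odflt (0, 0, 0%N) (unpickle j).
Definition cen j : R[i] := Complex (ratr (sq_code j).1.1) (ratr (sq_code j).1.2).
Definition rad j : R := ((sq_code j).2.+1%:R)^-1.

Lemma rad_gt0 j : 0 < rad j. Proof. by rewrite invr_gt0. Qed.
Lemma rad_le1 j : rad j <= 1.
Proof. by rewrite invf_le1 // ler1n. Qed.

Lemma inv_succ_lt (e : R) : 0 < e -> exists n : nat, (n.+1%:R)^-1 < e.
Proof.
move=> e0; exists (Num.bound e^-1); rewrite invf_plt ?posrE //.
by apply: lt_trans (archi_boundP _) _; [rewrite invr_ge0 ltW|rewrite ltr_nat].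
Qed.

Lemma rat_near (x e : R) : 0 < e -> exists p : rat, `|x - ratr p| < e.
Proof.
move=> e0; have h : x - e < x + e by lra.
have [p] := rat_in_itvoo h; rewrite in_itv /= => /andP[h1 h2].
by exists p; rewrite ltr_norml; apply/andP; split; lra.
Qed.

(** The Cauchy estimates need the point within r/2 of the centre: approximating both coordinates to
    within r/4 secures this, and r < d/4 keeps the square inside the given ball. *)
Lemma sq_cover (O : set R[i]) z : cnear z O ->
  exists j, (forall w, insq (cen j) (rad j) w -> O w) /\ cmod (z - cen j) < rad j / 2.
Proof.
move=> [d d0 hd]; have d4 : 0 < d / 4 by rewrite divr_gt0.
have [n] := inv_succ_lt d4; have : (0 : R) < (n.+1%:R)^-1 by rewrite invr_gt0.
move er : ((n.+1%:R)^-1 : R) => r rp hn.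
have r0 : 0 < r / 4 by rewrite divr_gt0.
have [p hp] := rat_near (Re z) r0; have [q hq] := rat_near (Im z) r0.
have e : sq_code (pickle (p, q, n)) = (p, q, n) by rewrite /sq_code pickleK.
exists (pickle (p, q, n)); rewrite /cen /rad e /= er.
have zc : cmod (z - Complex (ratr p) (ratr q)) < r / 2.
  by apply: le_lt_trans (cmod_le_ReIm _) _; rewrite ReB ImB; move: hp hq; rewrite /=; lra.
split=> // w /insq_cmod wc; apply: hd.
have := cmod_triangle (Complex (ratr p) (ratr q)) w z; rewrite (cmodB (Complex _ _) z).
lra.
Qed.
End SquareFamily.

Section FunctionSpace.
Variables (R : realType) (O : set R[i]) (oO : copen O).
Variables (rho : nat -> R) (rho0 : forall j, 0 < rho j) (rho1 : forall j, rho j <= 2^-1 ^+ j.+1).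
Implicit Types (F G : R[i] -> R[i]) (z w u : R[i]).
Local Notation Re := (@complex.Re R).
Local Notation Im := (@complex.Im R).

Definition sqvalid j : bool := `[< forall w, insq (cen R j) (rad R j) w -> O w >].

(** Squares that leave [O] contribute 0, so that one enumeration of squares serves every open
    set. *)
Definition sqip j F G : R[i] := if sqvalid j then
  bdip (Re (cen R j) - rad R j) (Re (cen R j) + rad R j) (Im (cen R j) - rad R j) (Im (cen R j) + rad R j) F G else 0.
Definition sqnorm j F : R := Re (sqip j F F).

Definition wsum N F G : R[i] := \sum_(j < N) ((rho j)%:C)%C * sqip j F G.
Definition wnorm N F : R := \sum_(j < N) rho j * sqnorm j F.

(** Vanishing off [O] makes equality of functions the same as equality on [O], in agreement with
    [zero_ext]. *)
Definition supported F := holo O F /\ forall z, ~ O z -> F z = 0.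
(* The square-summability condition defines a Hilbert space of holomorphic functions
   because the Cauchy formula bounds the values inside a square by the L^2 norm on its
   boundary. *)
Definition inH F := supported F /\ exists B, forall N, wnorm N F <= B.

Lemma sq_le' j (x : R) : x - rad R j <= x + rad R j.
Proof. by apply: sq_le; apply: ltW; exact: rad_gt0. Qed.

Lemma valid_in j w : sqvalid j -> insq (cen R j) (rad R j) w -> O w.
Proof. by move=> /asboolP h; exact: h. Qed.

Lemma holo_sqcont j F : sqvalid j -> holo O F ->
  bdcont (Re (cen R j) - rad R j) (Re (cen R j) + rad R j) (Im (cen R j) - rad R j) (Im (cen R j) + rad R j) F.
Proof. by move=> vj hF; apply: cdiff_bdcont => s /(valid_in vj); exact: hF. Qed.

Lemma sqip_lin j a F G h : holo O F -> holo O G -> holo O h ->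
  sqip j (fun z => a * F z + G z) h = a * sqip j F h + sqip j G h.
Proof.
rewrite /sqip; case: ifP => [vj hF hG hh|_ _ _ _]; last by rewrite mulr0 addr0.
by apply: bdip_lin; [exact: sq_le'|exact: sq_le'|exact: holo_sqcont..].
Qed.

Lemma sqip_conj j F G : holo O F -> holo O G -> sqip j G F = conjc (sqip j F G).
Proof.
rewrite /sqip; case: ifP => [vj hF hG|_ _ _]; last by rewrite conjc0.
by apply: bdip_conj; [exact: sq_le'|exact: sq_le'|exact: holo_sqcont..].
Qed.

Lemma sqip_self j F : holo O F -> sqip j F F = ((sqnorm j F)%:C)%C.
Proof.
rewrite /sqnorm /sqip; case: ifP => [vj hF|_ _] //.
by apply: bdip_self; [exact: sq_le'|exact: sq_le'|exact: holo_sqcont].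
Qed.

Lemma sqnorm_ge0 j F : holo O F -> 0 <= sqnorm j F.
Proof.
rewrite /sqnorm /sqip; case: ifP => [vj hF|_ _] //.
by apply: bdn_ge0; [exact: sq_le'|exact: sq_le'|exact: holo_sqcont].
Qed.

Lemma sqip_CS j F G : holo O F -> holo O G -> cmod (sqip j F G) ^+ 2 <= sqnorm j F * sqnorm j G.
Proof.
rewrite /sqnorm /sqip; case: ifP => [vj hF hG|_ _ _]; last by rewrite cmod0 expr0n mul0r.
by apply: bdip_CS; [exact: sq_le'|exact: sq_le'|exact: holo_sqcont..].
Qed.

Lemma sqip_le j F G : holo O F -> holo O G -> cmod (sqip j F G) <= (sqnorm j F + sqnorm j G) / 2.
Proof.
move=> hF hG; have f0 := sqnorm_ge0 j hF; have g0 := sqnorm_ge0 j hG.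
apply: sqr_le_of_le2; first by lra.
apply: le_trans (sqip_CS _ hF hG) _; have := sqr_ge0 (sqnorm j F - sqnorm j G).
by rewrite sqrrB expr_div_n sqrrD; lra.
Qed.

Lemma sqnorm_valid j F : sqvalid j -> sqnorm j F = sqn (cen R j) (rad R j) F.
Proof. by rewrite /sqnorm /sqip => ->. Qed.

Lemma holo_lin a F G : holo O F -> holo O G -> holo O (fun z => a * F z + G z).
Proof. by move=> hF hG z Oz; apply: cdiffD; [apply: cdiffZ; exact: hF|exact: hG]. Qed.

Lemma sqnormN j F : holo O F -> sqnorm j (fun z => - F z) = sqnorm j F.
Proof.
have h0 : holo O (fun=> 0) by move=> z _; exact: cdiff_cst.
move=> hF; rewrite /sqnorm.
have -> : (fun z => - F z) = (fun z => -1 * F z + 0) by apply/funext => z; rewrite mulN1r addr0.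
have hN := holo_lin (-1) hF h0.
have z0 G : holo O G -> sqip j (fun=> 0) G = 0.
  move=> hG; have := sqip_lin j (-1) h0 h0 hG; rewrite mulr0 addr0 => {1}->.
  by rewrite mulN1r addNr.
rewrite sqip_lin // (sqip_conj j hN hF) sqip_lin // !z0 // !addr0 !mulN1r conjcN.
by rewrite -sqip_conj // opprK.
Qed.

(** A pointwise bound is integrated over the boundary, whose length is 8 times a half-side that is
    at most 1; hence the term 8 A. *)
Lemma sqnorm_pointwise j F G (A B : R) : holo O F -> holo O G -> 0 <= A -> 0 <= B ->
  (forall z, O z -> insq (cen R j) (rad R j) z -> cmod (G z) ^+ 2 <= A + B * cmod (F z) ^+ 2) ->
  sqnorm j G <= 8 * A + B * sqnorm j F.
Proof.
move=> hF hG A0 B0 h; rewrite /sqnorm /sqip; case: ifP => [vj|_]; last by rewrite mulr0 addr0 mulr_ge0.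
have cF := holo_sqcont vj hF; have cG := holo_sqcont vj hG.
have c1 := @bdcont_cst R (Re (cen R j) - rad R j) (Re (cen R j) + rad R j) (Im (cen R j) - rad R j) (Im (cen R j) + rad R j) ((A%:C)%C).
have cFF := @bdcontZ R _ _ _ _ ((B%:C)%C) _ (bdcont_sq cF).
apply: (@le_trans _ _ (Re (bdint (Re (cen R j) - rad R j) (Re (cen R j) + rad R j) (Im (cen R j) - rad R j) (Im (cen R j) + rad R j)
    (fun z => ((A%:C)%C) + ((B%:C)%C) * (F z * conjc (F z)))))).
  apply: le_Re_bdint; [exact: sq_le'|exact: sq_le'|exact: bdcont_sq|exact: bdcontD|].
  move=> z /bdsq_insq zi; rewrite Re_mul_conjc ReD Re_real_cM Re_mul_conjc /=.
  by apply: h => //; exact: valid_in vj zi.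
rewrite bdintD // ?sq_le' // bdintZ ?sq_le' //; last exact: bdcont_sq.
rewrite bdint_cst ?sq_le' // bdlen_sq ReD Re_real_cM Re_real_cM /= lerD2r mulrAC.
by rewrite -mulrA; apply: ler_wpM2l => //; rewrite ler_piMr // rad_le1.
Qed.

Lemma wnorm_Re N F : Re (wsum N F F) = wnorm N F.
Proof.
rewrite /wsum /wnorm; elim: N => [|N IH]; first by rewrite !big_ord0.
by rewrite !big_ord_recr /= ReD IH Re_real_cM.
Qed.

Lemma wnormS N F : wnorm N.+1 F = wnorm N F + rho N * sqnorm N F.
Proof. by rewrite /wnorm big_ord_recr. Qed.

Lemma wnorm_mono N F : holo O F -> wnorm N F <= wnorm N.+1 F.
Proof. by move=> hF; rewrite wnormS lerDl mulr_ge0 ?sqnorm_ge0 // ltW. Qed.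

Lemma wsum_lin N a F G h : holo O F -> holo O G -> holo O h ->
  wsum N (fun z => a * F z + G z) h = a * wsum N F h + wsum N G h.
Proof.
move=> hF hG hh; rewrite /wsum mulr_sumr -big_split /=; apply: eq_bigr => j _.
by rewrite sqip_lin //; ring.
Qed.

Lemma wsum_conj N F G : holo O F -> holo O G -> wsum N G F = conjc (wsum N F G).
Proof.
move=> hF hG; rewrite /wsum; elim: N => [|N IH]; first by rewrite !big_ord0 conjc0.
by rewrite !big_ord_recr /= IH conjcD conjcM -sqip_conj // conjc_real.
Qed.

(** This is the parallelogram law on each square, with the nonnegative term for a F - G dropped. *)
Lemma wnorm_lin N a F G : holo O F -> holo O G ->
  wnorm N (fun z => a * F z + G z) <= 2 * cmod a ^+ 2 * wnorm N F + 2 * wnorm N G.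
Proof.
move=> hF hG; rewrite /wnorm !mulr_sumr -big_split /=; apply: ler_sum => j _.
have -> : 2 * cmod a ^+ 2 * (rho j * sqnorm j F) + 2 * (rho j * sqnorm j G) =
  rho j * (2 * (cmod a ^+ 2 * sqnorm j F) + 2 * sqnorm j G) by ring.
rewrite ler_pM2l //.
have h := holo_lin a hF hG; have h' := holo_lin a hF (fun z Oz => cdiffN (hG z Oz)).
have := sqnorm_ge0 j h'; have hN := fun z Oz => cdiffN (hG z Oz).
have e1 : sqip j (fun z => a * F z + G z) (fun z => a * F z + G z) =
   a * conjc a * sqip j F F + a * sqip j F G + conjc a * conjc (sqip j F G) + sqip j G G.
  rewrite sqip_lin // (sqip_conj j h hF) (sqip_conj j h hG) !sqip_lin // !conjcD !conjcM -!sqip_conj //; ring.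
have e2 : sqip j (fun z => a * F z + - G z) (fun z => a * F z + - G z) =
   a * conjc a * sqip j F F - (a * sqip j F G + conjc a * conjc (sqip j F G)) + sqip j G G.
  have e3 k : holo O k -> sqip j (fun z => - G z) k = - sqip j G k.
    move=> hk; have := sqip_lin j (-1) hG (fun z _ => cdiff_cst (0 : R[i]) z) hk.
    have -> : (fun z => -1 * G z + 0) = (fun z => - G z) by apply/funext => z; rewrite mulN1r addr0.
    move=> ->; have := sqip_lin j 0 hk (fun z _ => cdiff_cst (0 : R[i]) z) hk.
    have -> : (fun z => 0 * k z + 0) = (fun=> 0) by apply/funext => z; rewrite mul0r addr0.
    by rewrite mul0r add0r => /esym/eqP; rewrite mulN1r; have -> : sqip j (fun=> 0) k = 0;
      [have := sqip_lin j (-1) (fun z _ => cdiff_cst (0 : R[i]) z) (fun z _ => cdiff_cst (0 : R[i]) z) hk; rewrite mulr0 addr0 mulN1r addNr|rewrite addr0].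
  rewrite sqip_lin // (sqip_conj j h' hF) (e3 _ h') (sqip_conj j h' hG) !sqip_lin // !e3 // !conjcD !conjcM !conjcN -!sqip_conj //; ring.
rewrite /sqnorm e1 e2 mul_conjc !sqip_self //; move: (a * sqip j F G) (conjc a * conjc (sqip j F G)) => [x1 x2] [y1 y2].
by rewrite -real_cM /=; lra.
Qed.

Lemma inH_subspace : is_subspace (inH : set (R[i] -> R[i])).
Proof.
split.
  split; first by split=> // z _; exact: cdiff_cst.
  exists 0 => N; rewrite /wnorm big1 // => j _.
  suff -> : sqnorm j 0 = 0 by rewrite mulr0.
  have := sqip_lin j (-1) (fun z _ => cdiff_cst (0 : R[i]) z) (fun z _ => cdiff_cst (0 : R[i]) z) (fun z _ => cdiff_cst (0 : R[i]) z).
  by rewrite mulr0 addr0 mulN1r addNr /sqnorm => ->.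
move=> a F G [[hF zF] [B hB]] [[hG zG] [B' hB']].
split; first by split; [exact: holo_lin|move=> z nz; rewrite /= /GRing.scale /= /GRing.add /= zF // zG // scaler0 addr0].
exists (2 * cmod a ^+ 2 * B + 2 * B') => N; apply: le_trans (wnorm_lin N a hF hG) _.
by apply: lerD; [apply: ler_wpM2l => //; rewrite mulr_ge0 // sqr_ge0|apply: ler_wpM2l].
Qed.

End FunctionSpace.

(** * Inner product and completeness of the function space *)

Section HardyType.
Variables (R : realType) (O : set R[i]) (oO : copen O).
Variables (rho : nat -> R) (rho0 : forall j, 0 < rho j) (rho1 : forall j, rho j <= 2^-1 ^+ j.+1).
Implicit Types (F G : R[i] -> R[i]) (z w u : R[i]).
Local Notation Re := (@complex.Re R).
Local Notation inH := (inH O rho).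
Local Notation wS := (wsum O rho).
Local Notation wN := (wnorm O rho).
Local Notation wmono := (wnorm_mono rho0).

(** The increments are dominated by those of half the sum of the two squared norms, an increasing
    bounded sequence. *)
Lemma wsum_cvg F G : inH F -> inH G -> exists l, clim (fun N => wS N F G) l.
Proof.
move=> [[hF _] [B hB]] [[hG _] [B' hB']].
apply: (clim_dominated (s := fun N => (wN N F + wN N G) / 2) (B := (B + B') / 2)).
- by move=> n; have := wmono n hF; have := wmono n hG; lra.
- by move=> n; have := hB n; have := hB' n; lra.
- move=> n; rewrite /wsum big_ord_recr /= addrAC subrr add0r cmodM cmod_real ger0_norm ?(ltW (rho0 n)) //.
  have := ler_wpM2l (ltW (rho0 n)) (sqip_le n hF hG); rewrite !wnormS; lra.
Qed.

Definition hip F G : R[i] := xget 0 [set l | clim (fun N => wS N F G) l].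

Lemma hip_clim F G : inH F -> inH G -> clim (fun N => wS N F G) (hip F G).
Proof. by move=> hF hG; rewrite /hip; case: xgetP => [l _ //|h]; have [l /h] := wsum_cvg hF hG. Qed.

Lemma hipE F G l : clim (fun N => wS N F G) l -> inH F -> inH G -> hip F G = l.
Proof. by move=> h hF hG; apply: clim_unique (hip_clim hF hG) h. Qed.

Lemma inH_holo F : inH F -> holo O F. Proof. by case=> [[]]. Qed.

Lemma wnorm_le_hip N F : inH F -> wN N F <= Re (hip F F).
Proof.
move=> hF; apply: (clim_ge (hip_clim hF hF)); exists N => n Nn; rewrite wnorm_Re.
rewrite -(subnKC Nn); elim: (n - N)%N => [|k IH]; first by rewrite addn0.
by rewrite addnS; apply: le_trans IH _; apply: wmono; exact: inH_holo.
Qed.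

Lemma hip_le F (B : R) : inH F -> (forall N, wN N F <= B) -> Re (hip F F) <= B.
Proof. by move=> hF h; apply: (clim_le (hip_clim hF hF)); exists 0%N => n _; rewrite wnorm_Re. Qed.

Lemma hip_ge0 F : inH F -> 0 <= Re (hip F F).
Proof. by move=> hF; have := wnorm_le_hip 0 hF; rewrite /wnorm big_ord0. Qed.

Lemma sqnorm_le_hip j F : inH F -> rho j * sqnorm O j F <= Re (hip F F).
Proof.
move=> hF; apply: le_trans (wnorm_le_hip j.+1 hF); rewrite wnormS lerDr.
by apply: sumr_ge0 => i _; rewrite mulr_ge0 ?sqnorm_ge0 ?(ltW (rho0 _)) //; exact: inH_holo.
Qed.

Lemma hip_linear a F G h : inH F -> inH G -> inH h ->
  hip (a *: F + G) h = a * hip F h + hip G h.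
Proof.
move=> hF hG hh; apply: hipE => //; last exact: (inH_subspace O rho0).2.
have -> : (fun N => wS N (a *: F + G) h) = (fun N => a * wS N F h + wS N G h).
  by apply/funext => N; apply: wsum_lin; exact: inH_holo.
by apply: climD; [apply: climZ|]; exact: hip_clim.
Qed.

Lemma hip_conj F G : inH F -> inH G -> hip G F = conjc (hip F G).
Proof.
move=> hF hG; apply: hipE => //.
have -> : (fun N => wS N G F) = (fun N => conjc (wS N F G)).
  by apply/funext => N; apply: wsum_conj; exact: inH_holo.
by apply: clim_conj; exact: hip_clim.
Qed.

Definition hnorm F : R := Num.sqrt (Re (hip F F)).

Lemma hnorm_sq F : inH F -> hnorm F ^+ 2 = Re (hip F F).
Proof. by move=> hF; rewrite sqr_sqrtr // hip_ge0. Qed.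

Lemma hnorm_ge0 F : 0 <= hnorm F. Proof. exact: sqrtr_ge0. Qed.

(** The bound comes from one weighted square around [z] and is uniform near [z], so convergence in
    norm implies locally uniform convergence. *)
Lemma eval_near z : O z -> exists K, exists2 d : R, 0 < K /\ 0 < d & forall F w, inH F -> cmod (w - z) < d -> cmod (F w) <= K * hnorm F.
Proof.
move=> Oz; have [j [vj zj]] := sq_cover (oO Oz).
have vj' : sqvalid O j by apply/asboolP.
have r0 := rad_gt0 R j.
have K0 : 0 < sqK (rad R j) / rho j.
  rewrite divr_gt0 // /sqK divr_gt0 ?exprn_gt0 ?cmod_gt0 ?kappa_neq0 //.
  by rewrite !mulr_gt0 // invr_gt0.
exists (Num.sqrt (sqK (rad R j) / rho j)), (rad R j / 2 - cmod (z - cen R j)).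
  by rewrite sqrtr_gt0 K0 subr_gt0.
move=> F w hF wz; have wj : cmod (w - cen R j) < rad R j / 2.
  by have := cmod_triangle z w (cen R j); lra.
apply: sqr_le_of_le2; first by rewrite mulr_ge0 ?sqrtr_ge0 ?hnorm_ge0.
have hh : forall s, insq (cen R j) (rad R j) s -> cdiff F s.
  by move=> s /vj; exact: (inH_holo hF).
apply: le_trans (eval_bound r0 wj hh) _.
rewrite exprMn sqr_sqrtr ?(ltW K0) // hnorm_sq // -(sqnorm_valid _ vj').
have rj := rho0 j; have := sqnorm_le_hip j hF; have k0 : 0 <= sqK (rad R j).
  by have := ltW (mulr_gt0 K0 rj); rewrite divfK // gt_eqF.
by move: (sqK _) k0 => k k0; rewrite mulrAC ler_pdivlMr // -mulrA [_ * rho j]mulrC; exact: ler_wpM2l.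
Qed.

Lemma eval_sq c (r : R) : (forall w, insq c r w -> O w) ->
  exists2 K : R, 0 < K & forall w, insq c r w -> forall F, inH F -> cmod (F w) <= K * hnorm F.
Proof.
move=> hO; apply: (insq_bounded (Q := fun K w => forall F, inH F -> cmod (F w) <= K * hnorm F)).
  by move=> M M' z MM h F hF; apply: le_trans (h F hF) _; apply: ler_wpM2r => //; exact: hnorm_ge0.
move=> z /hO Oz; have [K [d [K0 d0] h]] := eval_near Oz.
by exists K, d => // w wz F hF; exact: h.
Qed.

Lemma hip_def F : inH F -> Re (hip F F) = 0 -> F = 0.
Proof.
move=> hF h0; apply/funext => z; case: (EM (O z)) => [Oz|nO]; last by case: hF => [[_ zF] _]; exact: zF.
have [K [d [K0 d0] h]] := eval_near Oz.
have := h F z hF; rewrite subrr cmod0 /hnorm h0 sqrtr0 mulr0 => /(_ d0) hz.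
by apply/eqP; rewrite -cmod_eq0 eq_le hz cmod_ge0.
Qed.

Lemma inHB F G : inH F -> inH G -> inH (F - G).
Proof. by move=> hF hG; rewrite -scaleN1r addrC; apply: (inH_subspace O rho0).2. Qed.

Lemma wnormB_le N F G : holo O F -> holo O G -> wN N (fun z => F z - G z) <= 2 * wN N F + 2 * wN N G.
Proof.
move=> hF hG; have := wnorm_lin rho0 N (-1) hG hF.
rewrite cmodN cmod1 expr1n mulr1 addrC.
by have -> : (fun z => -1 * G z + F z) = (fun z => F z - G z) by apply/funext => z; rewrite mulN1r addrC.
Qed.

(** A Cauchy sequence converges locally uniformly, hence to a holomorphic function, and in mean
    square on each finite set of squares. A Fatou argument passes from finite sums to the full
    norm. *)
Lemma inH_complete (f : nat -> R[i] -> R[i]) : (forall n, inH (f n)) ->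
  (forall e : R, 0 < e -> exists N, forall m n, (N <= m)%N -> (N <= n)%N -> hnorm (f m - f n) < e) ->
  exists2 F, inH F & forall e : R, 0 < e -> exists N, forall n, (N <= n)%N -> hnorm (f n - F) < e.
Proof.
move=> hf cf.
have ex z : exists l, O z -> clim (fun n => f n z) l.
  case: (EM (O z)) => [Oz|nO]; last by exists 0.
  have [K [d [K0 d0] h]] := eval_near Oz.
  have [l hl] : exists l, clim (fun n => f n z) l.
    apply: clim_cauchy => e e0; have e1 : 0 < e / K by rewrite divr_gt0.
    have [N hN] := cf _ e1; exists N => m n Nm Nn.
    have := hN m n Nm Nn; rewrite ltr_pdivlMr // mulrC; apply: le_lt_trans.
    by apply: (h (f m - f n)); [exact: inHB|rewrite subrr cmod0].
  by exists l.
have [g hg] := boolp.choice ex.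
pose F z := if `[< O z >] then g z else 0.
have FO z : O z -> clim (fun n => f n z) (F z).
  by move=> Oz; rewrite /F; case: asboolP => // _; exact: hg.
have Fn z : ~ O z -> F z = 0 by rewrite /F; case: asboolP.
have unif z (K e : R) N : O z -> 0 < K -> (forall G, inH G -> cmod (G z) <= K * hnorm G) ->
    (forall m n, (N <= m)%N -> (N <= n)%N -> hnorm (f m - f n) < e) -> forall n, (N <= n)%N -> cmod (f n z - F z) <= K * e.
  move=> Oz K0 h hN n Nn; apply/ler_addgt0Pr => d d0; have [N' hN'] := FO z Oz d d0.
  apply: le_trans (cmod_triangle (f (maxn N N') z) _ _) _; apply: lerD; last first.
    by apply: ltW; apply: hN'; exact: leq_maxr.
  apply: le_trans (h (f n - f (maxn N N')) (inHB (hf _) (hf _))) _.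
  by apply: ler_wpM2l; [exact: ltW|apply: ltW; apply: hN => //; exact: leq_maxl].
have hF : holo O F.
  apply: holo_limit => // z Oz; have [K [d [K0 d0] h]] := eval_near Oz.
  exists d => // e e0; have e1 : 0 < e / (2 * K) by rewrite divr_gt0 // mulr_gt0.
  have [N hN] := cf _ e1; exists (f N); first exact: inH_holo.
  move=> w wz Ow; rewrite cmodB.
  apply: (@le_lt_trans _ _ (K * (e / (2 * K)))).
    by apply: (unif w K _ N) => // G hG; exact: h.
  rewrite (_ : K * (e / (2 * K)) = e / 2); last by field; rewrite gt_eqF.
  lra.
have hB n : holo O (fun z => f n z - F z).
  by move=> z Oz; apply: cdiffB; [exact: inH_holo (hf n) z Oz|exact: hF].
have sq_small j (d : R) : 0 < d -> exists N, forall n, (N <= n)%N -> sqnorm O j (fun z => f n z - F z) <= d.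
  move=> d0; case: (boolP (sqvalid O j)) => vj; last first.
    by exists 0%N => n _; rewrite /sqnorm /sqip (negbTE vj) ltW.
  have [K K0 hK] := eval_sq (fun w => @valid_in R O j w vj).
  have K8 : 0 < 8 * K ^+ 2 by rewrite mulr_gt0 ?exprn_gt0.
  (* The minimum with 1 makes e^2 <= e, so that it suffices to bound e linearly. *)
  pose e := Num.min 1 (d / (8 * K ^+ 2)); have e0 : 0 < e by rewrite lt_min ltr01 divr_gt0.
  have [N hN] := cf _ e0; exists N => n Nn.
  have -> : d = d + 0 * sqnorm O j (fun=> 0) by rewrite mul0r addr0.
  apply: (@le_trans _ _ (8 * (K * e) ^+ 2 + 0 * sqnorm O j (fun=> 0))); last first.
    rewrite lerD2r exprMn mulrA; apply: (@le_trans _ _ (8 * K ^+ 2 * e)).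
      by apply: ler_wpM2l; [exact: ltW|rewrite expr2 ler_piMl ?ge_min ?lexx // ltW].
    by rewrite mulrC -ler_pdivlMr // ge_min lexx orbT.
  apply: sqnorm_pointwise => //; first by move=> z _; exact: cdiff_cst.
    exact: sqr_ge0.
  move=> z Oz zj; rewrite mul0r addr0 ler_sqr ?nnegrE ?cmod_ge0 ?mulr_ge0 ?(ltW K0) ?(ltW e0) //.
  by apply: (unif z K e N) => // G hG; exact: hK.
have w_small L : forall d : R, 0 < d -> exists N, forall n, (N <= n)%N -> wN L (fun z => f n z - F z) <= d.
  elim: L => [|L IH] d d0; first by exists 0%N => n _; rewrite /wnorm big_ord0 ltW.
  have d2 : 0 < d / 2 by rewrite divr_gt0.
  have [N1 h1] := IH _ d2; have [N2 h2] := sq_small L _ (divr_gt0 d2 (rho0 L)).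
  exists (maxn N1 N2) => n; rewrite geq_max => /andP[n1 n2]; rewrite wnormS.
  have := h1 n n1; have := h2 n n2; rewrite ler_pdivlMr // [_ * rho L]mulrC; lra.
(* The intermediate index m may depend on L, whereas N does not. The bound is 4 e^2 = 2 e^2 + 2 e^2:
   one part for f n - f m from the Cauchy condition, the other for f m - F on the first L
   squares. *)
have key e : 0 < e -> exists N, forall n, (N <= n)%N -> forall L, wN L (fun z => f n z - F z) <= 4 * e ^+ 2.
  move=> e0; have [N hN] := cf _ e0; exists N => n Nn L.
  have [N' hN'] := w_small L _ (exprn_gt0 2 e0); pose m := maxn N N'.
  have h1 := hN' m (leq_maxr _ _); have h2 := ltW (hN n m Nn (leq_maxl _ _)).
  have h3 : wN L (f n - f m) <= e ^+ 2.
    apply: le_trans (wnorm_le_hip L (inHB (hf n) (hf m))) _.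
    by rewrite -hnorm_sq ?ler_sqr ?nnegrE ?hnorm_ge0 ?(ltW e0) //; exact: inHB.
  have h4 := wnormB_le L (inH_holo (inHB (hf n) (hf m))) (fun z Oz => cdiffN (hB m z Oz)).
  move: h4; have -> : (fun z => (f n - f m) z - - (f m z - F z)) = (fun z => f n z - F z).
    by apply/funext => z; transitivity (f n z - f m z - - (f m z - F z)); [by []|ring].
  have -> : wN L (fun z => - (f m z - F z)) = wN L (fun z => f m z - F z).
    rewrite /wnorm; apply: eq_bigr => j _; congr (_ * _); apply: sqnormN; exact: hB.
  move=> h4; lra.
have inD : exists n, inH (fun z => f n z - F z).
  have [N hN] := key 1 ltr01; exists N; split; last by exists (4 * 1 ^+ 2); exact: hN.
  split; first exact: hB.
  by move=> z nz; rewrite Fn // subr0; case: (hf N) => [[_ zf] _]; exact: zf.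
have hFH : inH F.
  have [n hn] := inD; suff -> : F = f n - (fun z => f n z - F z) by apply: inHB.
  by apply/funext => z; transitivity (f n z - (f n z - F z)); [ring|by []].
exists F => // e e0; have e4 : 0 < e / 4 by rewrite divr_gt0.
have [N hN] := key _ e4; exists N => n Nn.
have h := hip_le (inHB (hf n) hFH) (hN n Nn).
apply: (@le_lt_trans _ _ (e / 2)); last by lra.
rewrite -ler_sqr ?nnegrE ?hnorm_ge0 ?divr_ge0 ?(ltW e0) // hnorm_sq; last exact: inHB.
by apply: le_trans h _; rewrite !expr_div_n; lra.
Qed.
End HardyType.

(** * Evaluation and difference quotients as bounded maps *)

Section HardySpace.
Variables (R : realType) (O : set R[i]) (oO : copen O).
Variables (rho : nat -> R) (rho0 : forall j, 0 < rho j) (rho1 : forall j, rho j <= 2^-1 ^+ j.+1).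
Implicit Types (z w u : R[i]).
Local Notation Re := (@complex.Re R).
Local Notation S := (inH_subspace O rho0).

Fact hardy_complete (f : nat -> subspace_type S) :
    (forall e : R, 0 < e -> exists N, forall m n, (N <= m)%N -> (N <= n)%N ->
       Num.sqrt (Re (hip O rho (subval (f m - f n)) (subval (f m - f n)))) < e) ->
    exists l : subspace_type S, forall e : R, 0 < e -> exists N, forall n, (N <= n)%N ->
       Num.sqrt (Re (hip O rho (subval (f n - l)) (subval (f n - l)))) < e.
Proof.
move=> cf; have [F hF h] := inH_complete oO rho0 (fun n => subvalP (f n)) cf.
by exists (subof S hF).
Qed.

Definition hardy : hilbert R := @Hilbert R (subspace_type S) (fun x y => hip O rho (subval x) (subval y))
  (fun a x y t => hip_linear rho0 a (subvalP x) (subvalP y) (subvalP t))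
  (fun x y => hip_conj rho0 (subvalP x) (subvalP y))
  (fun x => hip_ge0 rho0 (subvalP x))
  (fun x hx => @subval_inj R _ _ S x 0 (hip_def oO rho0 (subvalP x) hx))
  hardy_complete.

Definition hfun (F : hardy) : R[i] -> R[i] := subval (F : subspace_type S).
Implicit Types F G : hardy.

Lemma hfun_linear a F G : hfun (a *: F + G) = a *: hfun F + hfun G. Proof. by []. Qed.
Lemma hfun_inH F : inH O rho (hfun F). Proof. exact: subvalP. Qed.
Lemma hfun_holo F : holo O (hfun F). Proof. exact: (inH_holo (hfun_inH F)). Qed.
Lemma hfun_out F z : ~ O z -> hfun F z = 0. Proof. by case: (hfun_inH F) => [[_ h] _]; exact: h. Qed.
Lemma hfun_inj F G : hfun F = hfun G -> F = G. Proof. exact: subval_inj. Qed.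
Lemma hfun_nr F : nr F = hnorm O rho (hfun F). Proof. by []. Qed.

Lemma hfun_surj g : inH O rho g -> exists F, hfun F = g.
Proof. by move=> h; exists (subof S h). Qed.

Lemma hfun_ext F G : (forall z, O z -> hfun F z = hfun G z) -> F = G.
Proof.
move=> h; apply: hfun_inj; apply/funext => z; case: (EM (O z)) => [/h //|nO].
by rewrite !hfun_out.
Qed.

Lemma evaluation_exists : exists kk : R[i] -> hardy, forall w, O w -> forall F, hfun F w = ip F (kk w).
Proof.
have /boolp.choice[kk hk] : forall w, exists k : hardy, O w -> forall F, hfun F w = ip F k.
  move=> w; case: (EM (O w)) => [Ow|nO]; last by exists 0.
  have [K [d [K0 d0] h]] := eval_near oO rho0 Ow.
  have [||a x y _ _|x _|k [hk _ _]] := @riesz R hardy (fun=> True) (fun F => hfun F w) K.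
  - by split.
  - exact: ltW.
  - by rewrite hfun_linear.
  - by rewrite hfun_nr; apply: h; [exact: hfun_inH|rewrite subrr cmod0].
  by exists k => _ F; rewrite hk.
by exists kk.
Qed.

(** The constant A costs at most 8 A on each square, and the weights, being at most 2^-(j+1), sum to
    at most 1. *)
Lemma inH_pointwise (g : R[i] -> R[i]) F (A B : R) : holo O g -> (forall z, ~ O z -> g z = 0) -> 0 <= A -> 0 <= B ->
  (forall z, O z -> cmod (g z) ^+ 2 <= A + B * cmod (hfun F z) ^+ 2) ->
  inH O rho g /\ hnorm O rho g ^+ 2 <= 8 * A + B * nsq F.
Proof.
move=> hg zg A0 B0 h.
have wb N : wnorm O rho N g <= 8 * A + B * nsq F.
  apply: (@le_trans _ _ (8 * A * (\sum_(j < N) 2^-1 ^+ j.+1) + B * wnorm O rho N (hfun F))).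
    rewrite /wnorm !mulr_sumr -big_split /=; apply: ler_sum => j _.
    have h1 := sqnorm_pointwise (j := j) (hfun_holo F) hg A0 B0 (fun z Oz _ => h z Oz).
    have h2 := ler_wpM2l (ltW (rho0 j)) h1; apply: le_trans h2 _.
    have h3 := ler_wpM2l (mulr_ge0 (ler0n R 8) A0) (rho1 j).
    by rewrite mulrDr [rho j * (8 * A)]mulrC; apply: lerD => //; rewrite mulrCA.
  apply: lerD; last by apply: ler_wpM2l => //; exact: (wnorm_le_hip rho0 N (hfun_inH F)).
  by rewrite ler_piMr ?mulr_ge0 // geometric_sum.
have hh : inH O rho g by split=> //; exists (8 * A + B * nsq F).
by split=> //; rewrite (hnorm_sq rho0 hh); exact: hip_le.
Qed.

Lemma cmodB_sq (x y : R[i]) : cmod (x - y) ^+ 2 <= 2 * cmod x ^+ 2 + 2 * cmod y ^+ 2.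
Proof.
have := cmod_triangle 0 x y; rewrite subr0 add0r cmodN.
move=> h; apply: (@le_trans _ _ ((cmod x + cmod y) ^+ 2)).
  by rewrite ler_sqr ?nnegrE ?addr_ge0 ?cmod_ge0.
by have := sqr_ge0 (cmod x - cmod y); rewrite sqrrB sqrrD; move: (cmod x) (cmod y) => b c; lra.
Qed.

Lemma holo_zero_ext g : holo O g -> holo O (zero_ext O g).
Proof.
move=> hg z Oz; apply: (@cdiff_local _ g); last exact: hg.
by apply: cnearW (oO Oz) => w Ow; rewrite /zero_ext patchE ifT // inE.
Qed.

Lemma zero_ext_in (g : R[i] -> R[i]) z : O z -> zero_ext O g z = g z.
Proof. by move=> Oz; rewrite /zero_ext patchE ifT // inE. Qed.
Lemma zero_ext_out (g : R[i] -> R[i]) z : ~ O z -> zero_ext O g z = 0.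
Proof. by move=> Oz; rewrite /zero_ext patchE ifF //; apply/negbTE; rewrite notin_setE. Qed.

Lemma eq_zero_ext (g h : R[i] -> R[i]) : (forall z, O z -> g z = h z) -> zero_ext O g = zero_ext O h.
Proof.
move=> gh; apply/funext => z; case: (EM (O z)) => [Oz|nO]; first by rewrite !zero_ext_in ?gh.
by rewrite !zero_ext_out.
Qed.

Lemma diff_quot_lin u a (f g : R[i] -> R[i]) z : cdiff f u -> cdiff g u ->
  diff_quot u (a *: f + g) z = a * diff_quot u f z + diff_quot u g z.
Proof.
move=> /cdiff_derive1 df /cdiff_derive1 dg; rewrite /diff_quot; case: eqP => _.
  apply: cder_derive1; have := cderD (cderM (cder_cst a u) df) dg.
  by rewrite mul0r add0r.
have e w : (a *: f + g) w = a * f w + g w by [].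
by rewrite !e mulrA -mulrDl mulrBr; congr (_ * _); ring.
Qed.

(** Near [u] the quotient is controlled by the Cauchy estimate on a square around [u], and at
    distance at least d by (2/d^2)(|F z|^2 + |F u|^2). Both bounds have the shape A + B |F z|^2 that
    [inH_pointwise] accepts. *)
Lemma diff_quot_op_bound u : O u -> exists2 b : R, 0 <= b & forall F,
  inH O rho (diff_quot_op O u (hfun F)) /\ hnorm O rho (diff_quot_op O u (hfun F)) ^+ 2 <= b * nsq F.
Proof.
move=> Ou; have [j [vj uj]] := sq_cover (oO Ou).
have vj' : sqvalid O j by apply/asboolP.
have rj := rad_gt0 R j; have pj := rho0 j.
have [K [d1 [K0 d10] hK]] := eval_near oO rho0 Ou.
(* Points within d of [u] are still within half the half-side of the centre of the square, where
   [diff_quot_bound] applies. *)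
pose d := rad R j / 2 - cmod (u - cen R j); have d0 : 0 < d by rewrite subr_gt0.
have k2 : 0 <= sqK2 (rad R j).
  rewrite /sqK2 divr_ge0 ?sqr_ge0 //; have := ltW rj => ?; by rewrite !mulr_ge0 // invr_ge0.
pose A1 := sqK2 (rad R j) / rho j + 2 * K ^+ 2 / d ^+ 2; pose B := 2 / d ^+ 2.
have B0 : 0 <= B by rewrite divr_ge0 // sqr_ge0.
have q0 : 0 <= 2 * K ^+ 2 / d ^+ 2 by apply: divr_ge0; [apply: mulr_ge0 => //|]; exact: sqr_ge0.
have p0 : 0 <= sqK2 (rad R j) / rho j by apply: divr_ge0 => //; exact: ltW.
have A10 : 0 <= A1 by exact: addr_ge0.
exists (8 * A1 + B); first by rewrite addr_ge0 // mulr_ge0.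
move=> F; rewrite mulrDl -mulrA.
have n0 := nsq_ge0 F.
apply: inH_pointwise => //; first exact: holo_zero_ext (holo_diff_quot oO Ou (hfun_holo F)).
- by move=> z; exact: zero_ext_out.
- exact: mulr_ge0.
move=> z Oz; rewrite /diff_quot_op zero_ext_in // mulrDl; have [zu|zu] := ltP (cmod (z - u)) d.
  have zc : cmod (z - cen R j) < rad R j / 2.
    by have := cmod_triangle u z (cen R j); move: zu; rewrite /d; lra.
  have h := diff_quot_bound rj uj zc (fun s hs => hfun_holo F (vj s hs)).
  apply: le_trans h _; rewrite -(sqnorm_valid _ vj').
  have h := sqnorm_le_hip rho0 j (hfun_inH F); rewrite -/(nsq F) in h.
  have : sqK2 (rad R j) * sqnorm O j (hfun F) <= sqK2 (rad R j) / rho j * nsq F.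
    by move: (sqK2 _) k2 => k k0; rewrite mulrAC ler_pdivlMr // -mulrA [_ * rho j]mulrC; exact: ler_wpM2l.
  have : 0 <= 2 * K ^+ 2 / d ^+ 2 * nsq F by exact: mulr_ge0.
  have : 0 <= B * cmod (hfun F z) ^+ 2 by rewrite mulr_ge0 // sqr_ge0.
  move: (B * _) (_ / _ * nsq F) (_ / _ * nsq F) (_ * sqnorm _ _ _) => a b c e; lra.
have nzu : z != u by apply: contraTneq zu => ->; rewrite subrr cmod0 -ltNge.
rewrite /diff_quot (negbTE nzu) cmodM cmodV.
have hu : cmod (hfun F u) ^+ 2 <= K ^+ 2 * nsq F.
  have := hK _ u (hfun_inH F); rewrite subrr cmod0 => /(_ d10); rewrite -hfun_nr -nr_sq -exprMn => h.
  by rewrite ler_sqr ?nnegrE ?cmod_ge0 // mulr_ge0 ?nr_ge0 // ltW.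
have hz : (cmod (hfun F z - hfun F u) / cmod (z - u)) ^+ 2 <= (2 * cmod (hfun F z) ^+ 2 + 2 * cmod (hfun F u) ^+ 2) / d ^+ 2.
  rewrite expr_div_n; apply: ler_pM.
  - exact: sqr_ge0.
  - by rewrite invr_ge0 sqr_ge0.
  - exact: cmodB_sq.
  - rewrite lef_pV2 ?posrE ?exprn_gt0 //; last exact: lt_le_trans zu.
    by rewrite ler_sqr ?nnegrE ?cmod_ge0 // ltW.
apply: le_trans hz _; rewrite /B.
have e : (2 * cmod (hfun F z) ^+ 2 + 2 * cmod (hfun F u) ^+ 2) / d ^+ 2 =
  2 / d ^+ 2 * cmod (hfun F z) ^+ 2 + 2 / d ^+ 2 * cmod (hfun F u) ^+ 2 by rewrite mulrDl; congr (_ + _); rewrite mulrAC.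
rewrite e; have := ler_wpM2l B0 hu; rewrite /B.
have : 0 <= sqK2 (rad R j) / rho j * nsq F by exact: mulr_ge0.
have -> : 2 * K ^+ 2 / d ^+ 2 * nsq F = 2 / d ^+ 2 * (K ^+ 2 * nsq F) by ring.
move: (2 / d ^+ 2 * _) (2 / d ^+ 2 * _) (2 / d ^+ 2 * _) (_ / _ * nsq F) => a b c f; lra.
Qed.

Lemma diff_quot_operator u : O u -> exists D : hardy -> hardy,
  [/\ lin D, exists b, bnd D b & forall F, hfun (D F) = diff_quot_op O u (hfun F)].
Proof.
move=> Ou; have [b b0 hb] := diff_quot_op_bound Ou.
have /boolp.choice[D hD] : forall F, exists G, hfun G = diff_quot_op O u (hfun F).
  by move=> F; apply: hfun_surj; exact: (hb F).1.
exists D; split=> //.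
  have Dz F z : O z -> hfun (D F) z = diff_quot u (hfun F) z.
    by move=> Oz; rewrite hD; exact: zero_ext_in.
  move=> a F G; apply: hfun_ext => z Oz; rewrite Dz // !hfun_linear.
  rewrite diff_quot_lin; [|exact: hfun_holo..].
  by rewrite -!Dz.
exists (Num.sqrt b); split=> [|F]; first exact: sqrtr_ge0.
have := (hb F).2; rewrite -hD -hfun_nr => h.
apply: sqr_le_of_le2; first by apply: mulr_ge0; [exact: sqrtr_ge0|exact: nr_ge0].
by apply: le_trans h _; rewrite exprMn (nr_sq F) (sqr_sqrtr b0).
Qed.
End HardySpace.
(** * The Nevanlinna kernel *)

Section Kernel.
Variables (R : realType) (O : set R[i]) (oO : copen O).
Variable phi : R[i] -> R[i].
Hypothesis hphi : holo O phi.
Implicit Types (s y z w u : R[i]).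
Local Notation dd s y := (diff_quot y phi s).

Lemma diff_quotK g u s : diff_quot u g s * (s - u) = g s - g u.
Proof.
rewrite /diff_quot; case: eqP => [->|/eqP su]; first by rewrite !subrr mulr0.
by rewrite divfK // subr_eq0.
Qed.

Lemma dd_sym s y : dd s y = dd y s.
Proof.
rewrite /diff_quot [y == s]eq_sym; case: eqP => [-> //|/eqP sy].
by rewrite -[s - y]opprB invrN mulrN -mulNr opprB.
Qed.

(** For distinct points both sides are (y - u)(s - u) times the second divided difference of [phi]
    at s, y, u, which is symmetric in its arguments. The intertwining of D_u with [T] rests on this
    identity. *)
Lemma dd_exchange s y u : (dd s y - dd s u) * (s - u) = (y - u) * (dd s y - dd u y).
Proof.
have e1 := diff_quotK phi u s; have e2 := diff_quotK phi y s; have e3 := diff_quotK phi y u.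
have -> : (dd s y - dd s u) * (s - u) = dd s y * (s - y) + dd s y * (y - u) - dd s u * (s - u) by ring.
have -> : (y - u) * (dd s y - dd u y) = dd s y * (y - u) + dd u y * (u - y) by ring.
by rewrite e1 e2 e3; ring.
Qed.

(** On the diagonal this is the mean-square Cauchy estimate; off it the numerator is locally bounded
    and the denominator stays above a quarter of |s0 - y0|. *)
Lemma dd_locally_bounded s0 y0 : O s0 -> O y0 -> exists M, exists2 d : R, 0 < d &
  forall s y, cmod (s - s0) < d -> cmod (y - y0) < d -> cmod (dd s y) <= M.
Proof.
move=> Os Oy; have [<-|ne] := eqVneq s0 y0.
  have [r r0 hr] := exists_sq oO Os.
  exists (sqK2 r * sqn s0 r phi + 1), (r / 2); first by rewrite divr_gt0.
  move=> s y hs hy; have := diff_quot_bound r0 hy hs (fun t ht => hphi (hr t ht)).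
  move: (sqK2 r * _) (cmod_ge0 (dd s y)); move: (cmod _) => a b a0 h; nra.
have d0 : 0 < cmod (s0 - y0) by rewrite cmod_gt0 subr_eq0.
have cs := ccont_bounded (cdiff_cont (hphi Os)); have cy := ccont_bounded (cdiff_cont (hphi Oy)).
case: cs => d1 d10 h1; case: cy => d2 d20 h2.
pose e := cmod (s0 - y0) / 4.
have e0 : 0 < e by rewrite divr_gt0.
exists (((cmod (phi s0) + 1) + (cmod (phi y0) + 1)) / e), (Num.min e (Num.min d1 d2)).
  by rewrite !lt_min e0 d10 d20.
move=> s y; rewrite !lt_min => /and3P[s1 s2 s3] /and3P[y1 y2 y3].
have far : e <= cmod (s - y).
  have := cmod_triangle s s0 y0; have := cmod_triangle y s y0; rewrite (cmodB s0 s).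
  by move: s1 y1; rewrite /e; lra.
have sy : s != y by apply: contraTneq far => ->; rewrite subrr cmod0 -ltNge.
rewrite /diff_quot (negbTE sy) cmodM cmodV; apply: ler_pM; rewrite ?invr_ge0 ?cmod_ge0 //.
  have := cmod_triangle 0 (phi s) (phi y); rewrite subr0 add0r cmodN.
  by have := h1 s s2; have := h2 y y3; lra.
by rewrite lef_pV2 ?posrE //; apply: lt_le_trans far.
Qed.

(** Compactness is used twice: in [z], for [s] near a fixed point, and then in [s]. *)
Lemma dd_bounded c r c' r' : (forall s, insq c r s -> O s) -> (forall z, insq c' r' z -> O (conjc z)) ->
  exists2 M : R, 0 < M & forall s z, insq c r s -> insq c' r' z -> cmod (dd s (conjc z)) <= M.
Proof.
move=> hs hz.
have [||M M0 hM] := @insq_bounded R (fun M s => forall z, insq c' r' z -> cmod (dd s (conjc z)) <= M) c r.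
- by move=> M M' s MM h z zi; apply: le_trans (h z zi) MM.
- move=> s0 /hs Os.
  (* One number [M] plays both the bound and the inverse of the radius in [s]; this makes [Q]
     monotone in [M], as [insq_bounded] requires. *)
  pose Q M z := 0 < M /\ forall s, cmod (s - s0) * M < 1 -> cmod (dd s (conjc z)) <= M.
  have [||M M0 hM] := @insq_bounded R Q c' r'.
  + move=> M M' z MM [M0 h]; split=> [|s hs1]; first exact: lt_le_trans MM.
    apply: (le_trans _ MM); apply: h; apply: le_lt_trans hs1; apply: ler_wpM2l; [exact: cmod_ge0|exact: MM].
  + move=> z0 /hz Oz; have [M [d d0 h]] := dd_locally_bounded Os Oz.
    exists (Num.max M d^-1), d => // z zz; split; first by rewrite lt_max invr_gt0 d0 orbT.
    move=> s hs1; apply: (@le_trans _ _ M); last by rewrite le_max lexx.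
    apply: h; last by rewrite -conjcB cmod_conj.
    have : cmod (s - s0) * d^-1 < 1.
      by apply: le_lt_trans hs1; apply: ler_wpM2l; [exact: cmod_ge0|rewrite le_max lexx orbT].
    by rewrite ltr_pdivrMr // mul1r.
  exists M, M^-1; first by rewrite invr_gt0.
  move=> s hs1 z /hM[_]; apply; move: hs1.
  by rewrite -ltr_pdivlMr // div1r.
by exists M => // s z si zi; exact: hM.
Qed.
End Kernel.

(** * The Hilbert space model and the operator T *)

Section NevanlinnaKernel.
Variables (R : realType) (O : set R[i]) (oO : copen O) (symO : forall z, O z -> O (conjc z)).
Variable phi : R[i] -> R[i].
Hypotheses (hphi : holo O phi) (sphi : forall z, O z -> phi (conjc z) = conjc (phi z)).
Implicit Types (s y z w u : R[i]).
Local Notation dd s y := (diff_quot y phi s).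
Local Notation Re := (@complex.Re R).

(** Off the diagonal this is the symmetry of [phi]; the diagonal follows by continuity in the first
    variable, without computing a derivative. *)
Lemma dd_conj s y : O s -> O y -> dd (conjc s) (conjc y) = conjc (dd s y).
Proof.
move=> Os Oy; apply: (ccont_unique (f := fun t => dd (conjc t) (conjc y)) (g := fun t => conjc (dd t y))).
- apply: (@ccont_comp _ (@conjc R) (diff_quot (conjc y) phi)); first exact: ccont_conj.
  by apply: cdiff_cont; apply: (holo_diff_quot oO) => //; exact: symO.
- apply: (@ccont_comp _ (diff_quot y phi) (@conjc R)); last exact: ccont_conj.
  by apply: cdiff_cont; exact: (holo_diff_quot oO).
have [<-|sy] := eqVneq s y.
  apply: cnearW (oO Os) => t Ot ts.
  have ts' : conjc t != conjc s by apply: contraNneq ts => /(can_inj (@conjcK R)) ->.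
  by rewrite /diff_quot (negbTE ts) (negbTE ts') !sphi // -!conjcB fmorph_div.
apply: cnearW (cnearI (oO Os) (cnear_neq sy)) => t [Ot ty] _.
have ts' : conjc t != conjc y by apply: contraNneq ty => /(can_inj (@conjcK R)) ->.
by rewrite /diff_quot (negbTE ty) (negbTE ts') !sphi // -!conjcB fmorph_div.
Qed.

(* This bound makes F |-> (z |-> <F, N_z>) a contraction. *)
Lemma kernel_weights : exists rho : nat -> R,
  [/\ forall j, 0 < rho j, forall j, rho j <= 2^-1 ^+ j.+1 &
    forall k z, sqvalid O k -> insq (cen R k) (rad R k) z -> forall N,
      wnorm O rho N (zero_ext O (diff_quot (conjc z) phi)) <= 2^-1 ^+ k.+1 / (8 * rho k)].
Proof.
have ex j k : exists M : R, 0 <= M /\ (sqvalid O j -> sqvalid O k ->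
    forall s z, insq (cen R j) (rad R j) s -> insq (cen R k) (rad R k) z -> cmod (dd s (conjc z)) <= M).
  case: (boolP (sqvalid O j)) => vj; last by exists 0.
  case: (boolP (sqvalid O k)) => vk; last by exists 0.
  have [M M0 h] := dd_bounded oO hphi (fun s => @valid_in R O j s vj) (fun z hz => symO (valid_in vk hz)).
  by exists M; split=> [|_ _]; [exact: ltW|exact: h].
have /boolp.choice[M hM] : forall p : nat * nat, exists M : R, 0 <= M /\ (sqvalid O p.1 -> sqvalid O p.2 ->
    forall s z, insq (cen R p.1) (rad R p.1) s -> insq (cen R p.2) (rad R p.2) z -> cmod (dd s (conjc z)) <= M).
  by move=> p; exact: ex.
(* 64 = 8 * 8: a squared bound integrates over a square to at most 8 times itself, once in [s] for
   the norm of the kernel function, and once in [z] for functions dominated by that norm. *)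
have [rho [rho0 rho1 rhoM]] := @weights_exist R (fun j k => 64 * M (j, k) ^+ 2) (fun j k => mulr_ge0 (ler0n _ _) (sqr_ge0 _)).
exists rho; split=> // k z vk zk N.
have Oz := symO (valid_in vk zk).
have hN : holo O (zero_ext O (diff_quot (conjc z) phi)).
  by apply: (holo_zero_ext oO); exact: (holo_diff_quot oO).
have h0 : holo O (fun=> 0) by move=> t _; exact: cdiff_cst.
apply: (@le_trans _ _ (\sum_(j < N) 2^-1 ^+ j.+1 * (2^-1 ^+ k.+1 / (8 * rho k)))); last first.
  rewrite -mulr_suml; apply: ler_piMl; last exact: geometric_sum.
  apply: divr_ge0; first by apply: exprn_ge0; rewrite invr_ge0.
  by apply: mulr_ge0 => //; exact: ltW.
rewrite /wnorm; apply: ler_sum => j _; have pk := rho0 k.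
rewrite mulrA ler_pdivlMr ?mulr_gt0 //.
have hs : sqnorm O j (zero_ext O (diff_quot (conjc z) phi)) <= 8 * M (nat_of_ord j, k) ^+ 2.
  case: (boolP (sqvalid O j)) => vj; last first.
    by rewrite /sqnorm /sqip (negbTE vj) mulr_ge0 // sqr_ge0.
  have -> : 8 * M (nat_of_ord j, k) ^+ 2 = 8 * M (nat_of_ord j, k) ^+ 2 + 0 * sqnorm O j (fun=> 0) by rewrite mul0r addr0.
  apply: sqnorm_pointwise => //; first exact: sqr_ge0.
  move=> s Os sj; rewrite zero_ext_in // mul0r addr0 ler_sqr ?nnegrE ?cmod_ge0 ?(hM (_, _)).1 //.
  exact: (hM (_, _)).2.
apply: le_trans (rhoM j k); have := ler_wpM2l (ltW (mulr_gt0 (rho0 j) pk)) hs.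
move: (sqnorm _ _ _) (M _) => a b; move: (rho j) (rho k) => c d; lra.
Qed.

(** The properties of the space on which the model rests. The last clause is what the weights are
    made for: on the j-th square 8 rho_j |N_z|^2 <= 2^-(j+1), so a holomorphic function below c
    |N_z| has norm at most c. It makes [T] well defined and contractive. *)
Lemma hardy_exists : exists (H : hilbert R) (fn : H -> R[i] -> R[i]) (kk NN : R[i] -> H)
    (D : R[i] -> H -> H),
  [/\ [/\ forall a F G, fn (a *: F + G) = a *: fn F + fn G,
          forall F, holo O (fn F),
          forall F z, ~ O z -> fn F z = 0 &
          forall F G, (forall z, O z -> fn F z = fn G z) -> F = G],
      [/\ forall z F, O z -> fn F z = ip F (kk z) &
          forall z, O z -> fn (NN z) = zero_ext O (diff_quot (conjc z) phi)],
      forall u, O u -> [/\ lin (D u), exists b, bnd (D u) b & forall F, fn (D u F) = diff_quot_op O u (fn F)],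
      forall z, O z -> exists K, cnear z (fun w => O w /\ nr (NN w) <= K) &
      forall g (c : R), 0 <= c -> holo O g -> (forall z, ~ O z -> g z = 0) ->
        (forall z, O z -> cmod (g z) <= c * nr (NN z)) -> exists2 F, fn F = g & nr F <= c].
Proof.
have [rho [rho0 rho1 rhoN]] := kernel_weights.
pose H := hardy oO rho0; pose fn : H -> R[i] -> R[i] := @hfun R O oO rho rho0.
have [kk hkk] : exists kk : R[i] -> H, forall w, O w -> forall F : H, fn F w = ip F (kk w) by exact: evaluation_exists.
have /boolp.choice[D hD] : forall u, exists D : H -> H, O u ->
    [/\ lin D, exists b, bnd D b & forall F, fn (D F) = diff_quot_op O u (fn F)].
  move=> u; case: (EM (O u)) => [Ou|nO]; last by exists id.
  by have [D hD] := diff_quot_operator oO rho0 rho1 Ou; exists D.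
have sq z : O z -> exists2 k, sqvalid O k & cmod (z - cen R k) < rad R k.
  move=> Oz; have [k [vk zk]] := sq_cover (oO Oz); exists k; first by apply/asboolP.
  by have := rad_gt0 R k; lra.
have Nin z : O z -> inH O rho (zero_ext O (diff_quot (conjc z) phi)).
  move=> Oz; split; first split.
  - by apply: (holo_zero_ext oO); apply: (holo_diff_quot oO) => //; exact: symO.
  - by move=> w; exact: zero_ext_out.
  by have [k vk zk] := sq z Oz; exists (2^-1 ^+ k.+1 / (8 * rho k)) => N; apply: rhoN => //; exact: cmod_insq.
have /boolp.choice[NN hNN] : forall z, exists F : H, O z -> fn F = zero_ext O (diff_quot (conjc z) phi).
  move=> z; case: (EM (O z)) => [/Nin h|nO]; last by exists 0.
  by have [F hF] := hfun_surj oO rho0 h; exists F.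
have nsqNN k z : sqvalid O k -> insq (cen R k) (rad R k) z -> nsq (NN z) <= 2^-1 ^+ k.+1 / (8 * rho k).
  move=> vk zk; have Oz := valid_in vk zk.
  have h := hip_le rho0 (Nin z Oz) (rhoN k z vk zk); rewrite -(hNN z Oz) in h; exact: h.
exists H, fn, kk, NN, D; split.
- by split; [exact: hfun_linear|exact: hfun_holo|exact: hfun_out|exact: hfun_ext].
- by split=> [z F Oz|//]; exact: hkk.
- exact: hD.
- move=> z Oz; have [k vk zk] := sq z Oz; exists (Num.sqrt (2^-1 ^+ k.+1 / (8 * rho k))).
  apply: cnearW (cnear_open zk) => w /cmod_insq wk; split; first exact: valid_in vk wk.
  by rewrite /nr; apply: ler_wsqrtr; exact: nsqNN.
move=> g c c0 hg zg gb.
have wb N : wnorm O rho N g <= c ^+ 2.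
  apply: (@le_trans _ _ (c ^+ 2 * (\sum_(j < N) 2^-1 ^+ j.+1))); last first.
    by apply: ler_piMr; [exact: sqr_ge0|exact: geometric_sum].
  rewrite /wnorm mulr_sumr; apply: ler_sum => j _.
  have pj := rho0 j; have p2 : (0 : R) <= 2^-1 ^+ j.+1 by apply: exprn_ge0; rewrite invr_ge0.
  case: (boolP (sqvalid O j)) => vj; last first.
    by rewrite /sqnorm /sqip (negbTE vj) mulr0 mulr_ge0 // sqr_ge0.
  have h0 : holo O (fun=> 0) by move=> t _; exact: cdiff_cst.
  pose A := c ^+ 2 * (2^-1 ^+ j.+1 / (8 * rho j)).
  have A0 : 0 <= A.
    apply: mulr_ge0; first exact: sqr_ge0.
    by apply: divr_ge0 => //; apply: mulr_ge0 => //; exact: ltW.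
  apply: (@le_trans _ _ (rho j * (8 * A))).
    apply: ler_wpM2l; first exact: ltW.
    have -> : 8 * A = 8 * A + 0 * sqnorm O j (fun=> 0) by rewrite mul0r addr0.
    apply: sqnorm_pointwise => // z Oz zj; rewrite mul0r addr0; apply: (@le_trans _ _ ((c * nr (NN z)) ^+ 2)).
      by rewrite ler_sqr ?nnegrE ?cmod_ge0 ?mulr_ge0 ?nr_ge0 // gb.
    by rewrite exprMn nr_sq; apply: ler_wpM2l; [exact: sqr_ge0|exact: nsqNN].
  by rewrite /A le_eqVlt; apply/orP; left; apply/eqP; field; rewrite gt_eqF.
have hH : inH O rho g by split=> //; exists (c ^+ 2).
have [F hF] := hfun_surj oO rho0 hH; exists F => //.
apply: le_nr => //; have h := hip_le rho0 hH wb; rewrite -hF in h; exact: h.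
Qed.

(** Let C_u be the adjoint of D_{conj u}. By [dd_exchange] the function z |-> <F, N_z> has the
    difference quotients <C_u F, N_z>; these are locally bounded, so the function is continuous, and
    then, its quotients being continuous by the same argument, it is differentiable. This defines
    [T], and the same computation reads D_u T = T C_u. *)
Theorem hardy_model : exists (H : hilbert R) (fn : H -> R[i] -> R[i]) (kk NN : R[i] -> H)
    (D : R[i] -> H -> H) (T : H -> H),
  [/\ [/\ forall a F G, fn (a *: F + G) = a *: fn F + fn G,
          forall F, holo O (fn F),
          forall F z, ~ O z -> fn F z = 0 &
          forall F G, (forall z, O z -> fn F z = fn G z) -> F = G],
      [/\ forall z F, O z -> fn F z = ip F (kk z) &
          forall z, O z -> fn (NN z) = zero_ext O (diff_quot (conjc z) phi)],
      forall u, O u -> [/\ lin (D u), exists b, bnd (D u) b & forall F, fn (D u F) = diff_quot_op O u (fn F)],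
      [/\ lin T, selfadj T, forall F, nr (T F) <= nr F & forall z, O z -> T (kk z) = NN z] &
      forall u, O u -> forall F G, ip (D u (T F)) G = ip F (D (conjc u) (T G))].
Proof.
have [H [fn [kk [NN [D [[fnL fnh fn0 fnE] [hkk hNN] hD NNb surj]]]]]] := hardy_exists.
have fnE1 a F G : O a -> (forall z, O z -> z != a -> fn F z = fn G z) -> F = G.
  move=> Oa h; apply: fnE => z Oz; have [->|] := eqVneq z a; last exact: h.
  apply: (ccont_unique (cdiff_cont (fnh F a Oa)) (cdiff_cont (fnh G a Oa))).
  by apply: cnearW (oO Oa) => w Ow wa; exact: h.
have fnZ a F z : fn (a *: F) z = a * fn F z.
  have -> : a *: F = a *: F + 0 by rewrite addr0.
  have f0 : fn 0 z = 0.
    by have := fnL (-1) 0 0; rewrite scaler0 addr0 => ->; rewrite scaleN1r addNr.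
  by rewrite fnL -[RHS]addr0 -f0.
have fnB F G z : fn (F - G) z = fn F z - fn G z.
  have fnLz a F' G' : fn (a *: F' + G') z = a * fn F' z + fn G' z by rewrite fnL.
  by rewrite -scaleN1r addrC fnLz mulN1r addrC.
have NNz z s : O z -> O s -> fn (NN z) s = dd s (conjc z).
  by move=> Oz Os; rewrite hNN // zero_ext_in.
have NN_herm z w : O z -> O w -> fn (NN z) w = conjc (fn (NN w) z).
  move=> Oz Ow; rewrite !NNz // -dd_conj ?conjcK //; last exact: symO.
  by rewrite dd_sym.
have Dz u F z : O u -> O z -> fn (D u F) z = diff_quot u (fn F) z.
  by move=> Ou Oz; have [_ _ ->] := hD u Ou; exact: zero_ext_in.
have Dne u F z : O u -> O z -> fn (D u F) z * (z - u) = fn F z - fn F u.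
  by move=> Ou Oz; rewrite Dz // diff_quotK.
have exch u w : O u -> O w -> NN w - NN u = (conjc w - conjc u) *: D (conjc u) (NN w).
  move=> Ou Ow; have Ou' := symO Ou; have Ow' := symO Ow; apply: (fnE1 (conjc u)) => // s Os su.
  apply: (mulIf (x := s - conjc u)); first by rewrite subr_eq0.
  by rewrite fnB fnZ -mulrA Dne // !NNz // dd_exchange.
have /boolp.choice[C hC] : forall u, exists C : H -> H, O u -> exists b, [/\ lin C, bnd C b & forall F G, ip (D (conjc u) F) G = ip F (C G)].
  move=> u; case: (EM (O u)) => [Ou|nO]; last by exists id.
  have [lD [b bD] _] := hD _ (symO Ou); have [C hC] := adjoint_exists lD bD.
  by exists C => _; exists b.
pose t F z := if `[< O z >] then ip F (NN z) else 0.
have tO F z : O z -> t F z = ip F (NN z) by move=> Oz; rewrite /t; case: asboolP.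
have tdiff F u w : O u -> O w -> t F w - t F u = t (C u F) w * (w - u).
  move=> Ou Ow; rewrite !tO // -ipBr exch // ipZr -conjcB conjcK mulrC; congr (_ * _).
  have [b [_ _ e]] := hC u Ou; by rewrite ip_conj e -ip_conj.
have tbound F z : O z -> cmod (t F z) <= nr F * nr (NN z).
  by move=> Oz; rewrite tO //; exact: ip_CS_nr.
have tcont F z : O z -> ccont (t F) z.
  move=> Oz e e0; have [K hK] := NNb z Oz.
  have p0 : 0 < nr (C z F) * `|K| + 1 by rewrite ltr_wpDl ?mulr_ge0 ?nr_ge0.
  have d0 : 0 < e / (nr (C z F) * `|K| + 1) by rewrite divr_gt0.
  apply: cnearW (cnearI hK (cnear_cball z d0)) => w [[Ow hw] wz].
  rewrite tdiff // cmodM; move: wz; rewrite /cball /= ltr_pdivlMr // mulrC => wz.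
  apply: le_lt_trans wz; apply: ler_wpM2r; first exact: cmod_ge0.
  apply: le_trans (tbound _ _ Ow) _; apply: ler_wpDr => //.
  by apply: ler_wpM2l; [exact: nr_ge0|apply: le_trans hw _; exact: ler_norm].
have tholo F : holo O (t F).
  move=> z Oz; exists (t (C z F) z); exists (t (C z F)); first by split=> //; exact: tcont.
  by apply: cnearW (oO Oz) => w Ow; rewrite -tdiff // addrC subrK.
have /boolp.choice[T hT] : forall F, exists G, fn G = t F /\ nr G <= nr F.
  move=> F; have t0 z : ~ O z -> t F z = 0 by move=> nO; rewrite /t; case: asboolP.
  have [G hG nG] := surj (t F) (nr F) (nr_ge0 F) (tholo F) t0 (tbound F).
  by exists G.
have TO F z : O z -> fn (T F) z = ip F (NN z) by move=> Oz; rewrite (hT F).1 tO.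
have lT : lin T.
  move=> a F G; apply: fnE => z Oz; rewrite fnL TO // ip_linear.
  by transitivity (a * fn (T F) z + fn (T G) z); [rewrite !TO|].
have Tkk z : O z -> T (kk z) = NN z.
  by move=> Oz; apply: fnE => w Ow; rewrite TO // ip_conj -hkk // -NN_herm.
have bT : bnd T 1 by split=> // F; rewrite mul1r; exact: (hT F).2.
have [T' [lT' _ TT']] := adjoint_exists lT bT.
(* Tested on the evaluation vectors: T k_z = N_z, and <T G, k_z> = <G, N_z> by the definition of
   [T]. *)
have T'E G : T' G = T G.
  apply: fnE => z Oz; rewrite TO // hkk // -Tkk // ip_conj -TT' -ip_conj //.
exists H, fn, kk, NN, D, T; split=> //.
  split=> //; first by move=> F G; rewrite TT' T'E.
  by move=> F; exact: (hT F).2.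
move=> u Ou F G; have Ou' := symO Ou.
have e : D u (T F) = T (C u F).
  apply: (fnE1 u) => // z Oz zu; apply: (mulIf (x := z - u)); first by rewrite subr_eq0.
  by rewrite Dne // TO // TO // -!tO // tdiff // tO // TO.
have [b [_ _ hCu]] := hC u Ou.
by rewrite e TT' T'E ip_conj -hCu -ip_conj.
Qed.
End NevanlinnaKernel.

(** * The Krein space as the range of S *)

Section KreinModel.
Variables (R : realType) (O : set R[i]) (oO : copen O) (symO : forall z, O z -> O (conjc z)).
Variable phi : R[i] -> R[i].
Hypotheses (hphi : holo O phi) (sphi : forall z, O z -> phi (conjc z) = conjc (phi z)).

(** [M] is the orthogonal complement of the kernel of [S], so that x |-> S x parametrizes the range
    of [S] injectively. The kernel vectors are J S k_w, because S J S k_w = T k_w = N_w. The maps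
    [d u] with D_u S = S d_u come from [krein_lax], applied to the adjoint of D_u, followed by
    [douglas]. *)
Theorem krein_model : exists (M : hilbert R) (J : M -> M) (E : M -> R[i] -> R[i]) (nn : R[i] -> M)
    (d : R[i] -> M -> M),
  [/\ [/\ lin J, selfadj J & forall x, J (J x) = x],
      [/\ forall a x y, E (a *: x + y) = a *: E x + E y, forall x, E x = 0 -> x = 0,
          forall x, holo O (E x) & forall x z, ~ O z -> E x z = 0],
      forall w, O w -> E (nn w) = zero_ext O (diff_quot (conjc w) phi) /\ forall x, E x w = ip (J x) (nn w) &
      forall u, O u -> [/\ lin (d u), exists b, bnd (d u) b & forall x, E (d u x) = diff_quot_op O u (E x)]].
Proof.
have [H [fn [kk [NN [D [T [[fnL fnh fn0 fnE] [hkk hNN] hD [lT sT nT Tkk] DT]]]]]]] := hardy_model oO symO hphi sphi.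
have [S [J [[lS sS] [s bS] [lJ sJ] JJ [JS TJ]]]] := polar_decomposition lT sT nT.
have JT x : J (T x) = S (S x) by rewrite TJ JJ.
have TJc x : T (J x) = S (S x) by rewrite TJ -!JS JJ.
have factor u : O u -> exists2 k : R, 0 <= k & forall x, exists m, [/\ D u (S x) = S m, nr m <= k * nr x &
    forall y, S y = 0 -> ip m y = 0].
  move=> Ou; have [lD [b bD] _] := hD u Ou; have [lD' [b' bD'] _] := hD _ (symO Ou).
  have [C [lC bC hC]] := adjoint_exists lD bD; have [C' [lC' bC' hC']] := adjoint_exists lD' bD'.
  have lJC : lin (fun x => J (C' (J x))) by move=> a x y; rewrite lJ lC' lJ.
  have bJC : bnd (fun x => J (C' (J x))) b'.
    have nJ x : nr (J x) = nr x by rewrite /nr /nsq sJ JJ.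
    by case: bC' => b0 h; split=> // x; rewrite nJ; apply: le_trans (h _) _; rewrite nJ.
  (* As S^2 = J T, the intertwining relation says that the adjoint of C for the form <S x, S y> is J
     C' J, which is bounded; this is the symmetrizability that [krein_lax] asks for. *)
  have sym x y : ip (S (C x)) (S y) = ip (S x) (S (J (C' (J y)))).
    rewrite -[LHS]sS -JT sJ sT (ip_conj (T (J y))) -hC (DT u Ou) -ip_conj hC' TJ.
    by rewrite sJ sS.
  have [k k0 hk] := krein_lax lC lJC bC bJC bS sym.
  by exists k => // x; exact: (douglas lS sS lC k0 hk hC).
pose W : set H := [set m | forall y, S y = 0 -> ip m y = 0].
have sW : is_subspace W.
  split; first by move=> y _; rewrite ip0l.
  by move=> a x y Wx Wy z Sz; rewrite ip_linear Wx // Wy // mulr0 addr0.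
have cW : closedH W.
  by move=> x cx y Sy; apply: (closure_orth cx) => w; exact.
have WJ x : W x -> W (J x).
  by move=> Wx y Sy; rewrite sJ; apply: Wx; rewrite -JS Sy (lin0 lJ).
have WS x : W (S x) by move=> y Sy; rewrite sS Sy ip0r.
have W0 x : W x -> S x = 0 -> x = 0.
  by move=> Wx Sx; apply: ip_def; rewrite Wx.
pose M := sub_hilbert sW cW.
pose v (x : M) : H := subval (x : subspace_type sW).
have Wv x : W (v x) by exact: subvalP.
have vL a x y : v (a *: x + y) = a *: v x + v y by [].
have vI x y : v x = v y -> x = y by exact: subval_inj.
have vP x : W x -> exists y, v y = x by move=> Wx; exists (subof sW Wx).
have vip x y : ip x y = ip (v x) (v y) by [].
have vnr x : nr x = nr (v x) by [].
clearbody v M.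
have /boolp.choice[j hj] : forall x, exists y, v y = J (v x) by move=> x; apply: vP; exact: WJ.
have /boolp.choice[nn hnn] : forall w, exists y, v y = J (S (kk w)) by move=> w; apply: vP; apply: WJ.
have /boolp.choice[d hd] : forall u, exists d : M -> M, O u -> exists2 k : R, 0 <= k & forall x,
    D u (S (v x)) = S (v (d x)) /\ nr (d x) <= k * nr x.
  move=> u; case: (EM (O u)) => [Ou|nO]; last by exists id.
  have [k k0 hk] := factor u Ou.
  have /boolp.choice[d hd] : forall x, exists y, D u (S (v x)) = S (v y) /\ nr y <= k * nr x.
    move=> x; have [m [e nm Wm]] := hk (v x); have [y vy] := vP m Wm.
    by exists y; rewrite !vnr vy.
  by exists d => _; exists k.
exists M, j, (fun x => fn (S (v x))), nn, d; split.
- split; first by move=> a x y; apply: vI; rewrite vL !hj vL lJ.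
    by move=> x y; rewrite !vip !hj sJ.
  by move=> x; apply: vI; rewrite !hj JJ.
- split.
  + by move=> a x y; rewrite vL lS fnL.
  + move=> x h; have f0 : fn 0 = 0.
      by have := fnL (-1) 0 0; rewrite scaler0 addr0 => ->; rewrite scaleN1r addNr.
    have Sx : S (v x) = 0 by apply: fnE => z _; rewrite h f0.
    apply: vI; rewrite (W0 _ (Wv x) Sx).
    by have := vL (-1) 0 0; rewrite scaler0 addr0 => ->; rewrite scaleN1r addNr.
  + by move=> x; exact: fnh.
  + by move=> x z; exact: fn0.
- move=> w Ow; split=> [|x].
    by rewrite hnn -JS -TJ Tkk // hNN.
  by rewrite hkk // vip hj hnn sJ JJ sS.
move=> u Ou; have [k k0 hk] := hd u Ou; have [lD _ hDu] := hD u Ou; split.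
- move=> a x y; apply: vI; apply/eqP; rewrite -subr_eq0; apply/eqP; apply: W0.
    rewrite vL -scaleN1r addrC; apply: sW.2; [|exact: Wv]; apply: sW.2; exact: Wv.
  by rewrite (linB lS) vL lS -!(hk _).1 vL lS lD subrr.
- by exists k; split=> // x; exact: (hk x).2.
by move=> x; rewrite -(hk x).1 hDu.
Qed.
End KreinModel.
(** * The extended function *)

Section ExtendedFunction.
Variables (R : realType).
Local Notation C := (R[i] : numClosedFieldType).
Local Notation Im := (@complex.Im R).
Local Notation Re := (@complex.Re R).
Implicit Types (z w u : R[i]) (f g : R[i] -> R[i]).

Lemma numIm z : 'Im (z : C) = ((Im z)%:C)%C.
Proof. by rewrite complexIm. Qed.

Lemma nonrealP z : nonreal (z : C) <-> Im z != 0.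
Proof.
rewrite /nonreal /= numIm; split; first by apply: contra_neq => ->.
by apply: contra_neq => -[].
Qed.

Lemma upper_halfP z : upper_half (z : C) <-> 0 < Im z.
Proof. by rewrite /upper_half /= numIm -[0]/((0%:C)%C) ltcR. Qed.

Lemma lower_halfP z : lower_half (z : C) <-> Im z < 0.
Proof. by rewrite /lower_half /= numIm -[0]/((0%:C)%C) ltcR. Qed.

Lemma num_realE z : ((z : C) \is Num.real) = (Im z == 0).
Proof. by case: z => x y; rewrite complex_real. Qed.

Lemma nonreal_open z : nonreal (z : C) -> cnear z (fun w => nonreal (w : C)).
Proof.
move=> /nonrealP zi; exists `|Im z|; first by rewrite normr_gt0.
move=> w wz; apply/nonrealP; apply: contraTneq wz => wi; rewrite -leNgt.
by apply: le_trans (Im_le_cmod _); rewrite ImB wi sub0r normrN.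
Qed.

Lemma nonreal_dense z P : cnear z P -> exists2 w, nonreal (w : C) & P w.
Proof.
move=> [e e0 h]; have [zi|/negPn/eqP zi] := boolP (Im z != 0).
  by exists z; [exact/nonrealP|apply: h; rewrite subrr cmod0].
exists (z + Complex 0 (e / 2)).
  by apply/nonrealP; rewrite ImD zi add0r /= gt_eqF // divr_gt0.
apply: h; rewrite addrC addKr; apply: le_lt_trans (cmod_le_ReIm _) _.
by rewrite /= normr0 add0r ger0_norm ?divr_ge0 ?(ltW e0) //; lra.
Qed.

Lemma fext_nonreal f z : nonreal (z : C) -> fext (f : C -> C) z = f z.
Proof. by rewrite /nonreal /fext /= => ->. Qed.

Lemma fext_real f g z : Im z = 0 -> ccont g z -> cnear z (fun w => nonreal (w : C) -> f w = g w) ->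
  fext (f : C -> C) z = g z.
Proof.
move=> zi cg fg; rewrite /fext numIm zi eqxx /=.
by apply: lim_within => // P; exact: nonreal_dense.
Qed.

Lemma cder_conj f z l : cder f z l -> cder (fun w => conjc (f (conjc w))) (conjc z) (conjc l).
Proof.
move=> [q [cq <-] [e e0 h]]; exists (fun w => conjc (q (conjc w))).
  split; last by rewrite conjcK.
  apply: (@ccont_comp _ (fun w => q (conjc w)) (@conjc R)); last exact: ccont_conj.
  by apply: ccont_comp; [exact: ccont_conj|rewrite conjcK].
exists e => // w wz; rewrite conjcK h; last by rewrite -cmod_conj conjcB conjcK.
by rewrite conjcD conjcM conjcB conjcK.
Qed.

(** The two cases in the definition of [Uext] are merged: near each point a single analytic function
    represents [fext]. At a real point the radius stays below the distances to both ends of the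
    interval, so nearby real points are covered by the same interval. *)
Lemma Uext_local f z : Uext (f : C -> C) z -> exists g, ccont g z /\
  cnear z (fun w => [/\ Uext (f : C -> C) w, fext (f : C -> C) w = g w & cdiff g w]).
Proof.
move=> [[zn /analytic_atP fz]|[a [b [ar br /andP[az zb] [V [g [/openP oV abV gV fg]]]]]]].
  exists f; split; first exact: cdiff_cont (cnear_pt fz).
  apply: cnearW (cnearI (nonreal_open zn) (cnearI fz (cnear_near fz))) => w [wn [fw fww]].
  by split=> //; [left; split=> //; apply/analytic_atP|exact: fext_nonreal].
have gV' w : V w -> cnear w (cdiff g) by move=> /gV /analytic_atP.
have Vz : V z by apply: abV; rewrite /= az zb.
exists g; split; first exact: cdiff_cont (cnear_pt (gV' z Vz)).
move: az zb; rewrite !ltcE => /andP[/eqP ia ra] /andP[/eqP ib rb].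
have aI : Im a = 0 by apply/eqP; rewrite -num_realE.
have d0 : 0 < Num.min (Re z - Re a) (Re b - Re z) by rewrite lt_min !subr_gt0 ra rb.
apply: cnearW (cnearI (oV z Vz) (cnear_cball z d0)) => w [Vw]; rewrite /cball /= lt_min => /andP[w1 w2].
have [wn|/negPn/eqP wi] := boolP (Im w != 0).
  have wn' : nonreal (w : C) by apply/nonrealP.
  split; last exact: cnear_pt (gV' w Vw); last by rewrite fext_nonreal // fg.
  left; split=> //; apply/analytic_atP.
  apply: cnearW (cnearI (cnear_near (oV w Vw)) (cnearI (cnear_near (nonreal_open wn')) (gV' w Vw))) => u [Vu [un gu]].
  apply: cdiff_local gu; apply: cnearW (cnearI Vu un) => t [Vt tn]; by rewrite fg.
split; last exact: cnear_pt (gV' w Vw).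
  right; exists a, b; split=> //; last by exists V, g; split=> //; apply/openP.
  have := Re_le_cmod (w - z); rewrite ReB => h; have := ler_norm (Re w - Re z); have := ler_norm (Re z - Re w).
  rewrite !ltcE wi ib ia aI eqxx /= distrC => h1 h2; apply/andP; split; lra.
apply: fext_real => //; first exact: cdiff_cont (cnear_pt (gV' w Vw)).
by apply: cnearW (oV w Vw) => u Vu un; exact: fg.
Qed.

Lemma Uext_open f : copen (Uext (f : C -> C)).
Proof. by move=> z /Uext_local[g [_ h]]; apply: cnearW h => w []. Qed.

Lemma fext_holo f : holo (Uext (f : C -> C)) (fext (f : C -> C)).
Proof.
move=> z /Uext_local[g [_ h]]; have [_ _ gz] := cnear_pt h.
by apply: cdiff_local gz; apply: cnearW h => w [_ ->].
Qed.

Variable f : R[i] -> R[i].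
Hypothesis hf : Nsym (f : C -> C).

(** The reflected function w |-> conjc (f (conjc w)) is differentiable and agrees with [f] near the
    conjugate point. *)
Lemma analyticity_domain_conj z : analyticity_domain (f : C -> C) z -> analyticity_domain (f : C -> C) (conjc z).
Proof.
have [_ _ sf] := hf; move=> [zn /analytic_atP fz]; split.
  by apply/nonrealP; move/nonrealP: zn; case: (z) => x y /=; rewrite oppr_eq0.
apply/analytic_atP; case: (cnearI (cnear_near fz) (cnear_near (nonreal_open zn))) => e e0 h.
exists e => // w wz; have [] := h (conjc w); first by rewrite -cmod_conj conjcB conjcK.
move=> fw wn; have [l hl] := cnear_pt fw.
have hl' := cder_conj hl; rewrite conjcK in hl'.
exists (conjc l); apply: cder_local hl'.
case: (cnearI (cnear_near fw) wn) => e1 e10 h1; exists e1 => // u uw.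
have [] := h1 (conjc u); first by rewrite -conjcB cmod_conj.
move=> fu un; have := sf (conjc u) (conj un (iffRL (analytic_atP _ _) fu)).
by rewrite -[(conjc u)^*]/(conjc (conjc u)) conjcK => ->.
Qed.

Lemma Uext_conj z : Uext (f : C -> C) z -> Uext (f : C -> C) (conjc z).
Proof.
move=> [/analyticity_domain_conj|h]; first by left.
right; suff -> : conjc z = z by [].
move: h => [a [b [ar _ /andP[+ _] _]]]; rewrite ltcE => /andP[/eqP ia _].
have : Im a = 0 by apply/eqP; rewrite -num_realE.
by rewrite -ia; case: (z) => x y /= ->; rewrite oppr0.
Qed.

(** Off the real line this is the symmetry of [f]. At a real point both sides are limits along
    [nonreal], identified by [lim_within]. *)
Lemma fext_conj z : Uext (f : C -> C) z -> fext (f : C -> C) (conjc z) = conjc (fext (f : C -> C) z).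
Proof.
move=> Uz; have [_ _ sf] := hf.
have nr w : Uext (f : C -> C) w -> nonreal (w : C) -> fext (f : C -> C) (conjc w) = conjc (fext (f : C -> C) w).
  move=> Uw wn; have aw : analyticity_domain (f : C -> C) w.
    case: Uw => // -[a [b [ar _ /andP[+ _] _]]]; rewrite ltcE => /andP[/eqP ia _].
    have aI : Im a = 0 by apply/eqP; rewrite -num_realE.
    by move/nonrealP: wn; rewrite ia aI eqxx.
  by rewrite !fext_nonreal //; [exact: sf|exact: (analyticity_domain_conj aw).1].
have h : cnear z (fun w => nonreal (w : C) -> fext (f : C -> C) (conjc w) = conjc (fext (f : C -> C) w)).
  by apply: cnearW (Uext_open Uz) => w Uw; exact: nr.
have c1 : ccont (fun w => fext (f : C -> C) (conjc w)) z.
  by apply: ccont_comp; [exact: ccont_conj|apply: cdiff_cont; apply: fext_holo; exact: Uext_conj].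
have c2 : ccont (fun w => conjc (fext (f : C -> C) w)) z.
  by apply: ccont_comp; [apply: cdiff_cont; exact: fext_holo|exact: ccont_conj].
have e1 := lim_within (D := @nonreal C) c1 (cnearW (fun w _ _ => erefl) (cnear_cball z ltr01)) (@nonreal_dense z).
by have := lim_within (D := @nonreal C) c2 h (@nonreal_dense z); rewrite e1.
Qed.

Lemma meromorphic_nonreal z : nonreal (z : C) -> analytic_at (f : C -> C) z \/ pole_at (f : C -> C) z.
Proof.
have [[mu _] [ml _] _] := hf; move=> /nonrealP; case: (ltgtP (Im z) 0) => // h _.
  by apply: ml; apply/lower_halfP.
by apply: mu; apply/upper_halfP.
Qed.

Lemma punctured_analytic z : nonreal (z : C) -> cnear z (fun w => w != z -> Uext (f : C -> C) w).
Proof.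
move=> zn; have h : cnear z (fun w => w != z -> cdiff f w).
  by case: (meromorphic_nonreal zn) => [/analytic_atP|/pole_atP[]] // h; apply: cnearW h.
case: (cnearI (nonreal_open zn) h) => e e0 he; exists e => // w wz nwz.
left; split; first by case: (he w wz).
apply/analytic_atP; apply: cnearW (cnearI (cnear_open wz) (cnear_neq nwz)) => u [uz nuz].
by case: (he u uz) => _; exact.
Qed.

Lemma Uext_nonempty : exists z, Uext (f : C -> C) z.
Proof.
have zn : nonreal (Complex 0 1 : C) by apply/nonrealP; rewrite /= oner_eq0.
case: (punctured_analytic zn) => e e0 h; have e2 : 0 < e / 2 by rewrite divr_gt0.
exists (Complex 0 1 + ((e / 2)%:C)%C); apply: h.
  by rewrite addrC addKr cmod_real ger0_norm ?(ltW e2) //; lra.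
by rewrite -subr_eq0 addrC addKr -cmod_eq0 cmod_real normr_eq0 gt_eqF.
Qed.

(** At a pole |f| exceeds |h z| + 1 on a punctured neighbourhood, which the continuous function [h]
    cannot do. *)
Lemma not_pole z h (e : R) : nonreal (z : C) -> 0 < e -> ccont h z ->
  (forall w, cmod (w - z) < e -> Uext (f : C -> C) w -> fext (f : C -> C) w = h w) -> analytic_at (f : C -> C) z.
Proof.
move=> zn e0 ch he; case: (meromorphic_nonreal zn) => // /pole_atP[_ inf].
have := cnearI (cnearI (inf (cmod (h z) + 1)) (ccont_bounded ch)) (cnearI (punctured_analytic zn) (cnearI (nonreal_open zn) (cnear_cball z e0))).
case=> e1 e10 H; have e2 : 0 < e1 / 2 by rewrite divr_gt0.
have [] := H (z + ((e1 / 2)%:C)%C).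
  by rewrite addrC addKr cmod_real ger0_norm ?(ltW e2) //; lra.
have ne : z + ((e1 / 2)%:C)%C != z.
  by rewrite -subr_eq0 addrC addKr -cmod_eq0 cmod_real normr_eq0 gt_eqF.
move=> [/(_ ne) h1 h2] [/(_ ne) Uw [wn we]].
by move: h1; rewrite -(fext_nonreal f wn) he // ltNge (ltW h2).
Qed.

(** A holomorphic continuation of [fext] to a ball rules out poles in it, and if the centre is real
    it extends [f] through an interval. By this maximality, points of the resolvent set are shown to
    lie in [Uext]. *)
Lemma Uext_extension z h (e : R) : 0 < e -> (forall w, cmod (w - z) < e -> cdiff h w) ->
  (forall w, cmod (w - z) < e -> Uext (f : C -> C) w -> fext (f : C -> C) w = h w) -> Uext (f : C -> C) z.
Proof.
move=> e0 hh he.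
have an w : nonreal (w : C) -> cmod (w - z) < e -> analytic_at (f : C -> C) w.
  move=> wn wz; case: (cnear_open wz) => e1 e10 h1.
  apply: (not_pole wn e10 (cdiff_cont (hh w wz))) => u uw; apply: he; exact: h1.
have [zn|/negPn/eqP zi] := boolP (Im z != 0).
  have zn' : nonreal (z : C) by apply/nonrealP.
  by left; split=> //; apply: an => //; rewrite subrr cmod0.
right; exists (z - ((e / 2)%:C)%C), (z + ((e / 2)%:C)%C).
have e2 : 0 < e / 2 by rewrite divr_gt0.
split.
- by rewrite num_realE ImB zi subr0.
- by rewrite num_realE ImD zi addr0.
- by rewrite ltrBlDr ltrDl -[0]/((0%:C)%C) ltcR e2.
exists (cball z e), h; split.
- by apply/openP => w; exact: cnear_open.
- move=> t /=; rewrite !ltcE ImB ImD ReB ReD zi /= => /andP[/andP[/eqP ti t1] /andP[_ t2]].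
  rewrite /cball /=; apply: le_lt_trans (cmod_le_ReIm _) _; rewrite ReB ImB zi ti !subrr normr0 addr0.
  by rewrite ltr_norml; lra.
- move=> w wz; apply/analytic_atP; apply: cnearW (cnear_open wz) => u; exact: hh.
- move=> w wz wn; rewrite -(fext_nonreal f wn); apply: he => //; left; split=> //; exact: an.
Qed.
End ExtendedFunction.
(** * The realization *)

Section Realization.
Variables (R : realType) (O : set R[i]) (oO : copen O) (symO : forall z, O z -> O (conjc z)).
Variable phi : R[i] -> R[i].
Hypothesis sphi : forall z, O z -> phi (conjc z) = conjc (phi z).
Variables (M : hilbert R) (J : M -> M) (E : M -> R[i] -> R[i]) (nn : R[i] -> M) (d : R[i] -> M -> M).
Hypotheses (lJ : lin J) (sJ : selfadj J) (JJ : forall x, J (J x) = x).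
Hypotheses (lE : forall a x y, E (a *: x + y) = a *: E x + E y) (injE : forall x, E x = 0 -> x = 0).
Hypotheses (hE : forall x, holo O (E x)) (outE : forall x z, ~ O z -> E x z = 0).
Hypothesis hnn : forall w, O w -> E (nn w) = zero_ext O (diff_quot (conjc w) phi) /\ forall x, E x w = ip (J x) (nn w).
Hypothesis hd : forall u, O u ->
  [/\ lin (d u), exists b, bnd (d u) b & forall x, E (d u x) = diff_quot_op O u (E x)].
Implicit Types (x y p q : M) (z w u s : R[i]).

Local Notation K := (cKrein lJ sJ JJ lE injE).

Lemma E_lin a x y z : E (a *: x + y) z = a * E x z + E y z. Proof. by rewrite lE. Qed.
Lemma E_sub x y z : E (x - y) z = E x z - E y z.
Proof. by rewrite -scaleN1r addrC E_lin mulN1r addrC. Qed.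
Lemma E_scale a x z : E (a *: x) z = a * E x z.
Proof. by rewrite (EZ lE). Qed.

(** Two exceptional points are allowed since difference quotients at two base points get compared;
    continuity fills both in. *)
Lemma E_ext2 a b x y : (forall z, O z -> z != a -> z != b -> E x z = E y z) -> x = y.
Proof.
move=> h; apply: (E_inj lE injE); apply/funext => z; case: (EM (O z)) => [Oz|nO]; last by rewrite !outE.
apply: (ccont_unique (cdiff_cont (hE x Oz)) (cdiff_cont (hE y Oz))).
have [za|za] := eqVneq z a; have [zb|zb] := eqVneq z b.
- by apply: cnearW (oO Oz) => w Ow wz; apply: h; rewrite // -?za -?zb.
- by apply: cnearW (cnearI (oO Oz) (cnear_neq zb)) => w [Ow wb] wz; apply: h; rewrite // -?za.
- by apply: cnearW (cnearI (oO Oz) (cnear_neq za)) => w [Ow wb] wz; apply: h; rewrite // -?zb.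
by apply: cnearW (cnearI (oO Oz) (cnearI (cnear_neq za) (cnear_neq zb))) => w [Ow [wa wb]] _; exact: h.
Qed.

Lemma E_dK u x z : O u -> O z -> E (d u x) z * (z - u) = E x z - E x u.
Proof. by move=> Ou Oz; have [_ _ ->] := hd Ou; rewrite /diff_quot_op zero_ext_in // diff_quotK. Qed.

Lemma E_nn w s : O w -> O s -> E (nn w) s = diff_quot (conjc w) phi s.
Proof. by move=> Ow Os; rewrite (hnn Ow).1 zero_ext_in. Qed.

(** After multiplication by (z - u)(z - w) both sides are combinations of the values of [E x] at z,
    u and w. *)
Lemma resolvent_identity u w x : O u -> O w -> d w x - d u x = (w - u) *: d w (d u x).
Proof.
move=> Ou Ow; apply: (@E_ext2 u w) => z Oz zu zw.
apply: (mulIf (x := (z - u) * (z - w))); first by rewrite mulf_neq0 // subr_eq0.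
have e1 := E_dK x Ou Oz; have e2 := E_dK x Ow Oz; have e3 := E_dK (d u x) Ow Oz; have e4 := E_dK x Ou Ow.
rewrite E_sub E_scale.
transitivity (E (d w x) z * (z - w) * (z - u) - E (d u x) z * (z - u) * (z - w)); first by ring.
transitivity ((w - u) * (z - u) * (E (d w (d u x)) z * (z - w))); last by ring.
rewrite e3 mulrBr.
transitivity ((w - u) * (E (d u x) z * (z - u)) - (z - u) * (E (d u x) w * (w - u))); last by ring.
by rewrite e1 e2 e4; ring.
Qed.

Lemma nn_exchange u w : O u -> O w -> nn w - nn u = (conjc w - conjc u) *: d (conjc u) (nn w).
Proof.
move=> Ou Ow; have Ou' := symO Ou; have Ow' := symO Ow.
apply: (@E_ext2 (conjc u) (conjc u)) => s Os su _.
apply: (mulIf (x := s - conjc u)); first by rewrite subr_eq0.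
by rewrite E_sub E_scale -mulrA E_dK // !E_nn // dd_exchange.
Qed.

(** The form adjoint of D_u is D_{conj u}. Evaluation at [w] is pairing with [nn w], so the claim
    reduces to [nn_exchange]; the Hilbert adjoint D' turns it into an equality of vectors, which may
    be checked at the points w != u. *)
Lemma d_adjoint u x y : O u -> ip (J (d u x)) y = ip (J x) (d (conjc u) y).
Proof.
move=> Ou; have Ou' := symO Ou; have [lD [b bD] _] := hd Ou'.
have [D' [_ _ hD']] := adjoint_exists lD bD.
suff h : J (d u x) - D' (J x) = 0.
  apply/eqP; rewrite -subr_eq0; have -> : ip (J x) (d (conjc u) y) = ip (D' (J x)) y.
    by rewrite ip_conj hD' -ip_conj.
  by rewrite -ipBl h ip0l.
suff h : J (J (d u x) - D' (J x)) = 0 by rewrite -[LHS]JJ h (lin0 lJ).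
apply: (@E_ext2 u u) => w Ow wu _; have -> : E 0 w = 0 by rewrite (E0 lE).
rewrite (hnn Ow).2 JJ ipBl -(hnn Ow).2 ip_conj -hD' -ip_conj.
apply/eqP; rewrite subr_eq0; apply/eqP; apply: (mulIf (x := w - u)); first by rewrite subr_eq0.
rewrite E_dK // (hnn Ow).2 (hnn Ou).2 -ipBr nn_exchange // ipZr.
by rewrite conjcB !conjcK mulrC.
Qed.

Lemma kset_model x : kset K (E x). Proof. by exists x. Qed.
Lemma kform_model x y : kform K (E x) (E y) = ip (J x) y.
Proof. exact: (cformE J lE injE). Qed.

Lemma diff_quot_bounded u : O u -> bounded_operator K (diff_quot_op O u).
Proof. by move=> Ou; have [lD [b bD] e] := hd Ou; apply: (cbounded lJ sJ JJ lE injE lD bD) => x; rewrite e. Qed.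

Lemma model_reproducing w x : O w -> E x w = kform K (E x) (E (nn w)).
Proof. by move=> Ow; rewrite kform_model (hnn Ow).2. Qed.

Variables (z0 : R[i]) (Oz0 : O z0).

(** The relation whose resolvent at [z0] is [d z0]. It may be multivalued, since difference
    quotients annihilate constants, and is therefore given as a set of pairs. *)
Definition model_relation : set ((R[i] -> R[i]) * (R[i] -> R[i])) :=
  [set xy | exists p q, xy = (E p, E q) /\ p = d z0 (q - z0 *: p)].
Local Notation A := model_relation.

(** The resolvent identity makes the defining equation independent of the base point, so every point
    of [O] has its difference quotient as resolvent. *)
Lemma relation_point u w p q : O u -> O w -> p = d u (q - u *: p) -> p = d w (q - w *: p).
Proof.
move=> Ou Ow h; have [lD _ _] := hd Ow.
have -> : q - w *: p = (q - u *: p) - (w - u) *: p by rewrite scalerBl opprB addrA subrK.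
rewrite (linB lD) (linZ lD) {3}h -resolvent_identity // subKr //.
Qed.

Lemma relation_at w p q : O w -> A (E p, E q) <-> p = d w (q - w *: p).
Proof.
move=> Ow; split=> [[p' [q' [[/(E_inj lE injE) -> /(E_inj lE injE) ->] h]]]|h].
  exact: relation_point h.
by exists p, q; split=> //; exact: relation_point h.
Qed.

Lemma resolvent_model w : O w -> resolvent_rel A w = graph_on K (diff_quot_op O w).
Proof.
move=> Ow; have [lD _ hD] := hd Ow; apply/seteqP; split.
  move=> _ [_ [_ [[p [q [[-> ->] h]]] ->]]].
  have {}h : p = d w (q - w *: p) by apply/(relation_at p q Ow); exists p, q.
  rewrite /graph_on /= -(EZ lE) -(EB lE); split; first exact: kset_model.
  by rewrite -hD -h.
move=> [g h] [/= [x ->] ->]; rewrite -hD.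
exists (E (d w x)), (E (x + w *: d w x)); split; first by apply/(relation_at _ _ Ow); rewrite addrK.
by rewrite -(EZ lE) -(EB lE) addrK.
Qed.

Lemma model_relation_in : relation_in K A.
Proof.
split; last by move=> _ _ [p [q [[-> ->] _]]]; split; exact: kset_model.
have [lD _ _] := hd Oz0; split.
  exists 0, 0; split; first by rewrite (E0 lE).
  by rewrite scaler0 subr0 (lin0 lD).
move=> a _ _ [p [q [-> h]]] [p' [q' [-> h']]].
exists (a *: p + p'), (a *: q + q'); split; first by rewrite !lE.
rewrite {1}h {1}h' -lD; congr (d z0 _).
by rewrite [z0 *: (_ + _)]scalerDr opprD addrACA scalerBr !scalerA mulrC.
Qed.

(** Inclusion in the adjoint is [d_adjoint] combined with a change of base point to [conjc z0].
    Conversely, a pair in the adjoint is tested against (d z0 x, x + z0 d z0 x), which lies in the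
    relation for every x. *)
Lemma model_self_adjoint : self_adjoint K A.
Proof.
split; first exact: model_relation_in.
have Oz0' := symO Oz0; have [lD _ _] := hd Oz0.
apply/seteqP; split.
  move=> _ [a [b [-> h]]]; split=> /=; [exact: kset_model|exact: kset_model|].
  move=> _ _ [p [q [[-> ->] hp]]]; rewrite !(cformE J lE injE).
  have ha : a = d (conjc z0) (b - conjc z0 *: a) by exact: (relation_point Oz0 Oz0' h).
  have := d_adjoint (b - conjc z0 *: a) (q - z0 *: p) Oz0'.
  rewrite -ha conjcK -hp ipBr ipZr (linB lJ) (linZ lJ) ipBl ipZl.
  by move=> /addIr.
move=> [g h] [/= [a ->] [b ->] H].
apply/(relation_at a b Oz0').
suff : J a = J (d (conjc z0) (b - conjc z0 *: a)) by move=> /(congr1 J); rewrite !JJ.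
apply: ip_injl => x; rewrite (d_adjoint _ _ Oz0') conjcK (linB lJ) (linZ lJ) ipBl ipZl.
have := H (E (d z0 x)) (E (x + z0 *: d z0 x)).
rewrite !(cformE J lE injE) ipDr ipZr => <-; first by rewrite addrK.
by apply/(relation_at _ _ Oz0); rewrite addrK.
Qed.

Lemma resolventE w x : O w -> resolvent A w (E x) = E (d w x).
Proof.
move=> Ow; have [_ _ hD] := hd Ow; rewrite /resolvent (resolvent_model Ow).
case: xgetP => [y _ [_ /= ->]|/(_ (E (d w x))) []]; first by rewrite -hD.
by split=> /=; [exact: kset_model|rewrite hD].
Qed.

(** [nn_exchange] cancels the starting vector against the resolvent term. As w runs through [O] one
    obtains all kernel functions, so minimality becomes their density. *)
Lemma gamma_model w : O w -> gamma A z0 w (E (nn (conjc z0))) = E (nn (conjc w)).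
Proof.
move=> Ow; rewrite /gamma resolventE // -(EZ lE) -(ED lE); congr E.
have := nn_exchange (symO Ow) (symO Oz0); rewrite !conjcK -[w - z0]opprB scaleNr => <-.
by rewrite opprB addrC subrK.
Qed.

Lemma realization_formula w : O w ->
  phi w = conjc (phi z0) + (w - conjc z0) * kform K (gamma A z0 w (E (nn (conjc z0)))) (E (nn (conjc z0))).
Proof.
move=> Ow; have Oz0' := symO Oz0; rewrite gamma_model // -model_reproducing // E_nn ?conjcK //; last exact: symO.
by rewrite -opprB mulNr mulrC diff_quotK opprB sphi // addrC subrK.
Qed.

(** The vector that [riesz] finds for pairing with x lies in the closure of the span. It equals x,
    because a vector orthogonal to all kernel vectors becomes, after applying [J], the zero
    function. *)
Lemma model_dense : (forall w, resolvent_set K A w -> O w) -> (forall w, O w -> resolvent_set K A w) ->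
  kdense K (lspan [set gamma A z0 z (E (nn (conjc z0))) | z in resolvent_set K A]).
Proof.
move=> rO Or; set L := lspan _.
have LK : L `<=` kset K.
  apply: smallest_sub; first exact: crange_subspace.
  by move=> _ [w /rO Ow <-]; rewrite gamma_model //; exact: kset_model.
have L0 : is_subspace L.
  split; first by move=> S [S0 _]; exact: S0.1.
  by move=> a g h Lg Lh S [S0 hS]; apply: S0.2; [exact: Lg|exact: Lh].
have nL w : O w -> L (E (nn w)).
  move=> Ow S [_ hS]; apply: hS; exists (conjc w); first by apply: Or; exact: symO.
  by rewrite gamma_model ?conjcK //; exact: symO.
split=> //; exists (Kp J E), (Km J E); split; first exact: cdecomposition.
move=> _ [x ->] e; rewrite ltcE => /andP[/eqP /= ei er].
have sW : is_subspace (fun y => L (E y)).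
  split; first by rewrite (E0 lE); exact: L0.1.
  by move=> a y y' Ly Ly'; rewrite lE; apply: L0.2.
have [|||m [hm _ [y [Ly ym]]]] := @riesz R M (fun y => L (E y)) (fun y => ip y x) (nr x) sW.
- exact: nr_ge0.
- by move=> a y y' _ _; exact: ip_linear.
- by move=> y _; rewrite mulrC; exact: ip_CS_nr.
have xm : x = m.
  apply/eqP; rewrite -subr_eq0; apply/eqP; rewrite -[LHS]JJ -[RHS](lin0 lJ); congr J.
  apply: (@E_ext2 0 0) => w Ow _ _; rewrite (hnn Ow).2 JJ (E0 lE) ip_conj ipBr (hm _ (nL w Ow)).
  by rewrite subrr conjc0.
have [N /(_ N (leqnn N)) hN] := ym _ er.
exists (E (y N)); first exact: Ly.
by rewrite -(EB lE) (cknorm lJ sJ JJ lE injE) ltcE /= ei eqxx /= nrB xm.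
Qed.
End Realization.
(** * The resolvent set *)

(** It combines Cauchy-Schwarz on the positive part with that on the negative part of a Krein
    space. *)
Lemma CS_sum (R : realType) (A B a a' b b' : R) : 0 <= A -> 0 <= B -> 0 <= a -> 0 <= a' -> 0 <= b -> 0 <= b' ->
  A ^+ 2 <= a * a' -> B ^+ 2 <= b * b' -> (A + B) ^+ 2 <= (a + b) * (a' + b').
Proof.
move=> A0 B0 a0 a'0 b0 b'0 P Q.
have AB : 2 * (A * B) <= a * b' + a' * b.
  apply: sqr_le_of_le2; first by rewrite addr_ge0 ?mulr_ge0.
  have h1 : (A * B) ^+ 2 <= (a * a') * (b * b').
    by rewrite exprMn; apply: ler_pM => //; exact: sqr_ge0.
  have -> : (2 * (A * B)) ^+ 2 = 4 * (A * B) ^+ 2 by ring.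
  have -> : (a * b' + a' * b) ^+ 2 = 4 * (a * a' * (b * b')) + (a * b' - a' * b) ^+ 2 by ring.
  by apply: ler_wpDr; [exact: sqr_ge0|exact: ler_wpM2l].
have -> : (A + B) ^+ 2 = A ^+ 2 + B ^+ 2 + 2 * (A * B) by ring.
have -> : (a + b) * (a' + b') = a * a' + b * b' + (a * b' + a' * b) by ring.
by apply: lerD => //; exact: lerD.
Qed.

Section KreinNorm.
Variables (R : realType) (V : lmodType R[i]) (K : kreinSpace V) (Sp Sm : set V).
Hypothesis dec : fundamental_decomposition (kset K) (kform K) Sp Sm.
Local Notation Re := (@complex.Re R).
Implicit Types x y : V.

Definition kn x : R := Re (knorm K Sp Sm x).

Lemma kform_linear a x y z : kset K x -> kset K y -> kset K z ->
  kform K (a *: x + y) z = a * kform K x z + kform K y z.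
Proof. exact: (kform_hermitian K).1. Qed.

Lemma kform_conj x y : kset K x -> kset K y -> kform K y x = conjc (kform K x y).
Proof. exact: (kform_hermitian K).2. Qed.

Lemma kformDl x y z : kset K x -> kset K y -> kset K z ->
  kform K (x + y) z = kform K x z + kform K y z.
Proof. by move=> Kx Ky Kz; have := kform_linear 1 Kx Ky Kz; rewrite scale1r mul1r. Qed.

Lemma hilbert_form_ge0 (S : set V) form y : is_hilbert S form -> S y -> 0 <= Re (form y y).
Proof.
move=> [[S0 _] [fl _] pos _] Sy; have [->|y0] := eqVneq y 0.
  by have := fl (-1) 0 0 0 S0 S0 S0; rewrite scaler0 addr0 mulN1r addNr => ->.
by have := pos y Sy y0; rewrite ltcE /= => /andP[_ /ltW].
Qed.

Lemma knorm_components x : kset K x -> exists p m,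
  [/\ Sp p /\ Sm m, x = p + m, knorm K Sp Sm x = ((kn x)%:C)%C, 0 <= kn x &
      kn x ^+ 2 = Re (kform K p p) - Re (kform K m m)].
Proof.
move=> Kx; have [_ ex _ hp hm] := dec.
pose p := xget 0 [set p | Sp p /\ Sm (x - p)].
have [hSp hSm] : Sp p /\ Sm (x - p).
  rewrite /p; case: xgetP => [q _ //|/=].
  have [q [r [Sq Sr e]]] := ex x Kx; move=> /(_ q)[]; split=> //.
  by rewrite e addrC addKr.
pose m := x - p; rewrite -/m in hSm.
have p0 := hilbert_form_ge0 hp hSp.
have m0 : 0 <= - Re (kform K m m) by have := hilbert_form_ge0 hm hSm; rewrite /=; case: (kform K m m).
have s0 : 0 <= Re (kform K p p) - Re (kform K m m) by exact: addr_ge0.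
have [_ hhp _ _] := hp; have [_ hhm _ _] := hm.
have e : knorm K Sp Sm x = ((Num.sqrt (Re (kform K p p) - Re (kform K m m)))%:C)%C.
  have -> : knorm K Sp Sm x = sqrtC (((Re (kform K p p) - Re (kform K m m))%:C)%C).
    rewrite /knorm -/p -/m; congr (sqrtC _).
    rewrite (form_self hhp hSp); have := form_self hhm hSm => /= h.
    by rewrite h real_cD; congr (_ + _); case: (kform K m m) h.
  rewrite -{1}(sqr_sqrtr s0).
  move: (Num.sqrt _) (sqrtr_ge0 (Re (kform K p p) - Re (kform K m m))) => t t0.
  rewrite (_ : ((t ^+ 2)%:C)%C = (t%:C)%C ^+ 2); last by rewrite expr2 real_cM -expr2.
  by rewrite sqrCK // lecR.
exists p, m; split=> //; first by rewrite /m addrC subrK.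
- by rewrite /kn e.
- by rewrite /kn e /= sqrtr_ge0.
- by rewrite /kn e /= sqr_sqrtr.
Qed.

Lemma kn_ge0 x : kset K x -> 0 <= kn x.
Proof. by move=> /knorm_components[p [m []]]. Qed.
Lemma knormE x : kset K x -> knorm K Sp Sm x = ((kn x)%:C)%C.
Proof. by move=> /knorm_components[p [m []]]. Qed.

(** The parts of opposite sign are orthogonal, and Cauchy-Schwarz holds on each. An arbitrary
    decomposition is allowed, as the one that witnesses boundedness in [resolvent_set] may differ
    from that of the model. *)
Lemma kform_bound x y : kset K x -> kset K y -> cmod (kform K x y) <= kn x * kn y.
Proof.
move=> Kx Ky; have [[SpK SmK] _ [_ orth] hp hm] := dec.
have [p [m [[Spp Smm] ex _ kx0 kx]]] := knorm_components Kx.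
have [p' [m' [[Spp' Smm'] ey _ ky0 ky]]] := knorm_components Ky.
have Kp := SpK _ Spp; have Km := SmK _ Smm; have Kp' := SpK _ Spp'; have Km' := SmK _ Smm'.
have KD a b : kset K a -> kset K b -> kset K (a + b).
  by move=> Ka Kb; have := (kset_subspace K).2 1 a b Ka Kb; rewrite scale1r.
have -> : kform K x y = kform K p p' + kform K m m'.
  rewrite {1}ex kformDl // (kform_conj Ky Kp) (kform_conj Ky Km) ey !kformDl //.
  rewrite !conjcD -!kform_conj // (orth p m') // (kform_conj Kp' Km) (orth p' m) // conjc0; ring.
have [sp hhp _ _] := hp; have [sm hhm _ _] := hm.
have P := psd_CS_on sp hhp (fun t => hilbert_form_ge0 hp) Spp Spp'.
have Q := psd_CS_on sm hhm (fun t => hilbert_form_ge0 hm) Smm Smm'.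
have p0 := hilbert_form_ge0 hp Spp; have p'0 := hilbert_form_ge0 hp Spp'.
have m0 := hilbert_form_ge0 hm Smm; have m'0 := hilbert_form_ge0 hm Smm'.
move: Q m0 m'0; rewrite /= cmodN.
have rN z : Re (- z) = - Re z by case: z.
rewrite !rN => Q m0 m'0.
apply: sqr_le_of_le2; first by rewrite mulr_ge0.
rewrite exprMn kx ky; apply: (@le_trans _ _ ((cmod (kform K p p') + cmod (kform K m m')) ^+ 2)).
  by rewrite ler_sqr ?nnegrE ?addr_ge0 ?cmod_ge0 // cmodD.
apply: CS_sum => //; exact: cmod_ge0.
Qed.

(** The constant in [bounded_operator] is an element of [R[i]]; comparing real parts allows it to be
    replaced by its modulus. *)
Lemma kn_bound (T : V -> V) (M : R[i]) : (forall x, kset K x -> kset K (T x)) ->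
  (forall x, kset K x -> knorm K Sp Sm (T x) <= M * knorm K Sp Sm x) ->
  forall x, kset K x -> kn (T x) <= cmod M * kn x.
Proof.
move=> KT hT x Kx; have := hT x Kx; rewrite !knormE //; last exact: KT.
rewrite lecE => /andP[_]; rewrite mulrC Re_real_cM /= mulrC => h; apply: le_trans h _.
by apply: ler_wpM2r; [exact: kn_ge0|apply: le_trans (ler_norm _) (Re_le_cmod _)].
Qed.
End KreinNorm.

Section PowerSeries.
Variables (R : realType) (c : nat -> R[i]) (z0 : R[i]) (C m : R).
Hypotheses (C0 : 0 <= C) (m0 : 0 < m) (hc : forall n, cmod (c n) <= C * m ^+ n).
Local Notation P N w := (\sum_(n < N) c n * (w - z0) ^+ n).

Lemma cdiff_exp n w : cdiff (fun u : R[i] => (u - z0) ^+ n) w.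
Proof.
elim: n => [|n IH]; first exact: cdiff_cst.
have -> : (fun u : R[i] => (u - z0) ^+ n.+1) = (fun u => (u - z0) * (u - z0) ^+ n).
  by apply/funext => u; rewrite exprS.
by apply: cdiffM => //; apply: cdiffB; [exact: cdiff_id|exact: cdiff_cst].
Qed.

Lemma cdiff_partial_sum N w : cdiff (fun u => P N u) w.
Proof.
elim: N => [|N IH].
  have -> : (fun u => P 0 u) = (fun=> 0) by apply/funext => u; rewrite big_ord0.
  exact: cdiff_cst.
have -> : (fun u => P N.+1 u) = (fun u => P N u + c N * (u - z0) ^+ N).
  by apply/funext => u; rewrite big_ord_recr.
by apply: cdiffD => //; apply: cdiffZ; exact: cdiff_exp.
Qed.

Lemma small_power n w : cmod (w - z0) < (2 * m)^-1 -> m ^+ n * cmod (w - z0) ^+ n <= 2^-1 ^+ n.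
Proof.
move=> h; rewrite -exprMn; apply: lerXn2r; rewrite ?nnegrE ?mulr_ge0 ?cmod_ge0 ?(ltW m0) ?invr_ge0 //.
apply: (@le_trans _ _ (m * (2 * m)^-1)); first by apply: ler_wpM2l; exact: ltW.
by rewrite le_eqVlt; apply/orP; left; apply/eqP; field; rewrite gt_eqF.
Qed.

Lemma partial_sum_tail N k w : cmod (w - z0) < (2 * m)^-1 -> cmod (P (N + k)%N w - P N w) <= 2 * C * 2^-1 ^+ N.
Proof.
move=> h; apply: (@le_trans _ _ (2 * C * (2^-1 ^+ N - 2^-1 ^+ (N + k)))); last first.
  by apply: ler_wpM2l; [exact: mulr_ge0|rewrite gerBl exprn_ge0 // invr_ge0].
elim: k => [|k IH]; first by rewrite addn0 !subrr mulr0 cmod0.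
rewrite addnS big_ord_recr /= addrAC; apply: le_trans (cmodD _ _) _.
have hk : cmod (c (N + k)%N * (w - z0) ^+ (N + k)) <= C * 2^-1 ^+ (N + k).
  rewrite cmodM cmodX; apply: (@le_trans _ _ (C * m ^+ (N + k) * cmod (w - z0) ^+ (N + k))).
    by apply: ler_wpM2r => //; rewrite exprn_ge0 // cmod_ge0.
  by rewrite -mulrA; apply: ler_wpM2l => //; exact: small_power.
apply: le_trans (lerD IH hk) _; rewrite exprS.
by rewrite le_eqVlt; apply/orP; left; apply/eqP; field.
Qed.

Lemma pow2_small (e K : R) : 0 < e -> 0 <= K -> exists N, forall n, (N <= n)%N -> K * 2^-1 ^+ n < e.
Proof.
move=> e0 K0; have [N hN] := exists_pow2_gt (K / e); exists N => n Nn.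
have p2 j : (0 : R) < 2 ^+ j by exact: exprn_gt0.
rewrite exprVn ltr_pdivrMr // mulrC -ltr_pdivrMr //; apply: lt_le_trans hN _.
by apply: ler_weXn2l => //; lra.
Qed.

(** On a disc of half the guaranteed radius of convergence the n-th term is at most C 2^-n, so the
    partial sums converge uniformly and [holo_limit] applies. *)
Lemma power_series : exists h, (forall w, cmod (w - z0) < (2 * m)^-1 -> cdiff h w) /\
  forall w N, cmod (w - z0) < (2 * m)^-1 -> cmod (h w - P N w) <= 2 * C * 2^-1 ^+ N.
Proof.
pose O := cball z0 (2 * m)^-1.
have C2 : 0 <= 2 * C by exact: mulr_ge0.
have /boolp.choice[h hh] : forall w, exists l, O w -> clim (fun N => P N w) l.
  move=> w; case: (EM (O w)) => [Ow|]; last by exists 0.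
  have [l hl] : exists l, clim (fun N => P N w) l; last by exists l.
  apply: clim_cauchy => e e0; have e2 : 0 < e / 2 by rewrite divr_gt0.
  have [N hN] := pow2_small e2 C2; exists N => i j Ni Nj.
  apply: le_lt_trans (cmod_triangle (P N w) _ _) _; rewrite (cmodB (P N w)).
  have := partial_sum_tail N (i - N) Ow; have := partial_sum_tail N (j - N) Ow; rewrite !subnKC //.
  by have := hN N (leqnn N); lra.
have hb w N : O w -> cmod (h w - P N w) <= 2 * C * 2^-1 ^+ N.
  move=> Ow; apply/ler_addgt0Pr => e e0; have [N' hN'] := hh w Ow e e0.
  apply: le_trans (cmod_triangle (P (N + N')%N w) _ _) _; rewrite addrC; apply: lerD.
    exact: partial_sum_tail.
  by rewrite cmodB; apply: ltW; apply: hN'; exact: leq_addl.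
exists h; split=> [w Ow|]; last by [].
have oO : copen O by move=> u; exact: cnear_open.
apply: (holo_limit oO (F := h)) => // z Oz; exists 1 => // e e0.
have [N hN] := pow2_small e0 C2; exists (fun w => P N w); first by move=> u _; exact: cdiff_partial_sum.
by move=> u _ Ou; apply: le_lt_trans (hb u N Ou) (hN N (leqnn N)).
Qed.
End PowerSeries.

(** * Analyticity of the resolvent by Neumann series *)

Section ResolventExpansion.
Variables (R : realType) (V : lmodType R[i]) (K : kreinSpace V) (A : set (V * V)).
Implicit Types (x v g : V) (w z : R[i]).

(** If the resolvent at [w] is [T], the vector x = T v solves x = B v + (w - z) B x, where B is the
    resolvent at [z]; iterating gives the Neumann series. Its sum h is holomorphic on the whole
    ball, and the identity is asserted at the points where a resolvent is given. *)
Lemma resolvent_expansion z v : resolvent_set K A z -> kset K v ->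
  exists h, exists2 e : R, 0 < e & (forall w, cmod (w - z) < e -> cdiff h w) /\
    forall w T, cmod (w - z) < e -> bounded_operator K T -> resolvent_rel A w = graph_on K T ->
      kform K (T v) v = h w.
Proof.
move=> [B [KB LB [Sp [Sm [dec [b hb]]]]] hB] Kv.
have kb := kn_bound dec KB hb.
pose m := cmod b + 1; have m0 : 0 < m by rewrite ltr_wpDl ?cmod_ge0.
have KBn n x : kset K x -> kset K (iter n B x) by move=> Kx; elim: n => [|n IH] //=; exact: KB.
have kBn n x : kset K x -> kn K Sp Sm (iter n B x) <= m ^+ n * kn K Sp Sm x.
  move=> Kx; elim: n => [|n IH] /=; first by rewrite expr0 mul1r.
  apply: le_trans (kb _ (KBn n x Kx)) _; rewrite exprS -mulrA; apply: ler_pM => //.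
  - exact: cmod_ge0.
  - exact: kn_ge0 dec _ (KBn n x Kx).
  - by rewrite /m lerDl.
have LBn n a x y : kset K x -> kset K y -> iter n B (a *: x + y) = a *: iter n B x + iter n B y.
  by move=> Kx Ky; elim: n => [|n IH] //=; rewrite IH LB //; exact: KBn.
pose c n := kform K (iter n B (B v)) v.
pose C := kn K Sp Sm (B v) * kn K Sp Sm v.
have KBv := KB v Kv.
have C0 : 0 <= C by apply: mulr_ge0; exact: (kn_ge0 dec).
have hc n : cmod (c n) <= C * m ^+ n.
  apply: le_trans (kform_bound dec (KBn n _ KBv) Kv) _.
  have -> : C * m ^+ n = m ^+ n * kn K Sp Sm (B v) * kn K Sp Sm v by rewrite /C; ring.
  by apply: ler_wpM2r; [exact: (kn_ge0 dec)|exact: kBn].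
have [h [hh hP]] := power_series z C0 m0 hc.
exists h, (2 * m)^-1; first by rewrite invr_gt0 mulr_gt0.
split=> // w T wz [KT _ _] hT; have Kx := KT v Kv; set x := T v in Kx *.
have xE : x = (w - z) *: B x + B v.
  have : graph_on K T (v, x) by [].
  rewrite -hT => -[x' [y [Axy [ev ex]]]]; rewrite -ex in Axy ev.
  have : resolvent_rel A z (y - z *: x, x) by exists x, y.
  rewrite hB => -[_ /= {1}->]; rewrite -LB //; congr B.
  by rewrite ev scalerBl [RHS]addrC addrA subrK.
have key N : kform K x v = \sum_(n < N) c n * (w - z) ^+ n + (w - z) ^+ N * kform K (iter N B x) v.
  elim: N => [|N IH]; first by rewrite big_ord0 expr0 add0r mul1r.
  rewrite IH big_ord_recr /= -addrA; congr (_ + _).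
  have KBx := KB x Kx.
  rewrite {1}xE LBn // kform_linear //; [|exact: KBn..].
  by rewrite -iterSr -iterS exprS /c; ring.
have small N : cmod (kform K x v - h w) <= (2 * C + kn K Sp Sm x * kn K Sp Sm v) * 2^-1 ^+ N.
  apply: le_trans (cmod_triangle (\sum_(n < N) c n * (w - z) ^+ n) _ _) _.
  rewrite mulrDl addrC; apply: lerD; first by rewrite cmodB; exact: hP.
  rewrite (key N) addrAC subrr add0r cmodM cmodX.
  have hN := kform_bound dec (KBn N x Kx) Kv; have hx := kBn N x Kx.
  have kv0 := kn_ge0 dec Kv; have kx0 := kn_ge0 dec Kx.
  apply: (@le_trans _ _ (cmod (w - z) ^+ N * (m ^+ N * kn K Sp Sm x * kn K Sp Sm v))).
    apply: ler_wpM2l; first by rewrite exprn_ge0 // cmod_ge0.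
    by apply: le_trans hN _; apply: ler_wpM2r.
  have -> : cmod (w - z) ^+ N * (m ^+ N * kn K Sp Sm x * kn K Sp Sm v) = kn K Sp Sm x * kn K Sp Sm v * (m ^+ N * cmod (w - z) ^+ N) by ring.
  by apply: ler_wpM2l; [exact: mulr_ge0|exact: small_power].
apply/eqP; rewrite -subr_eq0 -cmod_eq0 eq_le cmod_ge0 andbT.
apply/ler_addgt0Pr => e e0; rewrite add0r.
have K0 : 0 <= 2 * C + kn K Sp Sm x * kn K Sp Sm v.
  by rewrite addr_ge0 ?mulr_ge0 ?(kn_ge0 dec).
have [N hN] := pow2_small e0 K0; exact: le_trans (small N) (ltW (hN N (leqnn N))).
Qed.
End ResolventExpansion.

(** * The modeling space and its realization *)

Section Assembly.
Variables (R : realType).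
Local Notation C := (R[i] : numClosedFieldType).

Lemma analytic_on_holo (O : set R[i]) (g : R[i] -> R[i]) : copen O -> holo O g -> analytic_on (O : set C) (g : C -> C).
Proof. by move=> oO hg z Oz; apply/analytic_atP; apply: cnearW (oO z Oz) => w; exact: hg. Qed.

(** The symmetry of [fext] replaces the conjugate of its value at w by its value at conjc w, which
    makes the kernel a difference quotient; the two definitions of the diagonal value coincide. *)
Lemma nevanlinna_kernelE (f : R[i] -> R[i]) z w : Nsym (f : C -> C) -> Uext (f : C -> C) w ->
  nevanlinna_kernel (f : C -> C) z w = diff_quot (conjc w : C) (fext (f : C -> C)) z.
Proof.
move=> hf Uw; rewrite /nevanlinna_kernel /diff_quot -[w^*]/(conjc w) -[(fext f w)^*]/(conjc (fext f w)).
by rewrite (fext_conj hf Uw); case: eqP => [->|_]; reflexivity.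
Qed.
End Assembly.

Theorem theorem3p1 (R : realType) (f : R[i] -> R[i]) (hf : Nsym f) :
  exists L : kreinSpace (R[i] -> R[i]),
    modeling_space (Uext f) f L /\
    exists (A : set ((R[i] -> R[i]) * (R[i] -> R[i]))) (v : R[i] -> R[i])
           (z0 : R[i]),
      associated_realization (Uext f) f L A v z0 /\
      resolvent_set L A = Uext f.
Proof.
set O := Uext f; pose phi : R[i] -> R[i] := fext f.
have oO : copen O by exact: Uext_open.
have symO z : O z -> O (conjc z) by exact: Uext_conj.
have hphi : holo O phi by exact: fext_holo.
have sphi z : O z -> phi (conjc z) = conjc (phi z) by exact: fext_conj.
have [M [J [E [nn [d [[lJ sJ JJ] [lE injE hE outE] hnn hd]]]]]] := krein_model oO symO hphi sphi.
have kerE w : O w -> zero_ext O (nevanlinna_kernel f ^~ w) = E (nn w).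
  move=> Ow; rewrite (hnn w Ow).1; apply: eq_zero_ext => z Oz.
  exact: nevanlinna_kernelE.
have an x : analytic_on O (E x) by apply: analytic_on_holo => //; exact: hE.
pose L := cKrein lJ sJ JJ lE injE.
have [z0 Oz0] : exists z0, O z0 by exact: Uext_nonempty.
exists L; split.
  split; [by []|exact: symO| |].
    split; first exact/openP.
    - move=> _ [x ->]; split; first exact: an.
      apply/funext => z; case: (EM (O z)) => [Oz|nO]; first by rewrite zero_ext_in.
      by rewrite zero_ext_out // outE.
    - by move=> w Ow; rewrite kerE //; exists (nn w).
    - by move=> _ w [x ->] Ow; rewrite kerE //; exact: (model_reproducing lJ sJ JJ lE injE hnn).
  by move=> w Ow; exact: (diff_quot_bounded lJ sJ JJ lE injE hd).
pose A := model_relation E d z0.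
pose v := E (nn (conjc z0)).
have Or w : O w -> resolvent_set L A w.
  move=> Ow; exists (diff_quot_op O w); first exact: (diff_quot_bounded lJ sJ JJ lE injE hd).
  exact: (resolvent_model oO lJ sJ JJ lE injE hE outE hd Oz0).
have form w : O w -> phi w = conjc (phi z0) + (w - conjc z0) * kform L (gamma A z0 w v) v.
  by move=> Ow; exact: (realization_formula oO symO sphi lJ sJ JJ lE injE hE outE hnn hd Oz0).
have Kv : kset L v by exists (nn (conjc z0)).
(* At a point of the resolvent set the right-hand side of the realization formula continues
   holomorphically by [resolvent_expansion], and it agrees with [fext] on the part of the ball
   inside [O]. *)
have rO w : resolvent_set L A w -> O w.
  move=> rw; have [h [e e0 [hh hT]]] := resolvent_expansion rw Kv.
  (* The realization formula with gamma expanded as v + (u - z0) R_u v, where h u stands for <R_u v,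
     v>. *)
  apply: (@Uext_extension R f hf w (fun u => conjc (phi z0) + (u - conjc z0) * ((u - z0) * h u + kform L v v)) e) => //.
    move=> u uw; apply: cdiffD; first exact: cdiff_cst.
    apply: cdiffM; first by apply: cdiffB; [exact: cdiff_id|exact: cdiff_cst].
    apply: cdiffD; last exact: cdiff_cst.
    by apply: cdiffM; [apply: cdiffB; [exact: cdiff_id|exact: cdiff_cst]|exact: hh].
  move=> u uw Ou; rewrite -/phi form //; congr (_ + _ * _).
  have bu := diff_quot_bounded lJ sJ JJ lE injE hd Ou.
  have ru := resolvent_model oO lJ sJ JJ lE injE hE outE hd Oz0 Ou.
  rewrite -(hT u _ uw bu ru) /gamma addrC /v.
  have [_ _ hD] := hd u Ou.
  rewrite (resolventE oO lJ sJ JJ lE injE hE outE hd Oz0) // -hD kform_linear //; exact: kset_model.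
exists A, v, z0; split; last by apply/seteqP; split=> w; [exact: rO|exact: Or].
split=> //.
- by rewrite kerE //; exact: symO.
- by move=> w Ow; exact: (resolvent_model oO lJ sJ JJ lE injE hE outE hd Oz0).
split; last exact: (model_dense oO symO hE outE hnn hd Oz0 rO Or).
split=> //.
- exact: analytic_on_holo.
- exact: (model_self_adjoint oO symO lJ sJ JJ lE injE hE outE hnn hd Oz0).
- by split=> //; exact: Or.
by move=> z [_ Oz]; exact: form.
Qed.
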